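(* Let $d\ge1$ and let $\mu_{\beta,h}$ denote the infinite-volume Ising measure on $\{-1,+1\}^{\mathbb Z^d}$. For a finite non-empty $\Delta\subset\mathbb Z^d$ let $M_\Delta=\sum_{i\in\Delta}\sigma_i$. (1) For all $h\ne0$ and $\beta>0$ there exists a constant $K=K(d,\beta,h)$ such that, for all finite non-empty subsets $\Delta$ of $\mathbb Z^d$, under $\mu_{\beta,h}$, $$d_{\mathrm{Kol}}\left(\frac{M_\Delta-\mathbb E[M_\Delta]}{\sqrt{\mathrm{Var}(M_\Delta)}}\,,\,\mathcal N_{\mathbb R}(0,1)\right)\le\frac{K}{\sqrt{|\Delta|}}.$$ (2) The same holds for $h=0$ and $\beta>0$ sufficiently small: there exists $\beta_1(d)>0$ such that for all $0<\beta<\beta_1(d)$ there is a constant $K=K(d,\beta)$ such that, for all finite non-empty subsets $\Delta$ of $\mathbb Z^d$, under $\mu_{\beta,0}$, $$d_{\mathrm{Kol}}\left(\frac{M_\Delta-\mathbb E[M_\Delta]}{\sqrt{\mathrm{Var}(M_\Delta)}}\,,\,\mathcal N_{\mathbb R}(0,1)\right)\le\frac{K}{\sqrt{|\Delta|}}.$$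
   Context: $d_{\mathrm{Kol}}(X,Y)=\sup_{a\in\mathbb R}|\mathbb P[X\le a]-\mathbb P[Y\le a]|$ is the Kolmogorov distance; $\mathcal N_{\mathbb R}(0,1)$ is the standard Gaussian law. Ising model: for a finite $\Lambda\subset\mathbb Z^d$, $\sigma\in\{-1,+1\}^\Lambda$, $\beta>0$ and $h\in\mathbb R$, set $\mathcal H^\Lambda_{\beta,h}(\sigma)=-\beta\sum_{\{i,j\}\subset\Lambda,\ \{i,j\}\in E_{\mathbb Z^d}}\sigma_i\sigma_j-h\sum_{i\in\Lambda}\sigma_i$, where $E_{\mathbb Z^d}$ is the set of nearest-neighbour edges of $\mathbb Z^d$, and let $\mu_{\beta,h,\Lambda}[\sigma]$ be proportional to $\exp(-\mathcal H^\Lambda_{\beta,h}(\sigma))$. For $h\ne0$, or for $h=0$ and $\beta$ smaller than a critical value $\beta_c(d)$, there is a unique limiting probability measure $\mu_{\beta,h}$ on $\{-1,+1\}^{\mathbb Z^d}$ as $\Lambda$ grows to $\mathbb Z^d$ (the unique infinite-volume Gibbs measure). *)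

(* Defs.v *)
From HB Require Import structures.
From mathcomp Require Import all_boot all_order all_algebra finmap.
From mathcomp Require Import all_classical all_reals all_analysis.
From mathcomp Require Import measurable_realfun.
Import Order.TTheory GRing.Theory Num.Theory.
Import numFieldNormedType.Exports.

Set Implicit Arguments.
Unset Strict Implicit.
Unset Printing Implicit Defensive.

Local Open Scope classical_set_scope.
Local Open Scope ring_scope.

Definition kolmogorov_dist (R : realType)
    (d1 : measure_display) (T1 : measurableType d1) (P : probability T1 R)
    (X : {RV P >-> R})
    (d2 : measure_display) (T2 : measurableType d2) (Q : probability T2 R)
    (Y : {RV Q >-> R}) : \bar R :=
  ereal_sup (range (fun a : R => `|cdf X a - cdf Y a|%E)).

(* Under a law Q on the real line, the identity is a random variable with
   law Q. *)
Definition id_rv (R : realType) : measurableTypeR R -> R := idfun.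

HB.instance Definition _ (R : realType) :=
  @isMeasurableFun.Build _ _ (measurableTypeR R) R (@id_rv R)
    (@measurable_id _ _ setT).

Definition std_gaussian (R : realType) : {RV (normal_prob (0 : R) 1) >-> R} :=
  @id_rv R.

(* 'E_P[X] and 'V_P[X] are extended reals; [fine] returns the real number when
   they are finite, in particular for bounded X. *)
Definition standardize (dT : measure_display) (T : measurableType dT)
    (R : realType) (P : probability T R) (X : {RV P >-> R}) : T -> R :=
  fun t => (X t - fine 'E_P[X]) / Num.sqrt (fine 'V_P[X]).

Lemma measurable_standardize (dT : measure_display) (T : measurableType dT)
    (R : realType) (P : probability T R) (X : {RV P >-> R}) :
  measurable_fun setT (standardize X).
Proof.
rewrite /standardize; apply: measurable_funM; last exact: measurable_cst.
by apply: measurable_funB => //; exact: measurable_cst.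
Qed.

HB.instance Definition _ (dT : measure_display) (T : measurableType dT)
    (R : realType) (P : probability T R) (X : {RV P >-> R}) :=
  @isMeasurableFun.Build _ _ T R (standardize X)
    (measurable_standardize X).

Notation lattice d := 'rV[int]_d.

Definition nearest_neighbour (d : nat) (i j : lattice d) : bool :=
  \sum_(k < d) `|i ord0 k - j ord0 k| == 1.

(* Spins are booleans: [true] stands for +1 and [false] for -1. *)
Definition spin (R : realType) (s : bool) : R := if s then 1 else -1.

Definition is_edge (d : nat) (L : {fset lattice d}) (e : {set L}) : bool :=
  [exists i : L, exists j : L,
    nearest_neighbour (val i) (val j) && (e == [set i; j]%SET)].

(* The first sum runs over the unordered pairs e = {i, j}, so that each edge is
   counted once. *)
Definition hamiltonian (R : realType) (d : nat) (beta h : R)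
    (L : {fset lattice d}) (s : {ffun L -> bool}) : R :=
  - beta * (\sum_(e : {set L} | is_edge e) \prod_(i in e) spin R (s i))
  - h * (\sum_(i : L) spin R (s i)).

Definition partition_function (R : realType) (d : nat) (beta h : R)
    (L : {fset lattice d}) : R :=
  \sum_(s : {ffun L -> bool}) expR (- hamiltonian beta h s).

Definition ising_pmf (R : realType) (d : nat) (beta h : R)
    (L : {fset lattice d}) (s : {ffun L -> bool}) : R :=
  expR (- hamiltonian beta h s) / partition_function beta h L.

Definition cylinder (d : nat) (D : {fset lattice d}) (eta : lattice d -> bool) :
    set (lattice d -> bool) :=
  [set w | forall i, i \in D -> w i = eta i].

Definition cylinders (d : nat) : set (set (lattice d -> bool)) :=
  [set A | exists D : {fset lattice d}, exists eta, A = cylinder D eta].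

(* The space {-1, +1}^(Z^d) with its product sigma-algebra. *)
Notation configuration d := (g_sigma_algebraType (@cylinders d)).

(* Probability, under the Ising measure in the finite volume L, of the event
   that the configuration agrees with eta on D.  Sites of D outside L are
   ignored; there are none once L contains D. *)
Definition ising_cylinder (R : realType) (d : nat) (beta h : R)
    (D : {fset lattice d}) (eta : lattice d -> bool) (L : {fset lattice d}) : R :=
  \sum_(s : {ffun L -> bool} |
      [forall i : L, (val i \in D) ==> (s i == eta (val i))])
    ising_pmf beta h s.

Definition exhaustion (d : nat) : set_system {fset lattice d} :=
  filter_from setT (fun L0 => [set L | (L0 `<=` L)%fset]).

(* mu is the limit of the finite-volume Ising measures as L grows to Z^d, in the
   sense of convergence of the probabilities of all cylinder events. *)
Definition infinite_volume_ising (R : realType) (d : nat) (beta h : R)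
    (mu : probability (configuration d) R) : Prop :=
  forall (D : {fset lattice d}) (eta : lattice d -> bool),
    ising_cylinder beta h D eta L @[L --> @exhaustion d]
      --> fine (mu (cylinder D eta)).

Definition magnetization (R : realType) (d : nat) (D : {fset lattice d}) :
    configuration d -> R :=
  fun w => \sum_(i <- D) spin R (w i).

Lemma measurable_magnetization (R : realType) (d : nat) (D : {fset lattice d}) :
  measurable_fun setT (magnetization R D).
Proof.
apply: measurable_sum => i.
have mi : measurable ([set w | w i = true] : set (configuration d)).
  apply: sub_sigma_algebra; exists [fset i]%fset, (fun=> true).
  apply/seteqP; split => w /=.
    by move=> wi j; rewrite inE => /eqP ->.
  by apply; rewrite inE.
have -> : (fun w : configuration d => spin R (w i)) =
    (fun w => if w i then cst 1 w else cst (-1) w).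
  by [].
apply: measurable_fun_ifT => //.
apply: (@measurable_fun_bool _ _ _ _ true).
by rewrite setTI.
Qed.

HB.instance Definition _ (R : realType) (d : nat) (D : {fset lattice d}) :=
  @isMeasurableFun.Build _ _ (configuration d) R
    (magnetization R D) (@measurable_magnetization R d D).

(* Main.v *)
(* Let S be the number of + spins in Delta and n = |Delta|.  The generating
   function P(w) = E[w^S] has no zero in a disc |w - 1| < r, with r independent
   of Delta and of the volume: for h <> 0 this is the Lee-Yang theorem (fields
   off the unit circle, by Asano contractions); for h = 0 and small
   beta the ratios of partition functions with a + or a - spin at one site stay
   in a cone around the positive axis, by induction on the volume.
   Hence P(w) = \prod_j (1 + a_j (w - 1)) with at most n factors and
   |a_j| <= 1/r, so the characteristic function of S - E[S] is
   exp(- theta^2 Var(S) / 2 + O(n |theta|^3)) for |theta| below a constant.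
   Testing S against the scores of single spins gives Var(S) >= c n, and a
   Fourier smoothing inequality turns the estimate on the characteristic
   function into the rate K / sqrt n.  The zero-free disc and the variance bound
   are obtained in finite volume; the disc survives the limit because the
   factorization gives |P(w)| >= (1 - |w - 1| / r)^n uniformly in the volume. *)

Require Import Defs.
From mathcomp Require Import all_boot all_order all_algebra finmap ring lra complex.
Set Implicit Arguments.
Unset Strict Implicit.
Unset Printing Implicit Defensive.
Import Order.TTheory GRing.Theory Num.Theory.
Local Open Scope ring_scope.

(** * Zero-free regions of ferromagnetic Ising polynomials *)

(** The variable w marks plus spins of Delta only, while the volume is larger: the fields are
    inhomogeneous, so the zero-free disc has to come from a statement about independent complex
    fields at all sites. The a_j are complex in general, so S is not treated as a sum of independent
    Bernoulli variables. What survives is two power sums: the a_j add up to E[S] and the a_j - a_j^2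
    add up to Var(S). Each factor is therefore compared with the exponential of its own second-order
    expansion, and multiplying these exponentials gives back the Gaussian exactly. With r = theta
    sqrt(Var S), the remaining error is at most of order r^3 exp(-r^2/4) / sqrt n, which is weakened
    to eps r / (1 + r^2). In this profile the factor r cancels the 1/t of the inversion kernel, and
    what is left integrates to an arctangent, bounded whatever the cutoff. The characteristic
    function is controlled only for |theta| below a constant, so the smoothing functions must have
    compactly supported Fourier transforms; after rescaling the cutoff in r is of order sqrt n, and
    smoothing costs its inverse. *)

Section SetPolynomials.
Variables (V : finType) (K : comNzRingType).
Implicit Types (F : {set V} -> K) (w : V -> K) (i j : V) (X : {set V}).

Definition set_poly F w : K := \sum_X F X * \prod_(k in X) w k.

Definition edge_weight (s : K) i j X : K :=
  if (i \in X) == (j \in X) then 1 else s.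

(** The polynomial is affine in [w i] and in [w j]; this is the coefficient of the monomial with
    exponents [b] and [c] in these two variables, the others being frozen. *)
Definition set_poly_coef F w i j (b c : bool) : K :=
  \sum_X F X * (\prod_(k in X | (k != i) && (k != j)) w k)
         * (((i \in X) == b) && ((j \in X) == c))%:R.

Lemma set_poly_affine2 (s : K) F w i j : i != j ->
  let c := set_poly_coef F w i j in
  set_poly (fun X => F X * edge_weight s i j X) w =
  (c false false + c true true * w i * w j)
  + s * (c true false * w i + c false true * w j).
Proof.
move=> ij /=; rewrite mulrDr !mulrA !mulr_sumr !mulr_suml -!big_split /=.
apply: eq_bigr => X _; rewrite /edge_weight.
have -> : \prod_(k in X) w k =
    (if i \in X then w i else 1) * (if j \in X then w j else 1)
    * \prod_(k in X | (k != i) && (k != j)) w k.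
  rewrite (bigID (fun k => k == i)) /=; rewrite [X in _ * X = _](bigID (fun k => k == j)) /=.
  rewrite [LHS]mulrA; congr (_ * _ * _).
  - case: ifP => iX; last first.
      by rewrite big_pred0// => k; case: (eqVneq k i) => [->|_]; rewrite ?iX ?andbF.
    by rewrite (big_pred1 i) // => k /=; case: (eqVneq k i) => [->|_]; rewrite ?iX ?andbF.
  - case: ifP => jX; last first.
      by rewrite big_pred0// => k; case: (eqVneq k j) => [->|_]; rewrite ?jX ?andbF.
    rewrite (big_pred1 j) // => k /=; case: (eqVneq k j) => [->|]; rewrite ?andbF //.
    by rewrite jX eq_sym ij.
  - by apply: eq_bigl => k; rewrite andbA.
by case: (i \in X); case: (j \in X) => /=; ring.
Qed.

Lemma edge_weight1 i j X : edge_weight 1 i j X = 1.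
Proof. by rewrite /edge_weight; case: ifP. Qed.

Lemma set_poly_coef_eq F w w' i j b c :
  (forall k, k != i -> k != j -> w k = w' k) ->
  set_poly_coef F w i j b c = set_poly_coef F w' i j b c.
Proof.
move=> ww'; apply: eq_bigr => X _; congr (_ * _ * _).
by apply: eq_bigr => k /andP[_ /andP[]]; exact: ww'.
Qed.

End SetPolynomials.

(** * The Lee-Yang theorem for independent fields *)

Section LeeYang.
Variable C : numClosedFieldType.

(** Vieta: both roots of the quadratic lie outside the open unit disc, so their product a / d has
    modulus at least 1, and so does the root - a / d of the contracted polynomial. *)
Lemma asano_contraction (a e d x : C) :
  (forall z, `|z| < 1 -> a + e * z + d * z ^+ 2 != 0) -> `|x| < 1 ->
  a + d * x != 0.
Proof.
move=> nz x1; apply/eqP => ax.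
have [d0|d0] := eqVneq d 0.
  have := nz 0; rewrite normr0 ltr01 => /(_ isT).
  by move: ax; rewrite d0 !mul0r mulr0 !addr0 => ->; rewrite eqxx.
pose t := sqrtC (e ^+ 2 - 4%:R * (d * a)).
have t2 : t ^+ 2 = e ^+ 2 - 4%:R * (d * a) by rewrite sqrtCK.
pose r1 := (- e + t) / (2%:R * d); pose r2 := (- e - t) / (2%:R * d).
have aE : a = - (d * x) by apply/eqP; rewrite -addr_eq0 ax.
have r12 : r1 * r2 = - x.
  have : (- e + t) * (- e - t) = 4%:R * (d * a).
    by transitivity (e ^+ 2 - t ^+ 2); [ring|rewrite t2; ring].
  rewrite /r1 /r2 mulrACA => ->; rewrite aE.
  by field.
have root1 r : (r == r1) || (r == r2) -> a + e * r + d * r ^+ 2 = 0.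
  move=> hr; have : (2%:R * d * r + e) ^+ 2 = t ^+ 2.
    by case/orP: hr => /eqP ->; rewrite /r1 /r2; field.
  rewrite t2 => h; apply: (mulfI (x := 4%:R * d)).
    by rewrite mulf_neq0 // pnatr_eq0.
  rewrite mulr0; transitivity ((2%:R * d * r + e) ^+ 2 - (e ^+ 2 - 4%:R * (d * a))).
    by ring.
  by rewrite h subrr.
have [l1|g1] := real_ltP (normr_real r1) (real1 C).
  by have := nz _ l1; rewrite root1 ?eqxx.
have [l2|g2] := real_ltP (normr_real r2) (real1 C).
  by have := nz _ l2; rewrite root1 ?eqxx ?orbT.
have : 1 <= `|r1 * r2| by rewrite normrM mulr_ege1.
by rewrite r12 normrN real_leNgt ?real1 ?normr_real // x1.
Qed.

(** The two-site case. The identity |1 + q y|^2 - |q + y|^2 = (1 - q^2)(1 - |y|^2) says that y -> (q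
    + y) / (1 + q y) sends the disc to itself. *)
Lemma edge_poly_neq0 (q x y : C) : 0 <= q <= 1 -> `|x| < 1 -> `|y| < 1 ->
  1 + q * y + (q + y) * x != 0.
Proof.
move=> /andP[q0 q1] x1 y1; apply/eqP => h.
have qr : q^* = q by apply: conj_Creal; exact: ger0_real.
have h1 : `|1 + q * y| = `|q + y| * `|x|.
  by rewrite -normrM -normrN; congr `|_|; apply/eqP; rewrite eq_sym -addr_eq0 addrC h.
have le : `|q + y| <= `|1 + q * y|.
  rewrite -(@ler_pXn2r _ 2) ?nnegrE ?normr_ge0 // !normCK !rmorphD !rmorphM /= rmorph1 qr.
  rewrite -subr_ge0.
  have -> : (1 + q * y) * (1 + q * y^*) - (q + y) * (q + y^*) =
    (1 - q) * (1 + q) * (1 - y * y^*) by ring.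
  rewrite -normCK !mulr_ge0 ?subr_ge0 ?addr_ge0 // exprn_ile1 ?normr_ge0 //.
  exact: ltW.
have [qy0|qy0] := eqVneq (q + y) 0.
  have: `|y| ^+ 2 = 1.
    have yE : y = - q by apply/eqP; rewrite -addr_eq0 addrC qy0.
    move: h; rewrite qy0 mul0r addr0 yE normrN ger0_norm // mulrN => /eqP.
    by rewrite subr_eq0 eq_sym -expr2 => /eqP.
  by move/eqP; rewrite lt_eqF // exprn_ilt1 ?normr_ge0.
move: le; rewrite h1 ler_pMr ?normr_gt0 // => /le_lt_trans/(_ x1).
by rewrite ltxx.
Qed.

(** The given polynomial times the one-edge polynomial, in common variables v and z, has no zero in
    the bidisc and is quadratic in each variable. Contracting v^2 to x and z^2 to y drops the middle
    terms and multiplies the coefficients pairwise: c00 and c11 by 1, c10 and c01 by q. *)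
Lemma lee_yang_edge (q c00 c10 c01 c11 : C) : 0 <= q <= 1 ->
  (forall x y, `|x| < 1 -> `|y| < 1 -> c00 + c10 * x + c01 * y + c11 * x * y != 0) ->
  forall x y, `|x| < 1 -> `|y| < 1 ->
  c00 + q * c10 * x + q * c01 * y + c11 * x * y != 0.
Proof.
move=> q01 nz x y x1 y1.
have -> : c00 + q * c10 * x + q * c01 * y + c11 * x * y =
  (c00 + q * c10 * x) + (q * c01 + c11 * x) * y by ring.
apply: (@asano_contraction _ (c01 + q * c00 + (c10 + q * c11) * x)) => // z z1.
have -> : c00 + q * c10 * x + (c01 + q * c00 + (c10 + q * c11) * x) * z +
    (q * c01 + c11 * x) * z ^+ 2 =
  (c00 + c01 * z) * (1 + q * z) + (c10 + c11 * z) * (q + z) * x by ring.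
apply: (@asano_contraction _ ((c00 + c01 * z) * (q + z) + (c10 + c11 * z) * (1 + q * z))) => // v v1.
have -> : (c00 + c01 * z) * (1 + q * z) +
  ((c00 + c01 * z) * (q + z) + (c10 + c11 * z) * (1 + q * z)) * v +
  (c10 + c11 * z) * (q + z) * v ^+ 2 =
  (c00 + c10 * v + c01 * z + c11 * v * z) * (1 + q * z + (q + z) * v) by ring.
by rewrite mulf_neq0 ?nz ?edge_poly_neq0.
Qed.

Variable V : finType.

Definition lee_yang_stable (F : {set V} -> C) :=
  forall w : V -> C, (forall k, `|w k| < 1) -> set_poly F w != 0.

Lemma lee_yang_stable_edge (q : C) (F : {set V} -> C) i j : 0 <= q <= 1 -> i != j ->
  lee_yang_stable F -> lee_yang_stable (fun X => F X * edge_weight q i j X).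
Proof.
move=> q01 ij st w w1; rewrite set_poly_affine2 //.
set c := set_poly_coef F w i j.
have -> : c false false + c true true * w i * w j +
    q * (c true false * w i + c false true * w j) =
  c false false + q * c true false * w i + q * c false true * w j
    + c true true * w i * w j by ring.
apply: lee_yang_edge => // x y x1 y1.
pose w' k := if k == i then x else if k == j then y else w k.
have w'1 k : `|w' k| < 1 by rewrite /w'; case: eqP => // _; case: eqP.
have := st _ w'1; suff -> : set_poly F w' =
  c false false + c true false * x + c false true * y + c true true * x * y by [].
have := set_poly_affine2 1 F w' ij; rewrite /= mul1r => h.
transitivity (set_poly (fun X => F X * edge_weight 1 i j X) w').
  by apply: eq_bigr => X _; rewrite edge_weight1 mulr1.
rewrite h /w' eqxx [j == i]eq_sym (negPf ij) eqxx.
have cE b b' : set_poly_coef F w' i j b b' = c b b'.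
  by apply: set_poly_coef_eq => k /negPf ki /negPf kj; rewrite /w' ki kj.
by rewrite -/w' !cE; ring.
Qed.

Lemma set_poly1 (w : V -> C) : set_poly (fun=> 1) w = \prod_k (1 + w k).
Proof.
under [RHS]eq_bigr do rewrite addrC.
by rewrite bigA_distr /=; apply: eq_big => // X _; rewrite mul1r big_mkcond.
Qed.

Lemma lee_yang_stable1 : lee_yang_stable (fun=> 1).
Proof.
move=> w w1; rewrite set_poly1; apply/prodf_neq0 => k _.
apply: contraTneq (w1 k) => /eqP; rewrite addrC addr_eq0 => /eqP ->.
by rewrite normrN normr1 ltxx.
Qed.

Lemma lee_yang (q : C) (E : seq (V * V)) : 0 <= q <= 1 ->
  all (fun p => p.1 != p.2) E ->
  lee_yang_stable (fun X => \prod_(p <- E) edge_weight q p.1 p.2 X).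
Proof.
move=> q01; elim: E => [_|p E IH /= /andP[pE /IH st]] w w1.
  rewrite (_ : set_poly _ _ = set_poly (fun=> 1) w) ?lee_yang_stable1 //.
  by apply: eq_bigr => X _; rewrite big_nil.
have := lee_yang_stable_edge q01 pE st w1; rewrite /=.
congr (_ != 0); apply: eq_bigr => X _; congr (_ * _).
by rewrite big_cons mulrC.
Qed.

End LeeYang.

(** * Sectors of the complex plane around the positive axis *)

Section Cones.
Local Open Scope complex_scope.
Variable R : rcfType.
Implicit Types (s t u r : R) (x y z : R[i]).

(** The sector |arg z| <= arctan t, described by its slope so that no argument function enters. *)
Definition cone t z := (0 < complex.Re z) && (`|complex.Im z| <= t * complex.Re z).

Lemma cone_weaken s t z : s <= t -> cone s z -> cone t z.
Proof.
move=> st /andP[z0 zs]; rewrite /cone z0; apply: (le_trans zs).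
by rewrite ler_wpM2r // ltW.
Qed.

Lemma cone_scale r t z : 0 < r -> cone t z -> cone t (r%:C * z).
Proof.
move=> r0; case: z => a b /andP[/= a0 ab]; rewrite /cone /= !mul0r subr0 addr0.
by rewrite mulr_gt0 // normrM gtr0_norm // mulrCA ler_pM2l.
Qed.

Lemma cone1 t : 0 <= t -> cone t 1.
Proof. by move=> t0; rewrite /cone /= ltr01 normr0 mulr1. Qed.

(** Arguments add under multiplication, and tan(p + q) = (s + t) / (1 - s t) for angles p and q of
    slopes s and t. *)
Lemma cone_mul s t u x y : 0 <= s -> 0 <= t -> s * t < 1 ->
  s + t <= u * (1 - s * t) -> cone s x -> cone t y -> cone u (x * y).
Proof.
move=> s0 t0 st1 stu; case: x => a b /andP[/= a0 ab]; case: y => c d /andP[/= c0 cd].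
have ac : 0 < a * c by rewrite mulr_gt0.
have bd : `|b * d| <= s * t * (a * c).
  by rewrite normrM [leRHS]mulrACA ler_pM.
have ad : `|a * d| <= t * (a * c).
  by rewrite normrM gtr0_norm // mulrCA ler_pM2l.
have bc : `|b * c| <= s * (a * c).
  by rewrite normrM (gtr0_norm c0) mulrA ler_pM2r.
have re : (1 - s * t) * (a * c) <= a * c - b * d.
  by have := ler_norm (b * d); lra.
have re0 : 0 < (1 - s * t) * (a * c) by rewrite mulr_gt0 // subr_gt0.
have u0 : 0 <= u.
  by rewrite -(pmulr_lge0 (x := 1 - s * t)) ?subr_gt0 //; apply: le_trans stu; rewrite addr_ge0.
rewrite /cone /= (lt_le_trans re0 re) /=.
apply: (le_trans (ler_normD _ _)).
apply: (@le_trans _ _ ((s + t) * (a * c))); first by lra.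
apply: (@le_trans _ _ (u * ((1 - s * t) * (a * c)))).
  by rewrite [leRHS]mulrA ler_wpM2r // ltW.
exact: ler_wpM2l.
Qed.

(** The factor 2 leaves a slack that pays for the denominator of the tangent addition formula, so
    slopes add linearly as long as the total stays below 1. *)
Lemma cone_mul_nat t x y (k : nat) : 0 <= t -> 2 * (k.+1)%:R * t <= 1 ->
  cone t x -> cone (2 * k%:R * t) y -> cone (2 * (k.+1)%:R * t) (x * y).
Proof.
rewrite -[k.+1%:R]natr1 => t0; have : 0 <= k%:R :> R by [].
move: (k%:R) => K k0 kt.
have kt0 : 0 <= K * t by rewrite mulr_ge0.
have -> : 2 * (K + 1) * t = 2 * (K * t) + 2 * t by ring.
have -> : 2 * K * t = 2 * (K * t) by ring.
have {}kt : 2 * (K * t) + 2 * t <= 1 by lra.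
apply: cone_mul => //; [lra|nra|].
have : 0 <= t * (1 - 2 * (K * t) * (2 * (K * t) + 2 * t)).
  by apply: mulr_ge0 => //; nra.
lra.
Qed.

(** Multiplying by the conjugate of the denominator leaves the imaginary part b (1/q - q) and a real
    part at least a, where x = a + i b and |b| <= a. Even a wide sector is thus mapped to one that
    is thin for q near 1. *)
Lemma cone_ratio (q : R) x : 0 < q <= 1 -> cone 1 x ->
  cone (q^-1 - q) ((1 + q^-1%:C * x) / (1 + q%:C * x)).
Proof.
move=> /andP[q0 q1]; case: x => a b /andP[/= a0]; rewrite mul1r => ab.
have q' : 1 <= q^-1 by rewrite invf_ge1.
pose D := (1 + q * a) ^+ 2 + (q * b) ^+ 2.
have D0 : 0 < D.
  rewrite ltr_pwDl ?sqr_ge0 // exprn_gt0 // addr_gt0 ?mulr_gt0 //.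
have -> : (1 + q^-1%:C * (a +i* b)) / (1 + q%:C * (a +i* b)) =
  D^-1%:C * ((1 + (a ^+ 2 + b ^+ 2) + a * (q^-1 + q)) +i* (b * (q^-1 - q))).
  have qx : 1 + q%:C * (a +i* b) != 0.
    by rewrite eq_complex negb_and /= !mul0r subr0 gt_eqF // addr_gt0 ?mulr_gt0.
  apply: (mulIf qx); rewrite mulfVK //.
  apply/eqP; rewrite eq_complex /=; apply/andP; split; apply/eqP; rewrite /D; field.
  - rewrite gt_eqF //= gt_eqF //; move: D0; rewrite /D; lra.
  - rewrite gt_eqF //= gt_eqF //; move: D0; rewrite /D; lra.
apply: cone_scale; first by rewrite invr_gt0.
have a1 : a <= 1 + (a ^+ 2 + b ^+ 2) + a * (q^-1 + q) by nra.
rewrite /cone /= (lt_le_trans a0 a1) /= normrM mulrC ger0_norm; last by lra.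
rewrite ler_wpM2l //; [lra|exact: le_trans a1].
Qed.

End Cones.

Section Subvolumes.
Variables (V : finType) (K : fieldType) (e : rel V) (s : K).
Hypothesis e_sym : symmetric e.
Hypothesis e_irr : irreflexive e.
Hypothesis s_neq0 : s != 0.
Implicit Types (A X : {set V}) (w : V -> K) (i j : V) (r : K) (N : pred V).

(** The product runs over ordered pairs: for symmetric [e] each edge contributes [s ^+ 2], hence the
    squares below. *)
Definition pair_weight A X : K :=
  \prod_(a in A) \prod_(b in A) (if e a b then edge_weight s a b X else 1).

Definition subvolume_sum A w : K :=
  \sum_(X : {set V} | X \subset A) pair_weight A X * \prod_(k in X) w k.

Definition scale_on N r w : V -> K := fun k => if N k then r * w k else w k.

Lemma subvolume_sum_ext A w w' : {in A, w =1 w'} ->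
  subvolume_sum A w = subvolume_sum A w'.
Proof.
move=> ww'; apply: eq_bigr => X XA; congr (_ * _).
by apply: eq_bigr => k kX; apply: ww'; exact: (subsetP XA).
Qed.

Lemma pair_weightD1 A X i : i \in A ->
  pair_weight A X = pair_weight (A :\ i) X *
    \prod_(b in A :\ i) (if e i b then edge_weight s i b X ^+ 2 else 1).
Proof.
move=> iA; rewrite /pair_weight (big_setD1 i iA) /= (big_setD1 i iA) /= e_irr mul1r.
under [X in _ * X = _]eq_bigr => a _ do rewrite (big_setD1 i iA) /=.
rewrite big_split /= mulrA mulrC; congr (_ * _).
rewrite -big_split /=; apply: eq_bigr => b _; rewrite e_sym.
by case: ifP => _; rewrite ?mul1r // expr2 /edge_weight eq_sym.
Qed.

Lemma pair_weight_ext A X Y : X :&: A = Y :&: A -> pair_weight A X = pair_weight A Y.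
Proof.
move=> XY; have h a : a \in A -> (a \in X) = (a \in Y).
  by move=> aA; have := congr1 (fun Z : {set V} => a \in Z) XY; rewrite !inE aA !andbT.
apply: eq_bigr => a aA; apply: eq_bigr => b bA.
by case: ifP => // _; rewrite /edge_weight !h.
Qed.

Lemma prod_scale_on A X i r w : X \subset A ->
  \prod_(k in X) scale_on (e i) r w k =
  (\prod_(b in A) (if e i b && (b \in X) then r else 1)) * \prod_(k in X) w k.
Proof.
move=> XA.
have -> : \prod_(b in A) (if e i b && (b \in X) then r else 1) =
    \prod_(b in X) (if e i b then r else 1).
  rewrite [LHS]big_mkcond [RHS]big_mkcond; apply: eq_bigr => b _ /=.
  case: (boolP (b \in X)) => bX; first by rewrite (subsetP XA _ bX) andbT.
  by rewrite andbF; case: ifP.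
rewrite -big_split; apply: eq_bigr => k _ /=.
by rewrite /scale_on; case: ifP; rewrite ?mul1r.
Qed.

Definition minus_part A i w :=
  subvolume_sum (A :\ i) (scale_on (e i) (s ^+ 2) w).

(** Fixing the spin at [i] turns its edges into fields on its neighbours. For a plus spin the
    neighbours outside X pay [s ^+ 2]; this is written as [s ^+ 2] for every neighbour, compensated
    by the inverse factor on those inside X. *)
Definition plus_part A i w :=
  w i * \prod_(b in A :\ i) (if e i b then s ^+ 2 else 1)
  * subvolume_sum (A :\ i) (scale_on (e i) (s ^+ 2)^-1 w).

Lemma subvolume_sum_split A i w : i \in A ->
  subvolume_sum A w = minus_part A i w + plus_part A i w.
Proof.
move=> iA; rewrite /subvolume_sum (bigID (fun X : {set V} => i \notin X)) /=.
congr (_ + _).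
  rewrite /minus_part; apply: eq_big => X; first by rewrite subsetD1.
  move=> /andP[XA iX]; have XA' : X \subset A :\ i by rewrite subsetD1 XA.
  rewrite (pair_weightD1 _ iA) (prod_scale_on _ _ _ XA') -!mulrA; congr (_ * (_ * _)).
  apply: eq_bigr => b _; rewrite /edge_weight (negPf iX).
  by case: (e i b); case: (b \in X) => //=; rewrite expr1n.
rewrite (reindex_onto (fun X => i |: X) (fun X => X :\ i)) /=; last first.
  by move=> X /andP[_]; rewrite negbK => iX; rewrite setD1K.
rewrite /plus_part big_distrr /=; apply: eq_big => X.
  rewrite negbK setU11 subUset sub1set iA /= subsetD1 andbT; congr (_ && _).
  by apply/eqP/idP => [<-|iX]; [rewrite setD11|rewrite setU1K].
move=> /andP[/andP[XA _] /eqP Xi].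
have iX : i \notin X by rewrite -Xi setD11.
have XA' : X \subset A :\ i.
  by rewrite subsetD1 iX andbT; apply: subset_trans XA; exact: subsetUr.
rewrite (pair_weightD1 _ iA) big_setU1 //= (prod_scale_on _ _ _ XA').
rewrite (@pair_weight_ext (A :\ i) (i |: X) X); last first.
  by apply/setP => k; rewrite !inE; case: eqVneq => //= _; rewrite andbF.
have -> : \prod_(b in A :\ i) (if e i b then edge_weight s i b (i |: X) ^+ 2 else 1) =
  \prod_(b in A :\ i) (if e i b then s ^+ 2 else 1) *
  \prod_(b in A :\ i) (if e i b && (b \in X) then (s ^+ 2)^-1 else 1).
  rewrite -big_split; apply: eq_bigr => b; rewrite !inE => /andP[bi _].
  rewrite /edge_weight setU11 !inE (negPf bi) /=.
  case: (e i b); case: (b \in X) => //=; rewrite ?mulr1 ?expr1n //.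
  by rewrite divff // expf_neq0.
ring.
Qed.

Lemma subvolume_sum_scale A i r w : i \in A ->
  subvolume_sum A (scale_on (pred1 i) r w) = minus_part A i w + r * plus_part A i w.
Proof.
move=> iA; rewrite (subvolume_sum_split _ iA); congr (_ + _).
  apply: subvolume_sum_ext => k; rewrite !inE => /andP[/negPf ki _].
  by rewrite /scale_on /= ki.
rewrite /plus_part {1}/scale_on /= eqxx !mulrA; congr (_ * _).
apply: subvolume_sum_ext => k; rewrite !inE => /andP[/negPf ki _].
by rewrite /scale_on /= ki.
Qed.

Lemma subvolume_sum_notin A i r w : i \notin A ->
  subvolume_sum A (scale_on (pred1 i) r w) = subvolume_sum A w.
Proof.
move=> iA; apply: subvolume_sum_ext => k kA; rewrite /scale_on /=.
by case: eqP => // ki; rewrite ki (negPf iA) in kA.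
Qed.

End Subvolumes.

(** * Absence of zeros at high temperature *)

Section HighTemperature.
Local Open Scope complex_scope.
Variables (R : rcfType) (V : finType) (e : rel V) (s eps : R) (D : nat).
Hypothesis e_sym : symmetric e.
Hypothesis e_irr : irreflexive e.
Hypothesis degree_le : forall i, (#|[set j | e i j]| <= D)%N.
Hypothesis s01 : 0 < s <= 1.
Hypothesis eps_ge0 : 0 <= eps.
Hypothesis eps_ge : (s ^+ 2)^-1 - s ^+ 2 <= eps.
Hypothesis eps_small : 2 * (D.+1)%:R * eps <= 1.
Implicit Types (A : {set V}) (w : V -> R[i]).

Local Notation Z := (subvolume_sum e s%:C).
Local Notation Zm := (minus_part e s%:C).
Local Notation Zp := (plus_part e s%:C).

Let s0 : 0 < s. Proof. by case/andP: s01. Qed.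
Let sC : s%:C != 0. Proof. by rewrite eq_complex /= gt_eqF. Qed.

Let cone_fields w := forall k, cone eps (w k).

Let cone_fields_scale (N : pred V) (r : R) w : 0 < r -> cone_fields w ->
  cone_fields (scale_on N r%:C w).
Proof. by move=> r0 cw k; rewrite /scale_on; case: ifP => // _; apply: cone_scale. Qed.

(** The invariant of the induction on the volume. Nonvanishing alone would not propagate; the sector
    for the ratio of the plus and minus parts is what allows one more site to be added. *)
Let good A := forall w, cone_fields w -> Z A w != 0 /\
  forall i, i \in A -> Zm A i w != 0 /\ cone 1 (Zp A i w / Zm A i w).

(** Scaling the field at [i] by r turns the sum into [Zm + r * Zp], so the quotient is the Moebius
    image in [cone_ratio] of [Zp / Zm]; off [A] it is 1. *)
Let flip_ratio A w i : good A -> cone_fields w ->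
  cone eps (Z A (scale_on (pred1 i) (s ^+ 2)^-1%:C w) /
            Z A (scale_on (pred1 i) (s ^+ 2)%:C w)).
Proof.
move=> gA cw; have [Zw gi] := gA _ cw.
have [iA|iA] := boolP (i \in A); last first.
  by rewrite !subvolume_sum_notin // divff //; exact: cone1.
have [m0 c1] := gi _ iA.
rewrite !subvolume_sum_scale //.
have -> : (Zm A i w + ((s ^+ 2)^-1)%:C * Zp A i w) / (Zm A i w + (s ^+ 2)%:C * Zp A i w) =
  (1 + (s ^+ 2)^-1%:C * (Zp A i w / Zm A i w)) / (1 + (s ^+ 2)%:C * (Zp A i w / Zm A i w)).
  set x := Zp A i w / _.
  have -> : Zp A i w = Zm A i w * x by rewrite /x mulrCA divff // mulr1.
  rewrite -[X in (X + _) / _]mulr1 -[X in _ / (X + _)]mulr1 !(mulrCA _ (Zm A i w)) -!mulrDr.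
  by rewrite invfM mulrACA divff // mul1r.
apply: cone_weaken eps_ge _; apply: cone_ratio => //.
by rewrite exprn_gt0 //= exprn_ile1 //; [exact: ltW|case/andP: s01].
Qed.

(** The fields on [l] are changed one site at a time: the quotient is a product of [size l]
    single-site quotients, each in the sector of slope [eps]. *)
Let telescope A w (l : seq V) : good A -> cone_fields w -> uniq l -> (size l <= D)%N ->
  cone (2 * (size l)%:R * eps)
    (Z A (scale_on (mem l) (s ^+ 2)^-1%:C w) / Z A (scale_on (mem l) (s ^+ 2)%:C w)).
Proof.
move=> gA; elim: l w => [|j l IH] w cw /=.
  move=> _ _; rewrite mulr0 mul0r.
  have c1 : cone 0 (Z A w / Z A w) by rewrite divff ?cone1 //; case: (gA _ cw).
  exact: c1.
move=> /andP[jl ul] sl.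
have s2 : 0 < s ^+ 2 by rewrite exprn_gt0.
have s2' : 0 < (s ^+ 2)^-1 by rewrite invr_gt0.
have step r : Z A (scale_on (mem (j :: l)) r w) =
    Z A (scale_on (pred1 j) r (scale_on (mem l) r w)).
  apply: subvolume_sum_ext => // k _; rewrite /scale_on /= inE.
  by case: eqP => [->|_] //=; rewrite (negPf jl).
have step' r r' : Z A (scale_on (mem l) r (scale_on (pred1 j) r' w)) =
    Z A (scale_on (pred1 j) r' (scale_on (mem l) r w)).
  apply: subvolume_sum_ext => // k _; rewrite /scale_on /=.
  by case: eqP => [->|_] //=; rewrite (negPf jl).
rewrite !step //.
have nz : Z A (scale_on (pred1 j) (s ^+ 2)%:C (scale_on (mem l) (s ^+ 2)^-1%:C w)) != 0.
  have [] // := gA (scale_on (pred1 j) (s ^+ 2)%:C (scale_on (mem l) (s ^+ 2)^-1%:C w)).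
  by do 2! apply: cone_fields_scale => //.
rewrite -[X in X / _](mulfVK nz) -[_ * _ / Z A _]mulrA.
apply: cone_mul_nat => //.
- apply: le_trans eps_small; rewrite ler_wpM2r // ler_pM2l // ler_nat.
  by rewrite ltnS ltnW.
- by apply: flip_ratio => //; exact: cone_fields_scale.
- rewrite -!step'; apply: IH => //; last exact: ltnW.
  exact: cone_fields_scale.
Qed.

Let good_all A : good A.
Proof.
have [n] := ubnP #|A|; elim: n A => // n IH A; rewrite ltnS => An w cw.
have s2 : 0 < s ^+ 2 by rewrite exprn_gt0.
have s2' : 0 < (s ^+ 2)^-1 by rewrite invr_gt0.
have gi i : i \in A -> Zm A i w != 0 /\ cone 1 (Zp A i w / Zm A i w).
  move=> iA; have gA : good (A :\ i).
    by apply: IH; move: An; rewrite (cardsD1 i A) iA.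
  have m0 : Zm A i w != 0.
    rewrite /minus_part -rmorphXn /=.
    by have [] := gA _ (cone_fields_scale (e i) s2 cw).
  split => //; rewrite /plus_part /minus_part.
  rewrite -rmorphXn /= -fmorphV /=.
  have -> : \prod_(b in A :\ i) (if e i b then (s ^+ 2)%:C else 1) =
      (\prod_(b in A :\ i) (if e i b then (s ^+ 2) else 1))%:C.
    by rewrite rmorph_prod /=; apply: eq_bigr => b _; case: ifP.
  rewrite (mulrC (w i)) -!mulrA; apply: cone_scale.
    by apply: prodr_gt0 => b _; case: ifP.
  pose l := enum [set j | e i j].
  have le r : Z (A :\ i) (scale_on (e i) r w) = Z (A :\ i) (scale_on (mem l) r w).
    by apply: subvolume_sum_ext => k _; rewrite /scale_on /= mem_enum inE.
  rewrite !le; have sl : (size l <= D)%N by rewrite -cardE.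
  (* The field [w i] supplies one more factor of slope [eps] beside those of the at most [D]
     neighbours, whence the successor. *)
  have lD : 2 * (size l).+1%:R * eps <= 1.
    by apply: le_trans eps_small; rewrite ler_wpM2r // ler_pM2l // ler_nat ltnS.
  apply: (cone_weaken lD); apply: cone_mul_nat => //.
  by apply: telescope => //; exact: enum_uniq.
split => //; have [->|/set0Pn[i iA]] := eqVneq A set0.
  rewrite /subvolume_sum (big_pred1 set0) => [|X]; last by rewrite subset0.
  by rewrite /pair_weight !big_set0 mulr1 oner_neq0.
have [m0 c1] := gi _ iA; rewrite (subvolume_sum_split _ _ _ _ iA) //.
have -> : Zm A i w + Zp A i w = Zm A i w * (1 + Zp A i w / Zm A i w).
  by rewrite mulrDr mulr1 mulrCA divff // mulr1.
rewrite mulf_neq0 //; case/andP: c1; case: (_ / _) => a b /= a0 _.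
by rewrite eq_complex negb_and /= gt_eqF // addr_gt0.
Qed.

Lemma high_temperature w : (forall k, cone eps (w k)) -> Z setT w != 0.
Proof. by move=> cw; have [] := @good_all setT _ cw. Qed.

End HighTemperature.

Section IsingZeros.
Import Normc.
Local Open Scope complex_scope.
Variables (R : rcfType) (V : finType) (e : rel V) (b : R).
Hypothesis e_sym : symmetric e.
Hypothesis e_irr : irreflexive e.
Hypothesis b01 : 0 < b <= 1.
Implicit Types (f : V -> R[i]) (X : {set V}) (w : R[i]).

Definition ising_weight X : R := pair_weight e b setT X.
Definition ising_poly f : R[i] := \sum_X (ising_weight X)%:C * \prod_(k in X) f k.

Lemma ising_weight_gt0 X : 0 < ising_weight X.
Proof.
rewrite /ising_weight /pair_weight; apply: prodr_gt0 => i _; apply: prodr_gt0 => j _.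
by rewrite /edge_weight; case: ifP => // _; case: ifP => // _; case/andP: b01.
Qed.

Lemma ising_weightC X : ising_weight (~: X) = ising_weight X.
Proof.
apply: eq_bigr => i _; apply: eq_bigr => j _; rewrite /edge_weight !inE.
by case: (i \in X); case: (j \in X).
Qed.

Lemma ising_polyE f : ising_poly f = subvolume_sum e b%:C setT f.
Proof.
rewrite /subvolume_sum; apply: eq_big => X; first by rewrite subsetT.
move=> _; congr (_ * _); rewrite /ising_weight /pair_weight rmorph_prod.
apply: eq_bigr => i _; rewrite rmorph_prod; apply: eq_bigr => j _ /=.
by rewrite /edge_weight; case: ifP => // _; case: ifP.
Qed.

Let normC_lt1 (z : R[i]) : normc z < 1 -> `|z| < 1.
Proof. by move=> z1; rewrite -[1]/(1%:C) ltcR. Qed.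

Lemma ising_poly_lee_yang f : (forall k, normc (f k) < 1) -> ising_poly f != 0.
Proof.
move=> f1.
pose E := [seq p <- enum [set: V * V] | e p.1 p.2].
have := @lee_yang R[i] V b%:C E; rewrite -[X in _ <= b%:C <= X]/(1%:C) -[X in X <= b%:C]/(0%:C) !lecR.
have -> : (0 <= b <= 1) by case/andP: b01 => /ltW -> ->.
have -> : all (fun p => p.1 != p.2) E.
  apply/allP => p; rewrite mem_filter => /andP[ep _].
  by apply: contraTneq ep => ->; rewrite e_irr.
move=> /(_ isT isT f (fun k => normC_lt1 (f1 k))); congr (_ != 0).
apply: eq_bigr => X _; congr (_ * _).
rewrite /ising_weight /pair_weight rmorph_prod big_filter big_mkcond big_enum_cond /=.
under [RHS]eq_bigr do rewrite rmorph_prod.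
rewrite (pair_big (mem [set: V]) (mem [set: V])) /=; apply: eq_big => [p|p _]; first by rewrite !inE.
by rewrite /edge_weight; case: ifP => // _; case: ifP.
Qed.

(** The global spin flip exchanges fields inside and outside the unit disc, so the case of fields
    larger than 1 follows from that of fields smaller than 1. *)
Lemma ising_poly_flip f : (forall k, f k != 0) ->
  ising_poly f = \prod_k f k * ising_poly (fun k => (f k)^-1).
Proof.
move=> f0; rewrite /ising_poly mulr_sumr (reindex_inj (inv_inj (@setCK V))) /=.
apply: eq_bigr => X _; rewrite ising_weightC mulrCA; congr (_ * _).
rewrite [X in _ = X * _](bigID (mem X)) /= mulrAC -big_split /= [X in X * _]big1 ?mul1r.
  by apply: eq_bigl => k; rewrite inE.
by move=> k _; rewrite divff.
Qed.

Lemma ising_poly_lee_yang_gt1 f : (forall k, 1 < normc (f k)) -> ising_poly f != 0.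
Proof.
move=> f1; have f0 k : f k != 0.
  by apply: contraTneq (f1 k) => ->; rewrite normc0 -leNgt.
rewrite ising_poly_flip // mulf_neq0 //; first by apply/prodf_neq0 => k _.
apply: ising_poly_lee_yang => k; rewrite normcV invf_lt1 //.
exact: lt_trans (f1 k).
Qed.

(** With [lam] the fugacity exp(2h) and [w] attached to the sites of [A], [ising_poly] becomes the
    unnormalized generating function of the number of plus spins in [A]. *)
Definition site_field (lam : R) (A : {set V}) w : V -> R[i] :=
  fun k => lam%:C * (if k \in A then w else 1).

Let normc_real (x : R) : normc x%:C = `|x|.
Proof. by rewrite /normc /= expr0n addr0 sqrtr_sqr. Qed.

(** On this disc |w| < 2 - lam, and lam (2 - lam) = 1 - (1 - lam)^2 < 1. *)
Lemma ising_zero_free_small (lam : R) (A : {set V}) w :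
  0 < lam < 1 -> normc (w - 1) < 1 - lam -> ising_poly (site_field lam A w) != 0.
Proof.
move=> /andP[l0 l1] w1; apply: ising_poly_lee_yang => k.
rewrite /site_field normcM normc_real gtr0_norm //.
case: ifP => _; last by rewrite normc1 mulr1.
have := le_normcD (w - 1) 1; rewrite subrK normc1 => h.
have : lam * normc w < lam * (2 - lam) by rewrite ltr_pM2l //; lra.
nra.
Qed.

Lemma ising_zero_free_large (lam : R) (A : {set V}) w :
  1 < lam -> normc (w - 1) < 1 - lam^-1 -> ising_poly (site_field lam A w) != 0.
Proof.
move=> l1 w1; have l0 : 0 < lam by lra.
apply: ising_poly_lee_yang_gt1 => k.
rewrite /site_field normcM normc_real gtr0_norm //.
case: ifP => _; last by rewrite normc1 mulr1.
have := le_normcD (1 - w) w; rewrite subrK normc1 -(normcN (1 - w)) opprB => h.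
by rewrite -ltr_pdivrMl // mulr1; lra.
Qed.

(** The smallness condition forces eps <= 1/2, so a point at distance less than eps / 2 from 1 has
    |Im| < eps / 2 <= eps Re and is an admissible field. *)
Lemma ising_zero_free_high_temperature (eps : R) (D : nat) (A : {set V}) w :
  (forall i, (#|[set j | e i j]| <= D)%N) -> 0 < eps ->
  (b ^+ 2)^-1 - b ^+ 2 <= eps -> 2 * (D.+1)%:R * eps <= 1 ->
  normc (w - 1) < eps / 2 -> ising_poly (site_field 1 A w) != 0.
Proof.
move=> deg eps0 be De w1; rewrite ising_polyE.
have eps1 : eps <= 2^-1.
  have : 0 <= D%:R :> R by []; move: De; rewrite -[D.+1%:R]natr1.
  by move: (D%:R) => K De K0; nra.
apply: (@high_temperature _ _ _ _ eps D e_sym e_irr deg b01 (ltW eps0) be De) => k.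
rewrite /site_field mul1r; case: ifP => _; last by apply: cone1; exact: ltW.
have hre : `|complex.Re w - 1| < eps / 2.
  apply: le_lt_trans w1; case: (w) => x y /=.
  by rewrite oppr0 addr0 -sqrtr_sqr ler_wsqrtr // lerDl sqr_ge0.
have him : `|complex.Im w| < eps / 2.
  apply: le_lt_trans w1; case: (w) => x y /=.
  by rewrite oppr0 addr0 -sqrtr_sqr ler_wsqrtr // lerDr sqr_ge0.
move: hre; rewrite ltr_norml => /andP[re1 re2].
rewrite /cone; apply/andP; split; first by lra.
apply: (le_trans (ltW him)); nra.
Qed.

End IsingZeros.

(** * Variance of the magnetization *)

Section Flip.
Variable V : finType.
Implicit Types (X : {set V}) (i j k : V).

Definition flip i X : {set V} := [set k | (k \in X) (+) (k == i)].

Lemma in_flip i X k : (k \in flip i X) = (k \in X) (+) (k == i).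
Proof. by rewrite inE. Qed.

Lemma flipK i : involutive (flip i).
Proof. by move=> X; apply/setP => k; rewrite !in_flip addbK. Qed.

Lemma flipC i j X : flip i (flip j X) = flip j (flip i X).
Proof. by apply/setP => k; rewrite !in_flip addbAC. Qed.

End Flip.

Section VarianceLowerBound.
Variables (R : realFieldType) (V : finType) (e : rel V) (mu : {set V} -> R) (r : R) (D : nat).
Implicit Types (X A : {set V}) (i j k : V) (F : {set V} -> R).
Hypothesis mu_gt0 : forall X, 0 < mu X.
Hypothesis r_gt0 : 0 < r.
Hypothesis mu_flip : forall i X, r * mu X <= mu (flip i X).
Hypothesis mu_indep : forall i j X, i != j -> ~~ e i j ->
  mu (flip j (flip i X)) * mu X = mu (flip i X) * mu (flip j X).
Hypothesis degree_le : forall i, (#|[set j | e i j]| <= D)%N.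

Let Z : R := \sum_X mu X.

Let sgn i X : R := if i \in X then 1 else -1.

(** The conditional probability, given the other sites, that site [i] takes the value opposite to
    the one it has in X. *)
Let rate i X : R := mu (flip i X) / (mu X + mu (flip i X)).

Let score i X : R := sgn i X * rate i X.

Let den_gt0 i X : 0 < mu X + mu (flip i X).
Proof. by rewrite addr_gt0. Qed.

Let rate_itv i X : 0 <= rate i X <= 1.
Proof.
have d0 := den_gt0 i X; have h1 := ltW (mu_gt0 X); have h2 := ltW (mu_gt0 (flip i X)).
rewrite /rate ler_pdivrMr // mul1r lerDr h1 andbT divr_ge0 //; exact: ltW.
Qed.

Let rate_ge i X : r / (1 + r) <= rate i X.
Proof.
have r1 : 0 < 1 + r by rewrite addr_gt0.
rewrite /rate ler_pdivlMr // mulrAC ler_pdivrMr //.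
by have := mu_flip i X; lra.
Qed.

Let sgn_flip i X : sgn i (flip i X) = - sgn i X.
Proof. by rewrite /sgn in_flip eqxx addbT; case: (i \in X) => //=; rewrite opprK. Qed.

(* The score of site i is the conditional law of its spin turned into a
   function orthogonal to everything that ignores that spin. *)
Let score_orthogonal i F : (forall X, F (flip i X) = F X) ->
  \sum_X mu X * score i X * F X = 0.
Proof.
move=> Fi; set s := LHS.
suff : s = - s by move=> h; lra.
rewrite {1}/s (reindex_inj (inv_inj (@flipK V i))) /= -sumrN; apply: eq_bigr => X _.
rewrite Fi /score sgn_flip /rate flipK (addrC (mu (flip i X))).
by field; rewrite gt_eqF.
Qed.

(** The product [mu X * rate i X] is invariant under the flip at [i], so restricting it to the
    configurations containing [i] keeps exactly half of the total. *)
Let score_self i : r / (1 + r) / 2 * Z <= \sum_X mu X * score i X * (i \in X)%:R.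
Proof.
have r1 : 0 < 1 + r by rewrite addr_gt0.
have e1 : \sum_X mu X * score i X * (i \in X)%:R =
    \sum_X mu X * rate i X * (i \in X)%:R.
  by apply: eq_bigr => X _; rewrite /score /sgn; case: (i \in X); rewrite ?mulr0 // mul1r.
have e2 : \sum_X mu X * rate i X * (i \in X)%:R = \sum_X mu X * rate i X * (i \notin X)%:R.
  rewrite (reindex_inj (inv_inj (@flipK V i))) /=; apply: eq_bigr => X _.
  rewrite in_flip eqxx addbT /rate flipK (addrC (mu (flip i X))); congr (_ * _).
  by field; rewrite gt_eqF.
have e3 : \sum_X mu X * rate i X = 2 * \sum_X mu X * rate i X * (i \in X)%:R.
  have -> : 2 * \sum_X mu X * rate i X * (i \in X)%:R =
     \sum_X mu X * rate i X * (i \in X)%:R + \sum_X mu X * rate i X * (i \notin X)%:R.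
    by rewrite -e2; ring.
  rewrite -big_split /=; apply: eq_bigr => X _.
  by case: (i \in X); rewrite /= ?mulr0 ?mulr1 ?addr0 ?add0r.
have e4 : r / (1 + r) * Z <= \sum_X mu X * rate i X.
  rewrite /Z mulr_sumr; apply: ler_sum => X _.
  by rewrite mulrC; apply: ler_wpM2l; [exact: ltW|exact: rate_ge].
by rewrite e1; lra.
Qed.

(** When i and j are not adjacent, the conditional law at j ignores the spin at i, so [score j] is
    one of the functions orthogonal to [score i]. *)
Let score_far i j : i != j -> ~~ e i j -> \sum_X mu X * score i X * score j X = 0.
Proof.
move=> ij eij; apply: score_orthogonal => X.
rewrite /score /sgn in_flip [j == i]eq_sym (negPf ij) addbF; congr (_ * _).
have d1 := den_gt0 j (flip i X); have d2 := den_gt0 j X.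
rewrite /rate; apply/eqP; rewrite (eqr_div _ _ (lt0r_neq0 d1) (lt0r_neq0 d2)); apply/eqP.
by rewrite mulrDr [RHS]mulrDr (mu_indep X ij eij); ring.
Qed.

Let score_near i j : \sum_X mu X * score i X * score j X <= Z.
Proof.
apply: ler_sum => X _; rewrite -mulrA ger_pMr //.
apply: (le_trans (ler_norm _)); rewrite normrM.
have h k : `|score k X| <= 1.
  rewrite /score normrM /sgn; have /andP[a0 a1] := rate_itv k X.
  by case: ifP => _; rewrite ?normrN normr1 mul1r ger0_norm.
by rewrite -[leRHS]mulr1 ler_pM.
Qed.

(** Cauchy-Schwarz against the sum G of the scores over A: its covariance with the number of plus
    spins is at least of order |A|, while its second moment is at most (D + 1) |A|, since a score
    correlates only with itself and its neighbours. *)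
Lemma variance_lower_bound A (m : R) :
  \sum_X mu X * (#|X :&: A|%:R - m) = 0 ->
  (r / (1 + r) / 2) ^+ 2 / (D.+1)%:R * #|A|%:R * Z <=
  \sum_X mu X * (#|X :&: A|%:R - m) ^+ 2.
Proof.
move=> centered.
have r1 : 0 < 1 + r by rewrite addr_gt0.
pose c1 := r / (1 + r) / 2; have c10 : 0 < c1 by rewrite !divr_gt0.
have Z0 : 0 <= Z by apply: sumr_ge0 => X _; exact: ltW.
pose G X := \sum_(i in A) score i X.
pose T X : R := #|X :&: A|%:R - m.
have TE X : #|X :&: A|%:R = \sum_(j in A) (j \in X)%:R :> R.
  rewrite -sum1_card natr_sum big_mkcond [RHS]big_mkcond; apply: eq_bigr => j _ /=.
  by rewrite inE; case: (j \in X); case: (j \in A).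
have TG : c1 * Z * #|A|%:R <= \sum_X mu X * (T X * G X).
  have -> : \sum_X mu X * (T X * G X) =
      \sum_(i in A) (\sum_(j in A) \sum_X mu X * score i X * (j \in X)%:R).
    have -> : \sum_(i in A) (\sum_(j in A) \sum_X mu X * score i X * (j \in X)%:R) =
        \sum_(i in A) \sum_X mu X * score i X * #|X :&: A|%:R.
      apply: eq_bigr => i _; rewrite exchange_big /=; apply: eq_bigr => X _.
      by rewrite TE mulr_sumr.
    rewrite exchange_big /=.
    have -> : \sum_X mu X * (T X * G X) =
        \sum_X (\sum_(i in A) mu X * score i X * #|X :&: A|%:R) -
          m * \sum_(i in A) \sum_X mu X * score i X * 1.
      have -> : \sum_(i in A) \sum_X mu X * score i X * 1 = \sum_X mu X * G X.
        rewrite exchange_big /=; apply: eq_bigr => X _; rewrite /G mulr_sumr.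
        by apply: eq_bigr => i _; rewrite mulr1.
      rewrite mulr_sumr -sumrB; apply: eq_bigr => X _.
      by rewrite /T -mulr_suml -mulr_sumr -/(G X); ring.
    rewrite [X in _ - m * X]big1 ?mulr0 ?subr0 // => i _.
    by apply: (score_orthogonal (F := fun=> 1)).
  rewrite -sum1_card natr_sum mulr_sumr; apply: ler_sum => i iA.
  rewrite (bigD1 i) //= [X in _ + X]big1 ?addr0; last first.
    move=> j /andP[_ ji]; apply: (score_orthogonal (F := fun X => (j \in X)%:R)) => X.
    by rewrite in_flip (negPf ji) addbF.
  by rewrite mulr1; exact: score_self.
have GG : \sum_X mu X * G X ^+ 2 <= (D.+1)%:R * Z * #|A|%:R.
  have -> : \sum_X mu X * G X ^+ 2 = \sum_(i in A) (\sum_(j in A) \sum_X mu X * score i X * score j X).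
    under [RHS]eq_bigr do rewrite exchange_big /=.
    rewrite exchange_big /=; apply: eq_bigr => X _.
    rewrite /G expr2 mulr_suml mulr_sumr; apply: eq_bigr => i _.
    by rewrite mulr_sumr mulr_sumr; apply: eq_bigr => j _; rewrite mulrA.
  rewrite -sum1_card [in leRHS]natr_sum mulr_sumr; apply: ler_sum => i iA; rewrite mulr1.
  apply: (@le_trans _ _ (\sum_(j in A) if (j == i) || e i j then Z else 0)).
    apply: ler_sum => j jA; case: ifP => [_|/negbT]; first exact: score_near.
    by rewrite negb_or eq_sym => /andP[ij eij]; rewrite score_far.
  apply: (@le_trans _ _ (\sum_(j in i |: [set j | e i j]) Z)).
    rewrite -big_mkcondr big_mkcond [leRHS]big_mkcond /=; apply: ler_sum => j _.
    by rewrite !inE; case: (j \in A) => //=; case: ifP.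
  rewrite sumr_const -[leLHS]mulr_natl ler_wpM2r // ler_nat.
  by apply: (leq_trans (leq_card_setU _ _)); rewrite cards1 add1n ltnS.
(* The maximizer of 2 K c1 - K^2 (D + 1). Expanding the nonnegative mean of (T - K G)^2 with this K
   replaces the division in Cauchy-Schwarz. *)
pose K := c1 / (D.+1)%:R.
have D0 : 0 < (D.+1)%:R :> R by rewrite ltr0n.
pose sTT := \sum_X mu X * T X ^+ 2; pose sTG := \sum_X mu X * (T X * G X).
pose sGG := \sum_X mu X * G X ^+ 2.
have h3 : 0 <= sTT - 2 * K * sTG + K ^+ 2 * sGG.
  have -> : sTT - 2 * K * sTG + K ^+ 2 * sGG = \sum_X mu X * (T X - K * G X) ^+ 2.
    rewrite /sTT /sTG /sGG; symmetry.
    transitivity (\sum_X (mu X * T X ^+ 2 - 2 * K * (mu X * (T X * G X)) + K ^+ 2 * (mu X * G X ^+ 2))).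
      by apply: eq_bigr => X _; ring.
    by rewrite !big_split /= sumrN -!mulr_sumr.
  by apply: sumr_ge0 => X _; rewrite mulr_ge0 ?sqr_ge0 // ltW.
have K0 : 0 <= K by rewrite divr_ge0 // ltW.
have h1 := ler_wpM2l (mulr_ge0 (ler0n R 2) K0) TG.
have h2 := ler_wpM2l (sqr_ge0 K) GG.
have e1 : 2 * K * (c1 * Z * #|A|%:R) = 2 * (c1 ^+ 2 / D.+1%:R * #|A|%:R * Z).
  by rewrite /K; move: (D.+1%:R) D0 => x x0; field; rewrite gt_eqF.
have e2 : K ^+ 2 * (D.+1%:R * Z * #|A|%:R) = c1 ^+ 2 / D.+1%:R * #|A|%:R * Z.
  by rewrite /K; move: (D.+1%:R) D0 => x x0; field; rewrite gt_eqF.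
rewrite e1 -/sTG in h1; rewrite e2 -/sGG in h2; rewrite -/c1 -[leRHS]/sTT.
by move: (_ * Z) h1 h2 h3 => Y h1 h2 h3; lra.
Qed.

End VarianceLowerBound.

Section IsingVariance.
Variables (R : rcfType) (V : finType) (e : rel V) (b lam : R) (D : nat).
Implicit Types (X A : {set V}) (i j k : V).
Hypothesis e_sym : symmetric e.
Hypothesis e_irr : irreflexive e.
Hypothesis b01 : 0 < b <= 1.
Hypothesis lam_gt0 : 0 < lam.
Hypothesis degree_le : forall i, (#|[set j | e i j]| <= D)%N.

Definition gibbs_weight X : R := lam ^+ #|X| * ising_weight e b X.

(** Worst case of one flip: the field factor changes by [lam] or its inverse, and at most [D] edges
    each lose a factor [b ^+ 2]. *)
Definition flip_rate : R := Num.min lam lam^-1 * (b ^+ 2) ^+ D.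

Let local_weight i X : R :=
  \prod_(a in setT :\ i) (if e i a then edge_weight b i a X ^+ 2 else 1).

Let b0 : 0 < b. Proof. by case/andP: b01. Qed.

Let ew_itv i a X : b ^+ 2 <= edge_weight b i a X ^+ 2 <= 1.
Proof.
have b1 : b ^+ 2 <= 1 by case/andP: b01 => h h'; rewrite exprn_ile1 // ltW.
by rewrite /edge_weight; case: ifP => _; rewrite ?expr1n ?b1 ?lexx.
Qed.

Let local_weight_le1 i X : local_weight i X <= 1.
Proof.
apply: prodr_ile1 => a _; case: ifP => _; last by rewrite ler01 lexx.
by have /andP[_ ->] := ew_itv i a X; rewrite sqr_ge0.
Qed.

Let local_weight_ge i X : (b ^+ 2) ^+ D <= local_weight i X.
Proof.
have b2 : 0 <= b ^+ 2 <= 1.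
  by rewrite sqr_ge0 /=; case/andP: b01 => h h'; rewrite exprn_ile1 // ltW.
apply: (@le_trans _ _ (\prod_(a in setT :\ i) (if e i a then b ^+ 2 else 1))).
  rewrite -big_mkcondr /= prodr_const; have /andP[h1 h2] := b2.
  apply: ler_wiXn2l => //; apply: leq_trans (degree_le i).
  by apply: subset_leq_card; apply/subsetP => a; rewrite !inE => /andP[].
apply: ler_prod => a _; case: ifP => _; last by rewrite ler01 lexx.
by have /andP[-> _] := ew_itv i a X; rewrite sqr_ge0.
Qed.

Let ising_weight_local i X :
  ising_weight e b X = pair_weight e b (setT :\ i) X * local_weight i X.
Proof. by rewrite /ising_weight (pair_weightD1 b e_sym e_irr X (in_setT i)). Qed.

Let pair_weight_flip i X :
  pair_weight e b (setT :\ i) (flip i X) = pair_weight e b (setT :\ i) X.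
Proof.
apply: pair_weight_ext; apply/setP => k; rewrite !inE.
by case: eqVneq; rewrite ?andbF ?addbF.
Qed.

Let site_weight X : lam ^+ #|X| = \prod_k (if k \in X then lam else 1).
Proof. by rewrite -big_mkcond prodr_const. Qed.

Lemma gibbs_weight_gt0 X : 0 < gibbs_weight X.
Proof. by rewrite mulr_gt0 ?exprn_gt0 // ising_weight_gt0. Qed.

Lemma flip_rate_gt0 : 0 < flip_rate.
Proof. by rewrite mulr_gt0 ?exprn_gt0 // lt_min lam_gt0 invr_gt0. Qed.

Lemma gibbs_weight_flip i X : flip_rate * gibbs_weight X <= gibbs_weight (flip i X).
Proof.
rewrite /flip_rate /gibbs_weight mulrACA; apply: ler_pM.
- by rewrite mulr_ge0 ?exprn_ge0 ?le_min ?invr_ge0 ?(ltW lam_gt0).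
- by rewrite mulr_ge0 ?exprn_ge0 ?sqr_ge0 // ltW // ising_weight_gt0.
- rewrite !site_weight (bigD1 i) //= [leRHS](bigD1 i) //= in_flip eqxx addbT.
  rewrite mulrA; have -> : \prod_(k | k != i) (if k \in flip i X then lam else 1) =
      \prod_(k | k != i) (if k \in X then lam else 1).
    by apply: eq_bigr => k /negPf ki; rewrite in_flip ki addbF.
  apply: ler_wpM2r; first by apply: prodr_ge0 => k _; case: ifP => _; rewrite // ltW.
  have l0 := lt0r_neq0 lam_gt0.
  case: (i \in X) => /=; last by rewrite mulr1 ge_min lexx.
  by rewrite -ler_pdivlMr // div1r ge_min lexx orbT.
- rewrite !(ising_weight_local i) pair_weight_flip mulrCA.
  have P0 : 0 <= pair_weight e b (setT :\ i) X.
    apply: prodr_ge0 => a _; apply: prodr_ge0 => c _.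
    by case: ifP => // _; rewrite /edge_weight; case: ifP => // _; exact: ltW.
  apply: ler_wpM2l => //; apply: le_trans (local_weight_ge i _).
  by apply: ler_piMr => //; rewrite exprn_ge0 // sqr_ge0.
Qed.

(** A flip at i alters only the edges at i, gathered in [local_weight i], and these do not see a
    site j that is not adjacent to i. *)
Lemma gibbs_weight_indep i j X : i != j -> ~~ e i j ->
  gibbs_weight (flip j (flip i X)) * gibbs_weight X =
  gibbs_weight (flip i X) * gibbs_weight (flip j X).
Proof.
move=> ij eij; rewrite /gibbs_weight mulrACA [RHS]mulrACA; congr (_ * _).
  rewrite !site_weight -!big_split; apply: eq_bigr => k _ /=; rewrite !in_flip.
  case: (eqVneq k i) => [->|_]; rewrite ?(negPf ij) !addbF //.
  by rewrite mulrC.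
have far Y : local_weight i (flip j Y) = local_weight i Y.
  apply: eq_bigr => a _; case: (boolP (e i a)) => // ia.
  rewrite /edge_weight !in_flip (negPf ij) addbF.
  case: (eqVneq a j) => [aj|_]; last by rewrite addbF.
  by rewrite -aj ia in eij.
rewrite (flipC j i) !(ising_weight_local i) !pair_weight_flip -flipC !far; ring.
Qed.

Lemma gibbs_variance_lower_bound A (m : R) :
  \sum_X gibbs_weight X * (#|X :&: A|%:R - m) = 0 ->
  (flip_rate / (1 + flip_rate) / 2) ^+ 2 / (D.+1)%:R * #|A|%:R
    * (\sum_X gibbs_weight X) <=
  \sum_X gibbs_weight X * (#|X :&: A|%:R - m) ^+ 2.
Proof.
apply: (@variance_lower_bound _ _ e) => //.
- exact: gibbs_weight_gt0.
- exact: flip_rate_gt0.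
- exact: gibbs_weight_flip.
- exact: gibbs_weight_indep.
Qed.

End IsingVariance.

From mathcomp Require Import all_classical all_reals all_analysis measurable_realfun.
Import numFieldNormedType.Exports.
Local Open Scope classical_set_scope.
Local Open Scope ring_scope.

(** * Fourier smoothing of distribution functions *)

Section Calculus.
Variable R : realType.
Implicit Types (f F g : R -> R).

Lemma is_derive_continuous f (x df : R) : is_derive x 1 f df -> {for x, continuous f}.
Proof. by case=> dv _; exact/differentiable_continuous/derivable1_diffP. Qed.

Lemma is_derive_le f df (x y : R) : x <= y ->
  (forall z, x <= z <= y -> is_derive z 1 f (df z)) ->
  (forall z, x <= z <= y -> 0 <= df z) -> f x <= f y.
Proof.
move=> xy fdf df0.
have [| |c cxy] := @MVT_segment R f df x y xy.
- by move=> z /itvP zxy; apply: fdf; rewrite !zxy.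
- by apply: derivable_within_continuous => z /itvP zxy; case: (fdf z); rewrite ?zxy.
- by move/eqP; rewrite subr_eq addrC => /eqP ->; rewrite lerDl mulr_ge0 ?subr_ge0 // df0 // !(itvP cxy).
Qed.

Lemma integral_itv_is_derive F f (a b : R) : a < b ->
  (forall z, a <= z <= b -> is_derive z 1 F (f z)) -> continuous f ->
  (\int[lebesgue_measure]_(x in `[a, b]) (f x)%:E = (F b - F a)%:E)%E.
Proof.
move=> ab Ff cf; rewrite (@continuous_FTC2 _ f F) ?EFinB //.
- exact: continuous_subspaceT.
- split=> [z zab||].
  + by case: (Ff z) => //; rewrite !(itvP zab).
  + by apply: cvg_at_right_filter; apply: is_derive_continuous (Ff _ _); rewrite lexx ltW.
  + by apply: cvg_at_left_filter; apply: is_derive_continuous (Ff _ _); rewrite lexx ltW.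
- by move=> z zab; rewrite derive1E; case: (Ff z) => //; rewrite !(itvP zab).
Qed.

Lemma integral_derive_eq0 F f : (forall z : R, is_derive z 1 F (f z)) ->
  continuous f -> lebesgue_measure.-integrable setT (EFin \o f) ->
  F n%:R @[n --> \oo] --> (0 : R) -> F (- n%:R) @[n --> \oo] --> (0 : R) ->
  \int[lebesgue_measure]_x f x = 0.
Proof.
move=> Ff cf intf Fy FNy.
have mf : measurable_fun setT f by exact: continuous_measurable_fun.
pose fn n : R -> R := f \_ `[(- n%:R), n%:R].
have mfn n : measurable_fun setT (fn n).
  by apply/(measurable_restrictT f) => //; exact: measurable_funS mf.
have [|||||_ _ h] := @dominated_convergence _ _ _ lebesgue_measure setT measurableT
  (fun n x => (fn n x)%:E) (EFin \o f) (fun x => `|f x|%:E) _ _ _ _.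
- move=> n.
apply/measurable_EFinP.
exact: mfn.
- exact/measurable_EFinP.
- apply: aeW => x _; apply: cvg_near_cst.
  near=> n; rewrite /fn /= patchE mem_set //= in_itv /= -ler_norml.
  by near: n; exact: nbhs_infty_ger.
- exact: integrable_norm.
- apply: aeW => x n _ /=; rewrite lee_fin /fn patchE.
  by case: ifP => //; rewrite normr0.
have h2 : (F n%:R - F (- n%:R))%:E @[n --> \oo] --> (\int[lebesgue_measure]_x (f x)%:E)%E.
  apply: cvg_trans h; apply: near_eq_cvg; near=> n.
  rewrite -(@integral_itv_is_derive F f) //.
    by rewrite [RHS]integral_mkcond; apply: eq_integral => x _; rewrite /fn restrict_EFin.
  rewrite -subr_gt0 opprK -natrD ltr0n addn_gt0.
  by apply/orP; left; near: n; exists 1%N.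
have h3 : (F n%:R - F (- n%:R))%:E @[n --> \oo] --> (0 : R)%:E.
  by apply: cvg_EFin; [exact: nearW|]; rewrite -[X in _ --> X]subr0; apply: cvgB.
by rewrite /Rintegral (cvg_unique _ h2 h3).
Unshelve. all: end_near. Qed.

End Calculus.

Section UnderIntegral.
Context {R : realType} d {Y : measurableType d} {mu : {measure set Y -> \bar R}}.

Lemma is_derive_Rintegral (f df : R -> Y -> R) (B : set Y) (G : Y -> R) (a : R) :
  measurable B ->
  (forall x, mu.-integrable B (EFin \o f x)) ->
  (forall (x : R) y, B y -> is_derive x 1 (f ^~ y) (df x y)) ->
  (forall y, 0 <= G y) -> mu.-integrable B (EFin \o G) ->
  (forall x y, B y -> `|df x y| <= G y) ->
  is_derive a 1 (fun x => \int[mu]_(y in B) f x y) (\int[mu]_(y in B) df a y).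
Proof.
move=> mB intf fdf G0 intG dfG.
have Ia : `]a - 1, a + 1[%classic a.
  by rewrite /= in_itv /=; apply/andP; split; lra.
have d1E x y : B y -> partial1of2 f x y = df x y.
  by move=> By; rewrite partial1of2E; case: (fdf x y By).
have hd x y : `]a - 1, a + 1[%classic x -> B y -> derivable (f ^~ y) x 1.
  by move=> _ By; case: (fdf x y By).
have hG x y : `]a - 1, a + 1[%classic x -> B y -> `|partial1of2 f x y| <= G y.
  by move=> _ By; rewrite d1E //; exact: dfG.
have hi x : `]a - 1, a + 1[%classic x -> mu.-integrable B (EFin \o f x) by [].
apply: DeriveDef.
  exact: (derivable_under_integral mB Ia hi hd G0 intG hG).
rewrite -derive1E (differentiation_under_integral mB Ia hi hd G0 intG hG).
by apply: eq_Rintegral => y /set_mem By; exact: d1E.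
Qed.

End UnderIntegral.

(** * The characteristic function of the standard Gaussian law *)

Section GaussianCharacteristicFunction.
Variable R : realType.
Local Notation phi := (@normal_pdf R 0 1).
Local Notation leb := (@lebesgue_measure R).

Lemma std_normal_pdfE x : phi x = normal_peak 1 * expR (- x ^+ 2 / 2).
Proof.
by rewrite normal_pdfE ?oner_neq0 // /normal_fun subr0 expr1n.
Qed.

Lemma is_derive_std_normal_pdf (x : R) : is_derive x 1 phi (- x * phi x).
Proof.
rewrite (_ : phi = fun x => normal_peak 1 * expR (- x ^+ 2 / 2)); last first.
  by apply/funext => y; exact: std_normal_pdfE.
by apply: is_derive_eq; rewrite /GRing.scale /=; field.
Qed.

Lemma continuous_std_normal_pdf : continuous phi.
Proof. by apply: continuous_normal_pdf; exact: oner_neq0. Qed.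

(** Since |x| <= 1 + x^2/4 <= exp(x^2/4), the function is dominated by a multiple of the Gaussian
    density of variance 2. *)
Lemma integrable_norm_mul_std_normal_pdf :
  leb.-integrable setT (EFin \o (fun x => `|x| * phi x)).
Proof.
pose s : R := Num.sqrt 2.
have s2 : s ^+ 2 = 2 by rewrite sqr_sqrtr.
have s0 : s != 0 by rewrite sqrtr_eq0 -ltNge.
pose c : R := normal_peak 1 / normal_peak s.
have c0 : 0 <= c by rewrite divr_ge0 ?normal_peak_ge0.
have := @integrableZl _ _ _ leb setT measurableT c _ (integrable_normal_pdf 0 s).
apply: le_integrable => //.
  apply/measurable_EFinP; apply: measurable_funM; first exact: normr_measurable.
  exact: measurable_normal_pdf.
move=> x _; rewrite /= lee_fin [leLHS]normrM normr_id (ger0_norm (normal_pdf_ge0 _ _ _)).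
rewrite [leRHS]ger0_norm ?mulr_ge0 ?normal_pdf_ge0 ?normal_peak_ge0 ?invr_ge0 ?normal_peak_ge0 //.
rewrite std_normal_pdfE normal_pdfE // /normal_fun subr0 s2 /c -mulrA (mulrA _ (normal_peak s)).
rewrite mulVf ?gt_eqF ?normal_peak_gt0 // mul1r mulrCA ler_wpM2l ?normal_peak_ge0 //.
have -> : - x ^+ 2 / 2 = - x ^+ 2 / (2 *+ 2) - x ^+ 2 / (2 *+ 2) by rewrite -mulr_natr; field.
rewrite expRD mulrA mulNr ler_piMl ?expR_ge0 // expRN.
rewrite ler_pdivrMr ?expR_gt0 // mul1r; apply: le_trans (expR_ge1Dx _).
have : 0 <= (`|x| / 2 - 1) ^+ 2 by rewrite sqr_ge0.
rewrite sqrrB exprMn real_normK ?num_real // => h.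
move: h; set y := `|x|; set z := x ^+ 2 => h.
have -> : z / (2 *+ 2) = z * 2^-1 ^+ 2 by rewrite -mulr_natr; field.
lra.
Qed.

Lemma integrable_mul_std_normal_pdf (h : R -> R) (a b : R) : measurable_fun setT h ->
  (forall x, `|h x| <= a + b * `|x|) ->
  leb.-integrable setT (EFin \o (fun x => h x * phi x)).
Proof.
move=> mh hab.
have i1 := @integrableZl _ _ _ leb setT measurableT a _ (integrable_normal_pdf 0 1).
have i2 := integrableZl measurableT b integrable_norm_mul_std_normal_pdf.
apply: le_integrable (integrableD measurableT i1 i2) => //.
  by apply/measurable_EFinP; apply: measurable_funM => //; exact: measurable_normal_pdf.
move=> x _ /=; rewrite lee_fin normrM (ger0_norm (normal_pdf_ge0 _ _ _)).
rewrite mulrA -mulrDl normrM (ger0_norm (normal_pdf_ge0 _ _ _)).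
by rewrite ler_wpM2r ?normal_pdf_ge0 // (le_trans (hab x)) // ler_norm.
Qed.

(** Stated for [u] so as to cover n and - n at once; the domination is n^2/2 >= n - 1/2. *)
Lemma cvg_std_normal_pdf_nat (u : nat -> R) : (forall n, u n ^+ 2 = n%:R ^+ 2) ->
  phi (u n) @[n --> \oo] --> (0 : R).
Proof.
move=> un.
apply: (@squeeze_cvgr _ _ _ _ (cst 0) (fun n => normal_peak 1 * expR 2^-1 * expR (- n%:R))).
- apply: nearW => n; rewrite normal_pdf_ge0 /= std_normal_pdfE -mulrA ler_wpM2l ?normal_peak_ge0 //.
  rewrite -expRD ler_expR un.
  have : 0 <= (n%:R - 1 : R) ^+ 2 by rewrite sqr_ge0.
  by lra.
- exact: cvg_cst.
- rewrite -[X in _ --> X](mulr0 (normal_peak 1 * expR 2^-1)).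
  by apply: cvgM; [exact: cvg_cst|exact: cvgn_expR].
Qed.

(** Stein's identity: the difference of the integrands is, up to sign, the derivative of [h * phi],
    which vanishes at both infinities. *)
Lemma gaussian_by_parts (h dh : R -> R) (a b : R) :
  (forall x : R, is_derive x 1 h (dh x)) -> continuous dh ->
  (forall x, `|h x| <= a) -> (forall x, `|dh x| <= b) ->
  \int[leb]_x (x * h x * phi x) = \int[leb]_x (dh x * phi x).
Proof.
move=> hdh cdh ha hb.
have ch : continuous h by move=> x; apply: is_derive_continuous (hdh x).
have mh := continuous_measurable_fun ch.
have mdh := continuous_measurable_fun cdh.
have i1 : leb.-integrable setT (EFin \o (fun x => dh x * phi x)).
  by apply: (integrable_mul_std_normal_pdf (a := b) (b := 0)) => // x; rewrite mul0r addr0.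
have i2 : leb.-integrable setT (EFin \o (fun x => x * h x * phi x)).
  apply: (integrable_mul_std_normal_pdf (a := 0) (b := a)) => [|x].
    by apply: measurable_funM.
  by rewrite add0r normrM mulrC ler_wpM2r.
apply/esym/eqP; rewrite -subr_eq0 -RintegralB //; apply/eqP.
have cF (u : nat -> R) : (forall n, u n ^+ 2 = n%:R ^+ 2) ->
    h (u n) * phi (u n) @[n --> \oo] --> (0 : R).
  move=> un; apply: norm_cvg0.
  apply: (@squeeze_cvgr _ _ _ _ (cst 0) (fun n => a * phi (u n))).
  - apply: nearW => n; rewrite normr_ge0 normrM (ger0_norm (normal_pdf_ge0 _ _ _)).
    by rewrite ler_wpM2r ?normal_pdf_ge0.
  - exact: cvg_cst.
  - rewrite -[X in _ --> X](mulr0 a).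
    by apply: cvgM; [exact: cvg_cst|exact: cvg_std_normal_pdf_nat].
apply: (@integral_derive_eq0 _ (fun x => h x * phi x)).
- move=> x; have dphi := is_derive_std_normal_pdf x; have dh' := hdh x.
  by apply: is_derive_eq; rewrite /GRing.scale /=; ring.
- move=> x; apply: cvgB; (apply: cvgM; last exact: continuous_std_normal_pdf).
    exact: cdh.
  by apply: cvgM; [exact: cvg_id|exact: ch].
- by apply: eq_integrable (integrableB measurableT i1 i2).
- exact: (cF (fun n => n%:R)).
- by apply: (cF (fun n => - n%:R)) => n; rewrite sqrrN.
Qed.

Let cont_scale (t : R) (f : R -> R) : continuous f -> continuous (fun x => f (t * x)).
Proof.
move=> cf x; apply: (@continuous_comp _ _ _ ( *%R t) f); last exact: cf.
by apply: cvgM; [exact: cvg_cst|exact: cvg_id].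
Qed.

Let bnd (f : R -> R) t x : (forall y, `|f y| <= 1) -> `|f (t * x)| <= 1 + 0 * `|x|.
Proof. by move=> f1; rewrite mul0r addr0. Qed.

Let meas (t : R) (f : R -> R) : continuous f -> measurable_fun setT (fun x => f (t * x)).
Proof. by move=> cf; apply: continuous_measurable_fun; exact: cont_scale. Qed.

Let intc (t : R) : leb.-integrable setT (EFin \o (fun x => cos (t * x) * phi x)).
Proof.
apply: (integrable_mul_std_normal_pdf (a := 1) (b := 0)); last by move=> x; apply: bnd; exact: cos_max.
by apply: meas; exact: continuous_cos.
Qed.

Let ints (t : R) : leb.-integrable setT (EFin \o (fun x => sin (t * x) * phi x)).
Proof.
apply: (integrable_mul_std_normal_pdf (a := 1) (b := 0)); last by move=> x; apply: bnd; exact: sin_max.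
by apply: meas; exact: continuous_sin.
Qed.

Let is_derive_gauss_fourier (f df : R -> R) (t : R) :
  (forall s, leb.-integrable setT (EFin \o (fun x => f (s * x) * phi x))) ->
  (forall x : R, is_derive x 1 f (df x)) -> (forall x, `|df x| <= 1) ->
  is_derive t 1 (fun s => \int[leb]_x (f (s * x) * phi x))
    (\int[leb]_x (x * df (t * x) * phi x)).
Proof.
move=> intf fdf df1.
apply: (@is_derive_Rintegral _ _ _ leb (fun s x => f (s * x) * phi x)
  (fun s x => x * df (s * x) * phi x) setT (fun x => `|x| * phi x)) => //.
- move=> s x _; have dfx := fdf (s * x).
  have -> : x * df (s * x) * phi x = (df (s * x) * x) * phi x by ring.
  have d1 : is_derive s 1 (fun s => f (s * x)) (df (s * x) * x).
    apply: (@is_derive1_comp _ f (fun s => s * x)).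
    by apply: is_derive_eq; rewrite /GRing.scale /=; ring.
  by apply: is_derive_eq; rewrite /GRing.scale /=; ring.
- by move=> x; rewrite mulr_ge0 ?normal_pdf_ge0.
- exact: integrable_norm_mul_std_normal_pdf.
- move=> s x _; rewrite !normrM (ger0_norm (normal_pdf_ge0 _ _ _)).
  by rewrite ler_wpM2r ?normal_pdf_ge0 // ler_piMr.
Qed.

Let ode_solution (u : R -> R) (t : R) :
  (forall s : R, is_derive s 1 u (- s * u s)) -> u t = u 0 * expR (- t ^+ 2 / 2).
Proof.
move=> du.
have : u t * expR (t ^+ 2 / 2) = u 0 * expR (0 ^+ 2 / 2).
  apply: (@is_derive_0_is_cst _ (fun t => u t * expR (t ^+ 2 / 2))) => s.
  by have ds := du s; apply: is_derive_eq; rewrite /GRing.scale /=; field.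
rewrite expr0n mul0r expR0 mulr1 => <-.
by rewrite mulNr expRN mulfK // gt_eqF // expR_gt0.
Qed.

(** Differentiation under the integral followed by Stein's identity gives u' = - s u, and u(0) = 1.
    The sine transform solves the same equation with u(0) = 0. *)
Lemma gaussian_cos (t : R) :
  \int[leb]_x (cos (t * x) * phi x) = expR (- t ^+ 2 / 2).
Proof.
pose u t := \int[leb]_x (cos (t * x) * phi x).
suff du : forall s : R, is_derive s 1 u (- s * u s).
  rewrite -/(u t) (ode_solution t du) /u.
  under eq_Rintegral do rewrite mul0r cos0 mul1r.
  by rewrite /Rintegral integral_normal_pdf /= mul1r.
move=> s; suff e : \int[leb]_x (x * - sin (s * x) * phi x) = - s * u s.
  rewrite -e; apply: (is_derive_gauss_fourier (df := fun x => - sin x)) => // x.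
  by rewrite normrN sin_max.
under eq_Rintegral do rewrite mulrN mulNr -mulrN1.
have dh (x : R) : is_derive x 1 (fun x => sin (s * x)) (s * cos (s * x)).
  rewrite mulrC; apply: (@is_derive1_comp _ sin (fun x => s * x)).
  by apply: is_derive_eq; rewrite /GRing.scale /=; ring.
rewrite RintegralZr //; last first.
  apply: (integrable_mul_std_normal_pdf (a := 0) (b := 1)) => [|x].
    by apply: measurable_funM => //; apply: meas; exact: continuous_sin.
  by rewrite add0r mul1r normrM ler_piMr // sin_max.
rewrite (@gaussian_by_parts _ (fun x => s * cos (s * x)) 1 `|s| dh).
- under eq_Rintegral do rewrite -mulrA.
  by rewrite RintegralZl // mulrN1 mulNr.
- move=> x; apply: cvgM; first exact: cvg_cst.
  by apply: (@cont_scale s cos); exact: continuous_cos.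
- by move=> x; exact: sin_max.
- by move=> x; rewrite normrM ler_piMr // cos_max.
Qed.

Lemma gaussian_sin (t : R) : \int[leb]_x (sin (t * x) * phi x) = 0.
Proof.
pose u t := \int[leb]_x (sin (t * x) * phi x).
suff du : forall s : R, is_derive s 1 u (- s * u s).
  rewrite -/(u t) (ode_solution t du) /u.
  under eq_Rintegral do rewrite mul0r sin0 mul0r.
  by rewrite /Rintegral integral0 mul0r.
move=> s; suff e : \int[leb]_x (x * cos (s * x) * phi x) = - s * u s.
  by rewrite -e; apply: (is_derive_gauss_fourier (df := cos)) => // x; exact: cos_max.
have dh (x : R) : is_derive x 1 (fun x => cos (s * x)) (- s * sin (s * x)).
  have -> : - s * sin (s * x) = - sin (s * x) * s by ring.
  apply: (@is_derive1_comp _ cos (fun x => s * x)).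
  by apply: is_derive_eq; rewrite /GRing.scale /=; ring.
rewrite (@gaussian_by_parts _ (fun x => - s * sin (s * x)) 1 `|s| dh).
- under eq_Rintegral do rewrite -mulrA.
  by rewrite RintegralZl.
- move=> x; apply: cvgM; first exact: cvg_cst.
  by apply: (@cont_scale s sin); exact: continuous_sin.
- by move=> x; exact: cos_max.
- by move=> x; rewrite normrM normrN ler_piMr // sin_max.
Qed.

End GaussianCharacteristicFunction.

Section TrigBounds.
Variable R : realType.
Implicit Types x u : R.

(** The Taylor bounds below are obtained by integrating one another from 0, starting from cos <=
    1. *)
Let le_from0 (f df : R -> R) x : 0 <= x -> f 0 = 0 ->
  (forall z : R, 0 <= z <= x -> is_derive z 1 f (df z)) ->
  (forall z : R, 0 <= z <= x -> 0 <= df z) -> 0 <= f x.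
Proof. by move=> x0 f0 fdf df0; rewrite -[leLHS]f0; exact: is_derive_le fdf df0. Qed.

Lemma sin_le x : 0 <= x -> sin x <= x.
Proof.
move=> x0; rewrite -subr_ge0.
apply: (@le_from0 (fun x => x - sin x)
  (fun x => 1 - cos x)) => //.
by rewrite sin0 subrr.
Qed.

Lemma cos_ge_quadratic_nonneg x : 0 <= x -> 1 - x ^+ 2 / 2 <= cos x.
Proof.
move=> x0; rewrite -subr_ge0.
apply: (@le_from0 (fun x => cos x - (1 - x ^+ 2 / 2))
  (fun x => x - sin x)) => // [|z _|z /andP[z0 _]].
- by rewrite cos0; field.
- by apply: is_derive_eq; rewrite /GRing.scale /=; field.
- by rewrite subr_ge0 sin_le.
Qed.

Lemma cos_ge_quadratic x : 1 - x ^+ 2 / 2 <= cos x.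
Proof.
by have [/cos_ge_quadratic_nonneg|x0] := leP 0 x; rewrite // -cosN -sqrrN cos_ge_quadratic_nonneg // oppr_ge0 ltW.
Qed.

Lemma norm_sin_le x : `|sin x| <= `|x|.
Proof.
wlog x0 : x / 0 <= x => [h|].
  by have [/h//|x0] := leP 0 x; rewrite -normrN -sinN -(normrN x) h // oppr_ge0 ltW.
rewrite (ger0_norm x0) ler_norml sin_le // andbT.
have [x1|x1] := leP 1 x; first by have := sin_geN1 x; lra.
have [->|xn0] := eqVneq x 0; first by rewrite sin0; lra.
have : 0 < sin x by apply: sin2_gt0; apply/andP; split; [rewrite lt0r xn0|lra].
lra.
Qed.

Lemma sin_ge_cubic x : 0 <= x -> x - x ^+ 3 / 6 <= sin x.
Proof.
move=> x0; rewrite -subr_ge0.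
apply: (@le_from0 (fun x => sin x - (x - x ^+ 3 / 6))
  (fun x => cos x - (1 - x ^+ 2 / 2))) => // [|z _|z _].
- by rewrite sin0; field.
- by apply: is_derive_eq; rewrite /GRing.scale /=; field.
- by rewrite subr_ge0 cos_ge_quadratic.
Qed.

Lemma norm_sin_sub_le x : `|sin x - x| <= `|x| ^+ 3 / 6.
Proof.
wlog x0 : x / 0 <= x => [h|].
  have [/h//|x0] := leP 0 x; have : 0 <= - x by rewrite oppr_ge0 ltW.
  by move/h; rewrite sinN -opprD !normrN.
rewrite (ger0_norm x0) ler_norml; apply/andP; split; first by have := sin_ge_cubic x0; lra.
have := sin_le x0; have : 0 <= x ^+ 3 by rewrite exprn_ge0.
lra.
Qed.

Lemma norm_cos_sub_le x : `|cos x - (1 - x ^+ 2 / 2)| <= `|x| ^+ 4 / 24.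
Proof.
wlog x0 : x / 0 <= x => [h|].
  by have [/h//|x0] := leP 0 x; rewrite -(normrN x) -cosN -sqrrN; apply: h; rewrite oppr_ge0 ltW.
rewrite ger0_norm ?subr_ge0 ?cos_ge_quadratic // (ger0_norm x0) -subr_ge0.
apply: (@le_from0 (fun x => x ^+ 4 / 24 - (cos x - (1 - x ^+ 2 / 2)))
   (fun x => sin x - (x - x ^+ 3 / 6))) => // [|z _|z /andP[z0 _]].
- by rewrite cos0; field.
- by apply: is_derive_eq; rewrite /GRing.scale /=; field.
- by rewrite subr_ge0 sin_ge_cubic.
Qed.

(** This makes [wendland_cos] nonnegative. On [0, 2) three differentiations lead to z sin z >= 0;
    beyond 2 the bound u >= 2 is enough. *)
Lemma cusa_inequality u : 0 <= u -> 3 * sin u <= u * (2 + cos u).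
Proof.
move=> u0; have [u2|u2] := leP 2 u.
  apply: (@le_trans _ _ (2 * (2 + cos u))); last first.
    by rewrite ler_wpM2r //; have := cos_geN1 u; lra.
  have := cos2Dsin2 u; set c := cos u; set s := sin u => cs.
  (* The two squares sum to 1 + c - 3 s / 2 + 13/16, which yields 2 c - 3 s >= -29/8 > -4. *)
  by have := sqr_ge0 (c + 2^-1); have := sqr_ge0 (s - 3 / 4); lra.
rewrite -subr_ge0.
have s0 z : 0 <= z < 2 -> 0 <= sin z.
  move=> /andP[z0 z2]; have [->|zn0] := eqVneq z 0; first by rewrite sin0.
  by apply/ltW/sin2_gt0; rewrite lt0r zn0 z0.
have h1 z : 0 <= z <= u -> 0 <= sin z - z * cos z.
  move=> /andP[z0 zu].
  apply: (@le_from0 (fun z => sin z - z * cos z)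
    (fun z => z * sin z)) => // [|y _|y /andP[y0 yz]].
  - by rewrite sin0; ring.
  - by apply: is_derive_eq; rewrite /GRing.scale /=; ring.
  - by rewrite mulr_ge0 // s0 // y0; lra.
have h2 z : 0 <= z <= u -> 0 <= 2 - 2 * cos z - z * sin z.
  move=> /andP[z0 zu].
  apply: (@le_from0 (fun z => 2 - 2 * cos z - z * sin z)
    (fun z => sin z - z * cos z)) => // [|y _|y /andP[y0 yz]].
  - by rewrite cos0; ring.
  - by apply: is_derive_eq; rewrite /GRing.scale /=; ring.
  - by apply: h1; rewrite y0; lra.
apply: (@le_from0 (fun z => z * (2 + cos z) - 3 * sin z)
  (fun z => 2 - 2 * cos z - z * sin z)) => // [|y _].
- by rewrite sin0; ring.
- by apply: is_derive_eq; rewrite /GRing.scale /=; ring.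
Qed.

End TrigBounds.

(** * Functions with Fourier transform in [-1, 1] that approximate a step *)

Section SmoothingKernels.
Variable R : realType.
Implicit Types t u : R.
Local Notation leb := (@lebesgue_measure R).
Local Notation D := (`]0, 1]%classic : set R).

Lemma integrable_unit_itv (f : R -> R) (c : R) : measurable_fun D f ->
  (forall t, 0 < t <= 1 -> `|f t| <= c) -> leb.-integrable D (EFin \o f).
Proof.
move=> mf fc; apply: measurable_bounded_integrable => //.
- by rewrite /= lebesgue_measure_itv /= lte01 oppr0 adde0 ltry.
- exists c; split; first exact: num_real.
  move=> x cx t /= tD; apply: (le_trans _ (ltW cx)); apply: fc.
  by rewrite !(itvP tD).
Qed.

Lemma Rintegral_unit_itv (F f : R -> R) :
  (forall t : R, 0 <= t <= 1 -> is_derive t 1 F (f t)) -> continuous f ->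
  \int[leb]_(t in D) f t = F 1 - F 0.
Proof.
move=> Ff cf; rewrite Rintegral_itv_obnd_cbnd.
  by rewrite /Rintegral (@integral_itv_is_derive _ F f).
have : leb.-integrable `[0, 1] (EFin \o f).
  apply: continuous_compact_integrable; first exact: segment_compact.
  exact: continuous_subspaceT.
by apply: integrableS => //; apply: subset_itv; rewrite bnd_simp.
Qed.

(* A positive definite weight, so that the primitive of its Fourier transform
   is monotone. *)
Definition wendland t : R := (1 - t) ^+ 3 * (3 * t + 1).

Definition wendland_cos u : R := \int[leb]_(t in D) (wendland t * cos (t * u)).

(** The odd primitive of [wendland_cos]. It behaves like a multiple of the sign of u, and its mean
    under a law only involves the characteristic function at frequencies in (0, 1]. *)
Definition smooth_sign u : R := \int[leb]_(t in D) (wendland t / t * sin (t * u)).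

(** A nonnegative kernel decaying like 1/u^2; a multiple of it dominates the distance of the step to
    its smoothed version. *)
Definition bump u : R := \int[leb]_(t in D) ((1 - t) ^+ 2 * cos (t * u)).

Lemma wendland_itv t : 0 <= t <= 1 -> 0 <= wendland t <= 1.
Proof.
move=> /andP[t0 t1]; rewrite /wendland; apply/andP; split.
  by apply: mulr_ge0; [rewrite exprn_ge0 // subr_ge0|lra].
have e : 1 - (1 - t) ^+ 3 * (3 * t + 1) = t ^+ 2 * (6 - 8 * t + 3 * t ^+ 2) by ring.
by rewrite -subr_ge0 e; apply: mulr_ge0; [exact: sqr_ge0|nra].
Qed.

Lemma continuous_wendland : continuous wendland.
Proof.
move=> t; apply: (@is_derive_continuous _ _ _ (- 12 * t * (1 - t) ^+ 2)).
by rewrite /wendland; apply: is_derive_eq; rewrite /GRing.scale /=; ring.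
Qed.

Lemma continuous_comp_mulr (f : R -> R) u : continuous f -> continuous (fun t : R => f (t * u)).
Proof.
move=> cf x; apply: (@continuous_comp _ _ _ (fun x : R => x * u) f); last exact: cf.
by apply: cvgM; [exact: cvg_id|exact: cvg_cst].
Qed.

Lemma continuous_mul (f g : R -> R) : continuous f -> continuous g ->
  continuous (fun t => f t * g t).
Proof. by move=> cf cg x; apply: cvgM; [exact: cf|exact: cg]. Qed.

Lemma measurable_smooth_sign_weight : measurable_fun D (fun t => wendland t / t).
Proof.
apply: measurable_funM.
  by apply: measurable_funTS; apply: continuous_measurable_fun; exact: continuous_wendland.
apply: subspace_continuous_measurable_fun => //.
apply: continuous_in_subspaceT => t /set_mem /= tD.
by apply: inv_continuous; rewrite gt_eqF // (itvP tD).
Qed.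

Lemma norm_smooth_sign_weight t : 0 < t <= 1 -> `|wendland t / t| <= t^-1.
Proof.
move=> /andP[t0 t1]; have /andP[w0 w1] : 0 <= wendland t <= 1 by apply: wendland_itv; rewrite ltW.
have t'0 : 0 <= t^-1 by rewrite invr_ge0 ltW.
by rewrite normrM (ger0_norm w0) (ger0_norm t'0) ler_piMl.
Qed.

Lemma norm_smooth_sign_integrand t u : 0 < t <= 1 -> `|wendland t / t * sin (t * u)| <= `|u|.
Proof.
move=> t01; have t0 : 0 < t by case/andP: t01.
rewrite normrM; apply: (@le_trans _ _ (t^-1 * (t * `|u|))).
  apply: ler_pM => //; first exact: norm_smooth_sign_weight.
  by rewrite -[X in X * `|u|]gtr0_norm // -normrM norm_sin_le.
by rewrite mulKf // gt_eqF.
Qed.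

Lemma integrable_smooth_sign u : leb.-integrable D (EFin \o (fun t => wendland t / t * sin (t * u))).
Proof.
apply: (@integrable_unit_itv _ `|u|) => [|t]; last exact: norm_smooth_sign_integrand.
apply: measurable_funM; first exact: measurable_smooth_sign_weight.
apply: measurable_funTS; apply: continuous_measurable_fun.
by apply: continuous_comp_mulr; exact: continuous_sin.
Qed.

Lemma is_derive_smooth_sign u : is_derive u 1 smooth_sign (wendland_cos u).
Proof.
apply: (@is_derive_Rintegral _ _ _ leb (fun u t => wendland t / t * sin (t * u))
  (fun u t => wendland t * cos (t * u)) D (fun=> 1)) => //.
- exact: integrable_smooth_sign.
- move=> x t /= tD; have t0 : t != 0 by rewrite gt_eqF // (itvP tD).
  have d1 : is_derive x 1 (fun x => sin (t * x)) (cos (t * x) * t).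
    apply: (@is_derive1_comp _ sin (fun x => t * x)).
    by apply: is_derive_eq; rewrite /GRing.scale /=; ring.
  by apply: is_derive_eq; rewrite /GRing.scale /=; field.
- apply: (@integrable_unit_itv _ 1) => // t _; by rewrite normr1.
- move=> x t /= tD; have /andP[w0 w1] : 0 <= wendland t <= 1.
    by apply: wendland_itv; rewrite !(itvP tD).
  by rewrite normrM ger0_norm // -[leRHS]mulr1 ler_pM // cos_max.
Qed.

Lemma smooth_sign0 : smooth_sign 0 = 0.
Proof.
rewrite /smooth_sign; under eq_Rintegral do rewrite mulr0 sin0 mulr0.
by rewrite /Rintegral integral0.
Qed.

Lemma smooth_signN u : smooth_sign (- u) = - smooth_sign u.
Proof.
rewrite /smooth_sign -[RHS]mulN1r -RintegralZl //; last exact: integrable_smooth_sign.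
by apply: eq_Rintegral => t _; rewrite mulrN sinN mulN1r mulrN.
Qed.

(** The closed form exhibits both the sign, through Cusa's inequality, and the decay in 1/u^4. *)
Lemma wendland_cosE u : u != 0 ->
  wendland_cos u = 24 * (u * (2 + cos u) - 3 * sin u) / u ^+ 5.
Proof.
move=> u0.
(* Repeated integration by parts: the polynomials are [wendland], expanded, and its successive
   derivatives. *)
pose F t := (1 - 6 * t ^+ 2 + 8 * t ^+ 3 - 3 * t ^+ 4) * sin (t * u) / u
  + (- 12 * t + 24 * t ^+ 2 - 12 * t ^+ 3) * cos (t * u) / u ^+ 2
  - (- 12 + 48 * t - 36 * t ^+ 2) * sin (t * u) / u ^+ 3
  - (48 - 72 * t) * cos (t * u) / u ^+ 4 - 72 * sin (t * u) / u ^+ 5.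
have dF t : 0 <= t <= 1 -> is_derive t 1 F (wendland t * cos (t * u)).
  move=> _; rewrite /F /wendland.
  have ds : is_derive t 1 (fun t => sin (t * u)) (cos (t * u) * u).
    apply: (@is_derive1_comp _ sin (fun x => x * u)).
    by apply: is_derive_eq; rewrite /GRing.scale /=; ring.
  have dc : is_derive t 1 (fun t => cos (t * u)) (- sin (t * u) * u).
    apply: (@is_derive1_comp _ cos (fun x => x * u)).
    by apply: is_derive_eq; rewrite /GRing.scale /=; ring.
  apply: is_derive_eq; rewrite /GRing.scale /=; field.
  exact: u0.
rewrite /wendland_cos (Rintegral_unit_itv dF).
  by rewrite /F !mul0r !mul1r sin0 cos0; field.
apply: continuous_mul; first exact: continuous_wendland.
by apply: continuous_comp_mulr; exact: continuous_cos.
Qed.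

Lemma bumpE u : u != 0 -> bump u = 2 * (1 - sin u / u) / u ^+ 2.
Proof.
move=> u0.
pose F t := (1 - t) ^+ 2 * sin (t * u) / u
  - 2 * (1 - t) * cos (t * u) / u ^+ 2 - 2 * sin (t * u) / u ^+ 3.
have dF t : 0 <= t <= 1 -> is_derive t 1 F ((1 - t) ^+ 2 * cos (t * u)).
  move=> _; rewrite /F.
  have ds : is_derive t 1 (fun t => sin (t * u)) (cos (t * u) * u).
    apply: (@is_derive1_comp _ sin (fun x => x * u)).
    by apply: is_derive_eq; rewrite /GRing.scale /=; ring.
  have dc : is_derive t 1 (fun t => cos (t * u)) (- sin (t * u) * u).
    apply: (@is_derive1_comp _ cos (fun x => x * u)).
    by apply: is_derive_eq; rewrite /GRing.scale /=; ring.
  apply: is_derive_eq; rewrite /GRing.scale /=; field.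
  exact: u0.
rewrite /bump (Rintegral_unit_itv dF).
  by rewrite /F !mul0r !mul1r sin0 cos0; field.
apply: continuous_mul; last by apply: continuous_comp_mulr; exact: continuous_cos.
move=> t; apply: (@is_derive_continuous _ _ _ (- 2 * (1 - t))).
by apply: is_derive_eq; rewrite /GRing.scale /=; ring.
Qed.

End SmoothingKernels.

Section SmoothingPointwise.
Variable R : realType.
Implicit Types t u x y : R.
Local Notation leb := (@lebesgue_measure R).
Local Notation D := (`]0, 1]%classic : set R).
Local Notation H := (@smooth_sign R).

Lemma wendland_cos_ge0 u : 0 <= u -> 0 <= wendland_cos u.
Proof.
move=> u0; have [->|un0] := eqVneq u 0.
  apply: Rintegral_ge0 => t /= tD; rewrite mulr0 cos0 mulr1.
  by have /andP[] : 0 <= wendland t <= 1 by apply: wendland_itv; rewrite !(itvP tD).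
rewrite wendland_cosE // divr_ge0 ?exprn_ge0 // mulr_ge0 // subr_ge0.
exact: cusa_inequality.
Qed.

Lemma wendland_cos_le u : 0 < u -> wendland_cos u <= 144 / u ^+ 4.
Proof.
move=> u0; have un0 : u != 0 by rewrite gt_eqF.
rewrite wendland_cosE // ler_pdivrMr ?exprn_gt0 //.
have -> : 144 / u ^+ 4 * u ^+ 5 = 144 * u by field.
have := cos_le1 u; have := norm_sin_le u; rewrite (gtr0_norm u0) ler_norml => /andP[su _].
nra.
Qed.

(** From cos u >= -1 and sin u <= 1 the numerator is at least 24 (u - 3), which reaches 12 u from u
    = 6 on. *)
Lemma wendland_cos_ge u : 6 <= u -> 12 / u ^+ 4 <= wendland_cos u.
Proof.
move=> u6; have u0 : 0 < u by lra.
have un0 : u != 0 by rewrite gt_eqF.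
rewrite wendland_cosE // ler_pdivlMr ?exprn_gt0 //.
have -> : 12 / u ^+ 4 * u ^+ 5 = 12 * u by field.
have := cos_geN1 u; have := sin_le1 u; nra.
Qed.

Lemma smooth_sign_homo x y : 0 <= x -> x <= y -> H x <= H y.
Proof.
move=> x0 xy; apply: (is_derive_le xy) => [z _|z /andP[xz _]].
  exact: is_derive_smooth_sign.
by rewrite wendland_cos_ge0 // (le_trans x0).
Qed.

Let is_derive_cubeV (c x : R) : x != 0 ->
  is_derive x 1 (fun x => c / x ^+ 3) (- (3 * c) / x ^+ 4).
Proof.
move=> x0; have x3 : x ^+ 3 != 0 by rewrite expf_neq0.
have dV : is_derive x 1 (fun x : R => (x ^+ 3)^-1) (- (x ^+ 3) ^- 2 * (3 * x ^+ 2)).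
  apply: (@is_derive1_comp _ GRing.inv (fun x => x ^+ 3)).
    apply: is_derive_eq; first exact: (@is_deriveV _ id _ 1 1).
    by rewrite /GRing.scale /=; ring.
  by apply: is_derive_eq; rewrite /GRing.scale /=; ring.
by apply: is_derive_eq; rewrite /GRing.scale /=; field.
Qed.

(** Integration of the bound 144 / u^4 on the derivative over [x, y]. *)
Lemma smooth_sign_tail x y : 0 < x -> x <= y -> H y <= H x + 48 / x ^+ 3.
Proof.
move=> x0 xy; have y0 : 0 < y := lt_le_trans x0 xy.
have : - (H x + 48 / x ^+ 3) <= - (H y + 48 / y ^+ 3).
  apply: (@is_derive_le _ (fun x => - (H x + 48 / x ^+ 3))
    (fun x => - (wendland_cos x + - (3 * 48) / x ^+ 4)) _ _ xy) => z /andP[xz _].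
    have zn0 : z != 0 by rewrite gt_eqF // (lt_le_trans x0).
    have d1 := is_derive_smooth_sign z; have d2 := is_derive_cubeV 48 zn0.
    exact: is_deriveN.
  have := wendland_cos_le (lt_le_trans x0 xz); lra.
have : 0 <= 48 / y ^+ 3 by rewrite divr_ge0 // exprn_ge0 // ltW.
lra.
Qed.

(** By monotonicity this is the limit at infinity, that is, the normalization that turns
    [smooth_sign] into an approximate sign. *)
Definition smooth_sign_limit := sup [set H u | u in [set u | 0 <= u]].
Local Notation L := smooth_sign_limit.

Let has_sup_H : has_sup [set H u | u in [set u | 0 <= u]].
Proof.
split; first by exists (H 0), 0 => /=.
exists (H 1 + 48) => _ [u /= u0 <-].
have [u1|u1] := leP 1 u; first by have := smooth_sign_tail ltr01 u1; lra.
by have := smooth_sign_homo u0 (ltW u1); lra.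
Qed.

Lemma smooth_sign_le_limit u : 0 <= u -> H u <= L.
Proof. by move=> u0; apply: ub_le_sup; [case: has_sup_H|exists u]. Qed.

Lemma limit_le_smooth_sign u : 0 < u -> L <= H u + 48 / u ^+ 3.
Proof.
move=> u0; apply: ge_sup; first by case: has_sup_H.
move=> _ [v /= v0 <-]; have [uv|vu] := leP u v; first exact: smooth_sign_tail.
have := smooth_sign_homo v0 (ltW vu).
have : 0 <= 48 / u ^+ 3 by rewrite divr_ge0 // exprn_ge0 // ltW.
lra.
Qed.

(** On [6, 12] the derivative is at least 12 / z^4, so the function, nonnegative at 6, increases
    strictly. *)
Lemma smooth_sign_limit_gt0 : 0 < L.
Proof.
have h6 := smooth_sign_homo (lexx 0) (_ : 0 <= 6); rewrite smooth_sign0 in h6.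
have h : H 6 + 4 / 6 ^+ 3 <= H 12 + 4 / 12 ^+ 3.
  apply: (@is_derive_le _ (fun x => H x + 4 / x ^+ 3)
    (fun x => wendland_cos x + - (3 * 4) / x ^+ 4)) => [|z /andP[z6 _]|z /andP[z6 _]].
  - by lra.
  - have zn0 : z != 0 by rewrite gt_eqF //; lra.
    have d1 := is_derive_smooth_sign z; have d2 := is_derive_cubeV 4 zn0.
    exact: is_deriveD.
  - have := wendland_cos_ge z6; lra.
have := smooth_sign_le_limit (_ : 0 <= 12); lra.
Qed.

Lemma integrable_bump u : leb.-integrable D (EFin \o (fun t => (1 - t) ^+ 2 * cos (t * u))).
Proof.
apply: (@integrable_unit_itv _ _ 1) => [|t /andP[t0 t1]].
  apply: measurable_funTS; apply: measurable_funM.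
    by apply: measurable_funX; apply: measurable_funB.
  by apply: continuous_measurable_fun; apply: continuous_comp_mulr; exact: continuous_cos.
rewrite normrM ger0_norm ?sqr_ge0 // -[leRHS]mulr1 ler_pM ?sqr_ge0 ?cos_max //.
by rewrite exprn_ile1 //; lra.
Qed.

(** Replace the cosine by 1 - (t u)^2 / 2. The weights (1 - t)^2 and (1 - t)^2 t^2 have integrals
    1/3 and 1/30, and 1/3 - 2/30 = 4/15. *)
Lemma bump_ge_near u : `|u| <= 2 -> 4 / 15 <= bump u.
Proof.
move=> u2; have uu : u ^+ 2 <= 4.
  rewrite -real_normK ?num_real //; have -> : 4 = 2 ^+ 2 :> R by ring.
  by rewrite ler_pXn2r // nnegrE.
pose g t := (1 - t) ^+ 2 * (1 - (t * u) ^+ 2 / 2).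
pose G t := t - t ^+ 2 + t ^+ 3 / 3 - u ^+ 2 / 2 * (t ^+ 3 / 3 - t ^+ 4 / 2 + t ^+ 5 / 5).
have dG t : 0 <= t <= 1 -> is_derive t 1 G (g t).
  by move=> _; rewrite /G /g; apply: is_derive_eq; rewrite /GRing.scale /=; field.
have dg t : is_derive t 1 g (- 2 * (1 - t) * (1 - (t * u) ^+ 2 / 2) - (1 - t) ^+ 2 * (t * u ^+ 2)).
  by rewrite /g; apply: is_derive_eq; rewrite /GRing.scale /=; field.
have cg : continuous g by move=> t; exact: is_derive_continuous (dg t).
apply: (@le_trans _ _ (\int[leb]_(t in D) g t)).
  rewrite (Rintegral_unit_itv dG cg) /G; lra.
apply: le_Rintegral => //; last 2 first.
- exact: integrable_bump.
- by move=> t _; rewrite ler_wpM2l ?sqr_ge0 // cos_ge_quadratic.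
apply: (@integrable_unit_itv _ _ 3).
  by apply: measurable_funTS; exact: continuous_measurable_fun.
move=> t /andP[t0 t1]; rewrite /g normrM -[leRHS]mul1r ler_pM //.
  by rewrite ger0_norm ?sqr_ge0 // exprn_ile1 //; lra.
apply: (le_trans (ler_normB _ _)); rewrite normr1 ger0_norm ?divr_ge0 ?sqr_ge0 //.
rewrite exprMn; have tt : t ^+ 2 <= 1 by rewrite exprn_ile1 // ltW.
have := sqr_ge0 t; have := sqr_ge0 u; nra.
Qed.

Lemma bump_ge_far u : 2 <= `|u| -> (u ^+ 2)^-1 <= bump u.
Proof.
move=> u2; have un0 : u != 0 by rewrite -normr_gt0; lra.
have uu : 0 < u ^+ 2 by rewrite exprn_even_gt0.
rewrite bumpE // ler_pdivlMr // mulVf ?gt_eqF //.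
suff : `|sin u / u| <= 2^-1 by rewrite ler_norml => /andP[_]; lra.
rewrite normrM normfV ler_pdivrMr ?normr_gt0 //; have := sin_max u; lra.
Qed.

Lemma bump_ge0 u : 0 <= bump u.
Proof.
have [u2|/ltW u2] := leP 2 `|u|.
  by apply: le_trans (bump_ge_far u2); rewrite invr_ge0 sqr_ge0.
by apply: le_trans (bump_ge_near u2); rewrite divr_ge0.
Qed.

(** For u <= 2 the left side is at most 1/2 <= 2 (4/15). For u >= 2 it is at most 24 / (L u^3) <=
    (12 / L) / u^2. *)
Let tail_le_bump u : 0 < u -> (L - H u) / (2 * L) <= (2 + 12 / L) * bump u.
Proof.
move=> u0; have L0 := smooth_sign_limit_gt0.
have H0 : 0 <= H u by have := smooth_sign_homo (lexx 0) (ltW u0); rewrite smooth_sign0.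
have t0 : 0 <= 12 / L by rewrite divr_ge0 // ltW.
have b0 := bump_ge0 u.
have [u2|/ltW u2] := leP 2 u.
  have := bump_ge_far (_ : 2 <= `|u|); rewrite gtr0_norm // => /(_ u2) bf.
  have h := limit_le_smooth_sign u0.
  apply: (@le_trans _ _ (12 / L * (u ^+ 2)^-1)); last by nra.
  apply: (@le_trans _ _ (48 / u ^+ 3 / (2 * L))).
    by rewrite ler_pM2r ?invr_gt0 ?mulr_gt0 //; lra.
  have -> : 48 / u ^+ 3 / (2 * L) = 12 / L * (u ^+ 2)^-1 * (2 / u).
    by field; rewrite !gt_eqF.
  have c0 : 0 <= 12 / L * (u ^+ 2)^-1 by rewrite mulr_ge0 // invr_ge0 sqr_ge0.
  by rewrite ler_piMr // ler_pdivrMr // mul1r.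
have := bump_ge_near (_ : `|u| <= 2); rewrite gtr0_norm // => /(_ u2) bn.
apply: (@le_trans _ _ 2^-1).
  by rewrite ler_pdivrMr ?mulr_gt0 //; lra.
nra.
Qed.

(** The step is compared with its smoothed version pointwise, so the inequality can be integrated
    against any law; the error term is itself band-limited and hence computable from the
    characteristic function. *)
Lemma indicator_smooth_sign_le u :
  `|(u <= 0)%R%:R - (2^-1 - H u / (2 * L))| <= (2 + 12 / L) * bump u.
Proof.
have L0 := smooth_sign_limit_gt0; have L2 : 2 * L != 0 by rewrite gt_eqF // mulr_gt0.
have [u0|u0|->] := ltgtP u (0 : R).
- have nu : 0 < - u by rewrite oppr_gt0.
  have e : 1 - (2^-1 - H u / (2 * L)) = (L - H (- u)) / (2 * L).
    by rewrite smooth_signN; field; rewrite gt_eqF.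
  have bN : bump (- u) = bump u by apply: eq_Rintegral => t _; rewrite mulrN cosN.
  rewrite e ger0_norm; first by rewrite -bN tail_le_bump.
  by rewrite divr_ge0 ?subr_ge0 ?smooth_sign_le_limit // ltW // mulr_gt0.
- have e : 0 - (2^-1 - H u / (2 * L)) = - ((L - H u) / (2 * L)).
    by field; rewrite gt_eqF.
  rewrite e normrN ger0_norm; first exact: tail_le_bump.
  by rewrite divr_ge0 ?subr_ge0 ?smooth_sign_le_limit // ltW // mulr_gt0.
- rewrite smooth_sign0 mul0r subr0.
  have -> : 1 - 2^-1 = 2^-1 :> R by field.
  rewrite ger0_norm //; have := bump_ge_near (_ : `|0| <= 2); rewrite normr0 => /(_ (ler0n _ 2)) b0.
  have : 0 <= 12 / L by rewrite divr_ge0 // ltW.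
  nra.
Qed.

End SmoothingPointwise.

Section FubiniUnit.
Context {R : realType} d {T : measurableType d}.
Variable m : {sigma_finite_measure set T -> \bar R}.
Local Notation leb := (@lebesgue_measure R).
Local Notation D := (`]0, 1]%classic : set R).

(** As t runs over an interval of length 1, a majorant depending on w alone gives joint
    integrability. For Fubini on the whole line, [a] is extended by 0. *)
Lemma Rintegral_unit_exchange (a : R -> R) (g : R * T -> R) (B : T -> R) :
  measurable_fun D a -> measurable_fun setT g ->
  (forall t w, 0 < t <= 1 -> `|a t * g (t, w)| <= B w) ->
  m.-integrable setT (EFin \o B) ->
  \int[m]_w (\int[leb]_(t in D) (a t * g (t, w))) =
  \int[leb]_(t in D) (\int[m]_w (a t * g (t, w))).
Proof.
move=> ma mg agB iB.
pose f (z : R * T) : R := (a \_ D) z.1 * g z.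
have mf : measurable_fun setT f.
  apply: measurable_funM => //; apply: measurableT_comp => //.
  by apply/(measurable_restrictT a).
have B0 w : 0 <= B w by apply: le_trans (agB 1 w _); rewrite ?normr_ge0 // ltr01 lexx.
have fB t w : `|f (t, w)| <= \1_D t * B w.
  rewrite /f /= patchE indicE; case: ifP => tD; last by rewrite !mul0r normr0.
  by rewrite mul1r; apply: agB; move/set_mem: tD => /= tD; rewrite !(itvP tD).
have mfE : measurable_fun setT (EFin \o f) by exact/measurable_EFinP.
have int_f : (leb \x m)%E.-integrable setT (EFin \o f).
  apply/(integrable12ltyP leb m mfE).
  apply: (@le_lt_trans _ _ (\int[leb]_t ((\1_D t)%:E * (\int[m]_w (B w)%:E)))%E).
    apply: ge0_le_integral => //.
    - by move=> t _; apply: integral_ge0.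
    - apply: (measurable_fun_fubini_tonelli_F (abse \o (EFin \o f))).
        exact: measurableT_comp.
      by move=> z; exact: abse_ge0.
    - apply: emeasurable_funM => //; apply/measurable_EFinP.
      exact: measurable_indic.
    - move=> t _; rewrite -ge0_integralZl //; last by move=> w _; rewrite lee_fin.
        apply: ge0_le_integral => //.
        + by apply: measurableT_comp => //; apply: (measurableT_comp mfE); exact: measurable_pair1.
        + by apply: emeasurable_funM => //; case/integrableP: iB.
        + by move=> w _; rewrite /= -EFinM lee_fin.
      by case/integrableP: iB.
  rewrite ge0_integralZr //; first last.
  - by apply: integral_ge0 => w _; rewrite lee_fin.
  - by apply/measurable_EFinP; exact: measurable_indic.
  rewrite integral_indic // setIT /= lebesgue_measure_itv /= lte01 oppr0 adde0 mul1e.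
  have /integrableP[_] := iB; apply: le_lt_trans.
  by rewrite le_eqVlt; apply/orP; left; apply/eqP; apply: eq_integral => w _ /=; rewrite ger0_norm.
have := Fubini int_f.
have finw w : (\int[leb]_t (f (t, w))%:E)%E = (\int[leb]_(t in D) (a t * g (t, w)))%:E.
  have -> : (\int[leb]_t (f (t, w))%:E)%E = (\int[leb]_(t in D) (a t * g (t, w))%:E)%E.
    rewrite [RHS]integral_mkcond; apply: eq_integral => t _.
    by rewrite /f /= !patchE; case: ifP => // _; rewrite mul0r.
  rewrite /Rintegral fineK //; apply: integrable_fin_num => //.
  apply: (@integrable_unit_itv _ (fun t => a t * g (t, w)) (B w)) => [|t t01]; last exact: agB.
  apply: measurable_funM => //; apply: measurable_funTS; apply: (measurableT_comp mg).
  exact: measurable_pair2.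
have fint t : D t -> (\int[m]_w (f (t, w))%:E)%E = (\int[m]_w (a t * g (t, w)))%:E.
  move=> tD; have fE w : f (t, w) = a t * g (t, w) by rewrite /f /= patchE mem_set.
  under eq_integral do rewrite fE.
  rewrite /Rintegral fineK //; apply: integrable_fin_num => //.
  apply: (le_integrable measurableT _ _ iB).
    apply/measurable_EFinP; apply: measurable_funM => //; apply: (measurableT_comp mg).
    exact: measurable_pair1.
  move=> w _ /=; rewrite lee_fin [leRHS]ger0_norm //.
  by apply: agB; rewrite !(itvP (tD : t \in `]0, 1])).
rewrite /Rintegral => FE.
have -> : (\int[m]_w (\int[leb]_(t in D) (a t * g (t, w)))%:E)%E =
    (\int[m]_w \int[leb]_t (f (t, w))%:E)%E.
  by apply: eq_integral => w _; rewrite finw.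
rewrite -FE [in RHS]integral_mkcond; congr fine; apply: eq_integral => t _.
rewrite patchE; case: ifP => tD; first by rewrite fint //; exact: set_mem.
rewrite (@eq_integral _ _ _ _ _ (cst 0%E)) ?integral0 // => w _.
by rewrite /f /= patchE tD mul0r.
Qed.

End FubiniUnit.

Section KernelRegularity.
Variable R : realType.
Local Notation leb := (@lebesgue_measure R).

Lemma continuous_smooth_sign : continuous (@smooth_sign R).
Proof. by move=> u; exact: is_derive_continuous (is_derive_smooth_sign u). Qed.

Lemma continuous_bump : continuous (@bump R).
Proof.
move=> u; pose db u : R := \int[leb]_(t in `]0, 1]) ((1 - t) ^+ 2 * (- sin (t * u) * t)).
apply: (@is_derive_continuous _ _ _ (db u)).
apply: (@is_derive_Rintegral _ _ _ leb (fun u t => (1 - t) ^+ 2 * cos (t * u))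
  (fun u t => (1 - t) ^+ 2 * (- sin (t * u) * t)) _ (fun=> 1)) => //.
- exact: integrable_bump.
- move=> x t _.
  have d1 : is_derive x 1 (fun x => cos (t * x)) (- sin (t * x) * t).
    apply: (@is_derive1_comp _ cos (fun x => t * x)).
    by apply: is_derive_eq; rewrite /GRing.scale /=; ring.
  by apply: is_derive_eq; rewrite /GRing.scale /=; ring.
- by apply: (@integrable_unit_itv _ _ 1) => // t _; rewrite normr1.
- move=> x t /= /itvP tD; rewrite normrM (ger0_norm (sqr_ge0 _)) normrM normrN.
  rewrite -[leRHS]mulr1 ler_pM ?sqr_ge0 ?mulr_ge0 //.
    by rewrite exprn_ile1 // ?subr_ge0 ?tD // lerBlDr lerDl tD.
  by rewrite -[leRHS]mulr1 ler_pM ?sin_max // gtr0_norm tD.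
Qed.

End KernelRegularity.

(** * Laws with a density [rho]: a probability with density 1 and the Gaussian density over Lebesgue
    measure are treated alike *)

Section WeightedLaw.
Context {R : realType} d {T : measurableType d}.
Variables (m : {sigma_finite_measure set T -> \bar R}) (rho X : T -> R).
Local Notation leb := (@lebesgue_measure R).
Local Notation D := (`]0, 1]%classic : set R).
Local Notation H := (@smooth_sign R).
Local Notation L := (smooth_sign_limit R).
Hypothesis mrho : measurable_fun setT rho.
Hypothesis mX : measurable_fun setT X.
Hypothesis rho_ge0 : forall w, 0 <= rho w.
Hypothesis irho : m.-integrable setT (EFin \o rho).
Hypothesis irho1 : \int[m]_w rho w = 1.
Hypothesis iX : m.-integrable setT (EFin \o (fun w => `|X w| * rho w)).

Let weighted_integrable (h : R -> R) (a b : R) : measurable_fun setT h ->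
  (forall x, `|h x| <= a + b * `|x|) ->
  m.-integrable setT (EFin \o (fun w => h (X w) * rho w)).
Proof.
move=> mh hab.
have i1 := @integrableZl _ _ _ m setT measurableT a _ irho.
have i2 := integrableZl measurableT b iX.
apply: le_integrable (integrableD measurableT i1 i2) => //.
  by apply/measurable_EFinP; apply: measurable_funM => //; exact: measurableT_comp.
move=> w _ /=; rewrite lee_fin normrM (ger0_norm (rho_ge0 _)).
rewrite mulrA -mulrDl normrM (ger0_norm (rho_ge0 _)).
by rewrite ler_wpM2r // (le_trans (hab _)) // ler_norm.
Qed.

Definition weighted_cos (t : R) : R := \int[m]_w (cos (t * X w) * rho w).
Definition weighted_sin (t : R) : R := \int[m]_w (sin (t * X w) * rho w).

Let mscale (f : R -> R) (t : R) : continuous f -> measurable_fun setT (fun x => f (t * x)).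
Proof.
move=> cf; apply: continuous_measurable_fun => x.
apply: (@continuous_comp _ _ _ ( *%R t) f); last exact: cf.
by apply: cvgM; [exact: cvg_cst|exact: cvg_id].
Qed.

Lemma weighted_cos_integrable t :
  m.-integrable setT (EFin \o (fun w => cos (t * X w) * rho w)).
Proof.
apply: (@weighted_integrable (fun x => cos (t * x)) 1 0) => [|x].
  by apply: mscale; exact: continuous_cos.
by rewrite mul0r addr0 cos_max.
Qed.

Lemma weighted_sin_integrable t :
  m.-integrable setT (EFin \o (fun w => sin (t * X w) * rho w)).
Proof.
apply: (@weighted_integrable (fun x => sin (t * x)) 1 0) => [|x].
  by apply: mscale; exact: continuous_sin.
by rewrite mul0r addr0 sin_max.
Qed.

Let continuous_weighted (f df : R -> R) :
  (forall t, m.-integrable setT (EFin \o (fun w => f (t * X w) * rho w))) ->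
  (forall x : R, is_derive x 1 f (df x)) -> (forall x, `|df x| <= 1) ->
  continuous (fun t : R => \int[m]_w (f (t * X w) * rho w)).
Proof.
move=> intf fdf df1 t.
apply: (@is_derive_continuous _ _ _ (\int[m]_w (df (t * X w) * X w * rho w))).
apply: (@is_derive_Rintegral _ _ _ m (fun t w => f (t * X w) * rho w)
  (fun t w => df (t * X w) * X w * rho w) setT (fun w => `|X w| * rho w)) => //.
- move=> s w _; have dfx := fdf (s * X w).
  have d1 : is_derive s 1 (fun s => f (s * X w)) (df (s * X w) * X w).
    apply: (@is_derive1_comp _ f (fun s => s * X w)).
    by apply: is_derive_eq; rewrite /GRing.scale /=; ring.
  by apply: is_derive_eq; rewrite /GRing.scale /=; ring.
- by move=> w; rewrite mulr_ge0.
- move=> s w _; rewrite !normrM (ger0_norm (rho_ge0 _)).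
  by rewrite ler_wpM2r // ler_piMl.
Qed.

Lemma continuous_weighted_cos : continuous weighted_cos.
Proof.
apply: (continuous_weighted (df := fun x => - sin x) weighted_cos_integrable) => x.
by rewrite normrN sin_max.
Qed.

Lemma continuous_weighted_sin : continuous weighted_sin.
Proof.
by apply: (continuous_weighted (df := cos) weighted_sin_integrable) => x; rewrite cos_max.
Qed.

Variables (s x : R).
Hypothesis s_gt0 : 0 < s.
Local Notation Y := (fun w => s * (X w - x)).

Lemma weighted_sin_shift t : \int[m]_w (sin (t * Y w) * rho w) =
  cos (t * s * x) * weighted_sin (t * s) - sin (t * s * x) * weighted_cos (t * s).
Proof.
rewrite /weighted_sin /weighted_cos -!RintegralZl //; last 2 first.
- exact: weighted_cos_integrable.
- exact: weighted_sin_integrable.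
rewrite -RintegralB //; last 2 first.
- have := integrableZl measurableT (cos (t * s * x)) (weighted_sin_integrable (t * s)).
  by apply: eq_integrable.
- have := integrableZl measurableT (sin (t * s * x)) (weighted_cos_integrable (t * s)).
  by apply: eq_integrable.
apply: eq_Rintegral => w _.
have -> : t * (s * (X w - x)) = t * s * X w - t * s * x by ring.
by rewrite sinB; ring.
Qed.

Lemma weighted_cos_shift t : \int[m]_w (cos (t * Y w) * rho w) =
  cos (t * s * x) * weighted_cos (t * s) + sin (t * s * x) * weighted_sin (t * s).
Proof.
rewrite /weighted_sin /weighted_cos -!RintegralZl //; last 2 first.
- exact: weighted_sin_integrable.
- exact: weighted_cos_integrable.
rewrite -RintegralD //; last 2 first.
- have := integrableZl measurableT (cos (t * s * x)) (weighted_cos_integrable (t * s)).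
  by apply: eq_integrable.
- have := integrableZl measurableT (sin (t * s * x)) (weighted_sin_integrable (t * s)).
  by apply: eq_integrable.
apply: eq_Rintegral => w _.
have -> : t * (s * (X w - x)) = t * s * X w - t * s * x by ring.
by rewrite cosB; ring.
Qed.

Let mshift (f : R -> R) : measurable_fun setT f ->
  measurable_fun setT (fun y : R => f (s * (y - x))).
Proof.
move=> mf; apply: (measurableT_comp mf); apply: continuous_measurable_fun => y.
by apply: cvgM; [exact: cvg_cst|apply: cvgB; [exact: cvg_id|exact: cvg_cst]].
Qed.

Let mY : measurable_fun setT Y.
Proof. by apply: measurable_funM => //; apply: measurable_funB. Qed.

Let measurable_trig (f : R -> R) : continuous f ->
  measurable_fun setT (fun z : R * T => f (z.1 * Y z.2) * rho z.2).
Proof.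
move=> cf; apply: measurable_funM; last exact: measurableT_comp.
apply: measurableT_comp; first exact: continuous_measurable_fun.
by apply: measurable_funM => //; apply: (measurableT_comp mY).
Qed.

Lemma weighted_smooth_sign : \int[m]_w (H (Y w) * rho w) =
  \int[leb]_(t in D) (wendland t / t *
    (cos (t * s * x) * weighted_sin (t * s) - sin (t * s * x) * weighted_cos (t * s))).
Proof.
transitivity (\int[m]_w (\int[leb]_(t in D) (wendland t / t * (sin (t * Y w) * rho w)))).
  apply: eq_Rintegral => w _; rewrite /smooth_sign -RintegralZr //; last exact: integrable_smooth_sign.
  by apply: eq_Rintegral => t _; rewrite -[LHS]mulrA.
(* The singular 1/t is absorbed by |sin (t Y)| <= t |Y|; this is where the first moment of X
   enters. *)
rewrite (@Rintegral_unit_exchange _ _ _ m _ (fun z => sin (z.1 * Y z.2) * rho z.2)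
  (fun w => `|Y w| * rho w)).
- apply: eq_Rintegral => t _; rewrite RintegralZl ?weighted_sin_shift //=.
  apply: (@weighted_integrable (fun y => sin (t * (s * (y - x)))) 1 0) => [|y].
    by apply: (@mshift (fun u => sin (t * u))); apply: mscale; exact: continuous_sin.
  by rewrite mul0r addr0 sin_max.
- exact: measurable_smooth_sign_weight.
- by apply: measurable_trig; exact: continuous_sin.
- move=> t w t01; rewrite /= mulrA normrM (ger0_norm (rho_ge0 _)).
  by rewrite ler_wpM2r // norm_smooth_sign_integrand.
- apply: (@weighted_integrable (fun y => `|s * (y - x)|) (s * `|x|) s) => [|y].
    by apply: (@mshift (fun u => `|u|)); exact: normr_measurable.
  rewrite normr_id normrM gtr0_norm // -mulrDr; apply: ler_wpM2l; first exact: ltW.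
rewrite [leRHS]addrC; exact: ler_normB.
Qed.

Lemma weighted_bump : \int[m]_w (bump (Y w) * rho w) =
  \int[leb]_(t in D) ((1 - t) ^+ 2 *
    (cos (t * s * x) * weighted_cos (t * s) + sin (t * s * x) * weighted_sin (t * s))).
Proof.
transitivity (\int[m]_w (\int[leb]_(t in D) ((1 - t) ^+ 2 * (cos (t * Y w) * rho w)))).
  apply: eq_Rintegral => w _; rewrite /bump -RintegralZr //; last exact: integrable_bump.
  by apply: eq_Rintegral => t _; rewrite -[LHS]mulrA.
rewrite (@Rintegral_unit_exchange _ _ _ m _ (fun z => cos (z.1 * Y z.2) * rho z.2) rho) //.
- apply: eq_Rintegral => t _; rewrite RintegralZl ?weighted_cos_shift //=.
  apply: (@weighted_integrable (fun y => cos (t * (s * (y - x)))) 1 0) => [|y].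
    by apply: (@mshift (fun u => cos (t * u))); apply: mscale; exact: continuous_cos.
  by rewrite mul0r addr0 cos_max.
- by apply: measurable_funX; apply: measurable_funB.
- by apply: measurable_trig; exact: continuous_cos.
- move=> t w /andP[t0 t1]; rewrite /= mulrA normrM (ger0_norm (rho_ge0 _)).
  rewrite ler_piMl // normrM (ger0_norm (sqr_ge0 _)) -[leRHS]mulr1 ler_pM ?sqr_ge0 ?cos_max //.
  by rewrite exprn_ile1 //; lra.
Qed.

Definition weighted_cdf (y : R) : R := \int[m]_w ((X w <= y)%R%:R * rho w).

Lemma weighted_cdf_smoothing :
  `|weighted_cdf x - (2^-1 - (\int[m]_w (H (Y w) * rho w)) / (2 * L))|
  <= (2 + 12 / L) * \int[m]_w (bump (Y w) * rho w).
Proof.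
have L0 := smooth_sign_limit_gt0 R.
have mH : measurable_fun setT (fun y : R => H (s * (y - x))).
  by apply: mshift; apply: continuous_measurable_fun; exact: continuous_smooth_sign.
have iH : m.-integrable setT (EFin \o (fun w => H (Y w) * rho w)).
  apply: (@weighted_integrable (fun y => H (s * (y - x))) L 0) => // y.
  rewrite mul0r addr0; set u := s * _; have [u0|u0] := leP 0 u.
    rewrite ger0_norm ?smooth_sign_le_limit //.
    by have := smooth_sign_homo (lexx 0) u0; rewrite smooth_sign0.
  rewrite -[u]opprK smooth_signN normrN; have nu : 0 <= - u by rewrite oppr_ge0 ltW.
  rewrite ger0_norm ?smooth_sign_le_limit //.
  by have := smooth_sign_homo (lexx 0) nu; rewrite smooth_sign0.
have mI : measurable_fun setT (fun y : R => (y <= x)%R%:R : R).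
  rewrite (_ : (fun y : R => _) = \1_`]-oo, x]); first exact: measurable_indic.
  by apply/funext => y; rewrite indicE mem_setE in_itv.
have iI : m.-integrable setT (EFin \o (fun w => (X w <= x)%R%:R * rho w)).
  apply: (@weighted_integrable (fun y => (y <= x)%R%:R) 1 0) => // y.
  by rewrite mul0r addr0; case: (y <= x); rewrite ?normr1 ?normr0.
have mb : measurable_fun setT (fun y : R => bump (s * (y - x))).
  by apply: mshift; apply: continuous_measurable_fun; exact: continuous_bump.
have ib : m.-integrable setT (EFin \o (fun w => bump (Y w) * rho w)).
  apply: (@weighted_integrable (fun y => bump (s * (y - x))) 1 0) => // y.
  rewrite mul0r addr0; set u := s * _.
  apply: (le_trans (le_normr_Rintegral _ (integrable_bump u))) => //.
  apply: (@le_trans _ _ (\int[leb]_(t in D) 1)).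
    apply: le_Rintegral => //.
    - exact: integrable_norm (integrable_bump u).
    - by apply: (@integrable_unit_itv _ _ 1) => // t _; rewrite normr1.
    - move=> t /= /itvP tD; rewrite normrM (ger0_norm (sqr_ge0 _)) -[leRHS]mulr1.
      rewrite ler_pM ?sqr_ge0 ?cos_max // exprn_ile1 // ?subr_ge0 ?tD //.
      by rewrite lerBlDr lerDl tD.
  rewrite Rintegral_cst //= lebesgue_measure_itv /= lte01 oppr0 adde0 /=.
  by rewrite mulr1.
have iH2 : m.-integrable setT (EFin \o (fun w => (2 * L)^-1 * (H (Y w) * rho w))).
  by have := integrableZl measurableT (2 * L)^-1 iH; apply: eq_integrable.
have irho2 : m.-integrable setT (EFin \o (fun w => 2^-1 * rho w)).
  by have := @integrableZl _ _ _ m setT measurableT 2^-1 _ irho; apply: eq_integrable.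
have i3 : m.-integrable setT (EFin \o (fun w => 2^-1 * rho w - (2 * L)^-1 * (H (Y w) * rho w))).
  by have := integrableB measurableT irho2 iH2; apply: eq_integrable.
have i4 : m.-integrable setT (EFin \o (fun w => (X w <= x)%R%:R * rho w -
    (2^-1 * rho w - (2 * L)^-1 * (H (Y w) * rho w)))).
  by have := integrableB measurableT iI i3; apply: eq_integrable.
have -> : weighted_cdf x - (2^-1 - (\int[m]_w (H (Y w) * rho w)) / (2 * L)) =
    \int[m]_w ((X w <= x)%R%:R * rho w - (2^-1 * rho w - (2 * L)^-1 * (H (Y w) * rho w))).
  rewrite RintegralB // RintegralB // RintegralZl // RintegralZl // irho1 mulr1.
  by rewrite [X in _ - (_ - X)]mulrC.
apply: (le_trans (le_normr_Rintegral _ i4)) => //.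
rewrite -RintegralZl //; apply: le_Rintegral => //.
- exact: integrable_norm.
- by have := integrableZl measurableT (2 + 12 / L) ib; apply: eq_integrable.
move=> w _.
have -> : (X w <= x)%R%:R * rho w - (2^-1 * rho w - (2 * L)^-1 * (H (Y w) * rho w)) =
  ((Y w <= 0)%R%:R - (2^-1 - H (Y w) / (2 * L))) * rho w.
  by rewrite pmulr_rle0 // subr_le0; ring.
rewrite normrM (ger0_norm (rho_ge0 _)) mulrA ler_wpM2r //.
exact: indicator_smooth_sign_le.
Qed.

End WeightedLaw.

Section Comparison.
Variable R : realType.
Local Notation leb := (@lebesgue_measure R).
Local Notation D := (`]0, 1]%classic : set R).
Local Notation L := (smooth_sign_limit R).
Variables (C S : R -> R) (eps s x : R).
Hypothesis s_gt0 : 0 < s.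
Hypothesis eps_ge0 : 0 <= eps.
Hypothesis cC : continuous C.
Hypothesis cS : continuous S.
Hypothesis C_near : forall r, 0 < r <= s -> `|C r - expR (- r ^+ 2 / 2)| <= eps * r / (1 + r ^+ 2).
Hypothesis S_near : forall r, 0 < r <= s -> `|S r| <= eps * r / (1 + r ^+ 2).

Let cgauss : continuous (fun r : R => expR (- r ^+ 2 / 2)).
Proof.
move=> r; apply: (@is_derive_continuous _ _ _ (- r * expR (- r ^+ 2 / 2))).
by apply: is_derive_eq; rewrite /GRing.scale /=; field.
Qed.

Let oneDsqr_gt0 (r : R) : 0 < 1 + r ^+ 2.
Proof. by rewrite ltr_wpDr ?sqr_ge0. Qed.

(** The integral equals arctan s < pi/2 < 2, uniformly in the cutoff [s]. *)
Lemma Rintegral_cauchy_kernel_le :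
  leb.-integrable D (EFin \o (fun t => s / (1 + (t * s) ^+ 2))) /\
  \int[leb]_(t in D) (s / (1 + (t * s) ^+ 2)) <= 2.
Proof.
have df (t : R) : is_derive t 1 (fun t => s / (1 + (t * s) ^+ 2))
    (s * (- (1 + (t * s) ^+ 2) ^- 2 * (2 * t * s ^+ 2))).
  have d1 : is_derive t 1 (fun t => (1 + (t * s) ^+ 2)^-1)
      (- (1 + (t * s) ^+ 2) ^- 2 * (2 * t * s ^+ 2)).
    apply: (@is_derive1_comp _ GRing.inv (fun t => 1 + (t * s) ^+ 2)).
      apply: is_derive_eq; first by apply: (@is_deriveV _ id _ 1 1); rewrite gt_eqF.
      by rewrite /GRing.scale /=; ring.
    by apply: is_derive_eq; rewrite /GRing.scale /=; ring.
  by apply: is_derive_eq; rewrite /GRing.scale /=; ring.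
have cf : continuous (fun t : R => s / (1 + (t * s) ^+ 2)).
  by move=> t; exact: is_derive_continuous (df t).
have dF (t : R) : 0 <= t <= 1 -> is_derive t 1 (fun t => atan (t * s)) (s / (1 + (t * s) ^+ 2)).
  move=> _; rewrite mulrC; apply: (@is_derive1_comp _ atan (fun t => t * s)).
  by apply: is_derive_eq; rewrite /GRing.scale /=; ring.
split.
  apply: (@integrable_unit_itv _ _ s) => [|t t01].
    by apply: measurable_funTS; exact: continuous_measurable_fun.
  have s0 := ltW s_gt0; have d0 := oneDsqr_gt0 (t * s); have d0' := ltW d0.
  by rewrite ger0_norm ?divr_ge0 // ler_pdivrMr // ler_peMr // lerDl sqr_ge0.
rewrite (Rintegral_unit_itv dF cf) mul0r mul1r atan0 subr0.
by have := atan_ltpi2 s; have /andP[_] := @pihalf_02 R; lra.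
Qed.

Let integrable_on_unit (f : R -> R) : continuous f ->
  leb.-integrable D (EFin \o f).
Proof.
move=> cf; have : leb.-integrable `[0, 1] (EFin \o f).
  apply: continuous_compact_integrable; first exact: segment_compact.
  exact: continuous_subspaceT.
by apply: integrableS => //; apply: subset_itv; rewrite bnd_simp.
Qed.

Let ccos : continuous (fun t : R => cos (t * s * x)).
Proof.
move=> t; apply: (@is_derive_continuous _ _ _ (- sin (t * s * x) * (s * x))).
apply: (@is_derive1_comp _ cos (fun t => t * s * x)).
by apply: is_derive_eq; rewrite /GRing.scale /=; ring.
Qed.

Let csin : continuous (fun t : R => sin (t * s * x)).
Proof.
move=> t; apply: (@is_derive_continuous _ _ _ (cos (t * s * x) * (s * x))).
apply: (@is_derive1_comp _ sin (fun t => t * s * x)).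
by apply: is_derive_eq; rewrite /GRing.scale /=; ring.
Qed.

Local Notation A C' S' := (\int[leb]_(t in D) (wendland t / t *
    (cos (t * s * x) * S' (t * s) - sin (t * s * x) * C' (t * s)))).
Local Notation B C' S' := (\int[leb]_(t in D) ((1 - t) ^+ 2 *
    (cos (t * s * x) * C' (t * s) + sin (t * s * x) * S' (t * s)))).
Local Notation g := (fun r : R => expR (- r ^+ 2 / 2)).
Local Notation zero := (fun _ : R => 0 : R).

Let norm_comb (a b p q : R) : `|a| <= 1 -> `|b| <= 1 -> `|a * p + b * q| <= `|p| + `|q|.
Proof.
move=> a1 b1; apply: (le_trans (ler_normD _ _)); rewrite !normrM.
by rewrite lerD // ler_piMl.
Qed.

Let integrable_A (C' S' : R -> R) (a c : R) : continuous C' -> continuous S' ->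
  (forall r, 0 < r <= s -> `|C' r| <= c) -> (forall r, 0 < r <= s -> `|S' r| <= a * r) ->
  leb.-integrable D (EFin \o (fun t => wendland t / t *
    (cos (t * s * x) * S' (t * s) - sin (t * s * x) * C' (t * s)))).
Proof.
move=> cC' cS' Cc Sa; apply: (@integrable_unit_itv _ _ (a * s + s * `|x| * c)).
  apply: measurable_funM; first exact: measurable_smooth_sign_weight.
  apply: measurable_funTS; apply: continuous_measurable_fun => t.
  apply: cvgB; (apply: cvgM; [|exact: continuous_comp_mulr]).
    exact: ccos.
  exact: csin.
move=> t t01; have /andP[t0 t1] := t01.
have ts : 0 < t * s <= s by rewrite mulr_gt0 // ler_piMl // ltW.
rewrite normrM; apply: (@le_trans _ _ (t^-1 * (a * (t * s) + t * s * `|x| * c))); last first.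
  by rewrite le_eqVlt; apply/orP; left; apply/eqP; field; rewrite gt_eqF.
apply: ler_pM => //; first exact: norm_smooth_sign_weight.
apply: (le_trans (ler_normB _ _)); rewrite !normrM lerD //.
  by rewrite -[leRHS]mul1r ler_pM ?cos_max ?Sa.
apply: ler_pM => //; last exact: Cc.
apply: (le_trans (norm_sin_le _)); rewrite normrM gtr0_norm // mulr_gt0 //.
Qed.

(** The cosine and sine errors each contribute [eps] times the Cauchy kernel, once the r of the
    error profile has cancelled 1/t; the kernel has integral at most 2. *)
Lemma smooth_sign_comparison : `|A C S - A g zero| <= 4 * eps.
Proof.
have dle (r : R) : 0 < r -> eps * r / (1 + r ^+ 2) <= eps * r.
  by move=> r0; rewrite ler_pdivrMr // ler_peMr ?mulr_ge0 ?lerDl ?sqr_ge0 // ltW.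
have g1 (r : R) : `|g r| <= 1.
  by rewrite ger0_norm ?expR_ge0 // -expR0 ler_expR mulNr oppr_le0 divr_ge0 // sqr_ge0.
have iA1 : leb.-integrable D (EFin \o (fun t => wendland t / t *
    (cos (t * s * x) * S (t * s) - sin (t * s * x) * C (t * s)))).
  apply: (@integrable_A _ _ eps (eps * s + 1)) => // r rs; have /andP[r0 r1] := rs; last first.
    exact: le_trans (S_near rs) (dle _ r0).
  have := ler_normD (C r - g r) (g r); rewrite subrK.
  have := C_near rs; have := g1 r; have := dle _ r0.
  by have := ler_wpM2l eps_ge0 r1; lra.
have iA2 : leb.-integrable D (EFin \o (fun t => wendland t / t *
    (cos (t * s * x) * zero (t * s) - sin (t * s * x) * g (t * s)))).
  apply: (@integrable_A g zero 0 1) => //; first exact: cst_continuous.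
  by move=> r _; rewrite normr0 mul0r.
have [ik k2] := Rintegral_cauchy_kernel_le.
have c0 : continuous zero by exact: cst_continuous.
rewrite -RintegralB //.
set f := (fun t => _ - _).
have fle (t : R) : 0 < t <= 1 -> `|f t| <= 2 * eps * (s / (1 + (t * s) ^+ 2)).
  move=> t01; have /andP[t0 t1] := t01.
  have ts : 0 < t * s <= s by rewrite mulr_gt0 // ler_piMl // ltW.
  have -> : f t = wendland t / t * (cos (t * s * x) * S (t * s) +
      (- sin (t * s * x)) * (C (t * s) - g (t * s))) by rewrite /f; ring.
  rewrite normrM; apply: (@le_trans _ _ (t^-1 * (2 * (eps * (t * s) / (1 + (t * s) ^+ 2))))).
    apply: ler_pM => //; first exact: norm_smooth_sign_weight.
    apply: le_trans (norm_comb _ _ _ _) _; rewrite ?normrN ?cos_max ?sin_max //.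
    by have := C_near ts; have := S_near ts; lra.
  rewrite le_eqVlt; apply/orP; left; apply/eqP; field.
  by rewrite gt_eqF //= gt_eqF.
have mf : leb.-integrable D (EFin \o f).
  by have := @integrableB _ _ _ leb _ (measurable_itv _) _ _ iA1 iA2; apply: eq_integrable.
apply: (le_trans (le_normr_Rintegral _ mf)) => //.
apply: (@le_trans _ _ (\int[leb]_(t in D) (2 * eps * (s / (1 + (t * s) ^+ 2))))).
  apply: le_Rintegral => //.
  - exact: integrable_norm.
  - by have := @integrableZl _ _ _ leb _ (measurable_itv _) (2 * eps) _ ik; apply: eq_integrable.
have -> : 4 * eps = 2 * eps * 2 by ring.
by rewrite RintegralZl // ler_wpM2l // mulr_ge0.
Qed.

Let expR_le_cauchy (r : R) : expR (- r ^+ 2 / 2) <= 2 / (1 + r ^+ 2).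
Proof.
rewrite mulNr expRN -[leRHS]invrK lef_pV2 ?posrE ?expR_gt0 ?invr_gt0 ?divr_gt0 //.
rewrite invf_div; apply: le_trans (expR_ge1Dx _); lra.
Qed.

Let integrable_B (C' S' : R -> R) : continuous C' -> continuous S' ->
  leb.-integrable D (EFin \o (fun t => (1 - t) ^+ 2 *
    (cos (t * s * x) * C' (t * s) + sin (t * s * x) * S' (t * s)))).
Proof.
move=> cC' cS'; apply: integrable_on_unit; apply: continuous_mul.
  move=> t; apply: (@is_derive_continuous _ _ _ (- 2 * (1 - t))).
  by apply: is_derive_eq; rewrite /GRing.scale /=; ring.
move=> t; apply: cvgD; (apply: cvgM; [|exact: continuous_comp_mulr]).
  exact: ccos.
exact: csin.
Qed.

(** The Gaussian is below 2 / (1 + r^2), whose integral after rescaling is at most (2 / s) 2; each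
    of the two errors is at most eps / 2 because r / (1 + r^2) <= 1/2. *)
Lemma bump_comparison : B C S <= 4 / s + eps /\ B g zero <= 4 / s.
Proof.
have [ik k2] := Rintegral_cauchy_kernel_le.
have c0 : continuous zero by exact: cst_continuous.
have sq (t : R) : 0 < t <= 1 -> 0 <= (1 - t) ^+ 2 <= 1.
  by move=> /andP[t0 t1]; rewrite sqr_ge0 exprn_ile1 //; lra.
have sk : leb.-integrable D (EFin \o (fun t => 2 / s * (s / (1 + (t * s) ^+ 2)))).
  by have := @integrableZl _ _ _ leb _ (measurable_itv _) (2 / s) _ ik; apply: eq_integrable.
have ske : leb.-integrable D (EFin \o (fun t => 2 / s * (s / (1 + (t * s) ^+ 2)) + eps)).
  have ie : leb.-integrable D (EFin \o (fun=> eps)).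
    by apply: (@integrable_unit_itv _ _ eps) => // t _; rewrite ger0_norm.
  by have := @integrableD _ _ _ leb _ (measurable_itv _) _ _ sk ie; apply: eq_integrable.
have bnd (t p q u : R) : 0 < t <= 1 -> `|p| + `|q| <= u ->
    (1 - t) ^+ 2 * (cos (t * s * x) * p + sin (t * s * x) * q) <= u.
  move=> /sq /andP[h0 h1] pq; apply: (le_trans (ler_norm _)).
  rewrite normrM (ger0_norm h0) -[u]mul1r ler_pM //.
  exact: le_trans (norm_comb _ _ (cos_max _) (sin_max _)) pq.
have gk (t : R) : `|g (t * s)| <= 2 / s * (s / (1 + (t * s) ^+ 2)).
  rewrite ger0_norm ?expR_ge0 //; apply: (le_trans (expR_le_cauchy _)).
  by rewrite mulrA divfK // gt_eqF.
have s4 : 2 / s * \int[leb]_(t in D) (s / (1 + (t * s) ^+ 2)) <= 4 / s.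
  have -> : 4 / s = 2 / s * 2 by field; rewrite gt_eqF.
  by rewrite ler_pM2l // divr_gt0.
split; last first.
  apply: le_trans s4; rewrite -RintegralZl //; apply: le_Rintegral => //.
    exact: (@integrable_B g zero cgauss c0).
  by move=> t /= /itvP tD; apply: bnd; rewrite ?tD // normr0 addr0.
apply: (@le_trans _ _ (\int[leb]_(t in D) (2 / s * (s / (1 + (t * s) ^+ 2)) + eps))).
  apply: le_Rintegral => //; first exact: integrable_B.
  move=> t /= /itvP tD; have t01 : 0 < t <= 1 by rewrite !tD.
  apply: bnd => //; have /andP[t0 t1] := t01.
  have ts : 0 < t * s <= s by rewrite mulr_gt0 // ler_piMl // ltW.
  have half : eps * (t * s) / (1 + (t * s) ^+ 2) <= eps / 2.
    rewrite -mulrA ler_wpM2l // ler_pdivrMr //.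
    by have := sqr_ge0 (t * s - 1); lra.
  have := ler_normD (C (t * s) - g (t * s)) (g (t * s)); rewrite subrK.
  by have := C_near ts; have := S_near ts; have := gk t; lra.
rewrite RintegralD //; last first.
  by apply: (@integrable_unit_itv _ _ eps) => // t _; rewrite ger0_norm.
rewrite RintegralZl // lerD // Rintegral_cst //= lebesgue_measure_itv /= lte01 oppr0 adde0 /=.
by rewrite mulr1.
Qed.

End Comparison.

Section KolmogorovSmoothing.
Variable R : realType.
Local Notation leb := (@lebesgue_measure R).
Local Notation phi := (@normal_pdf R 0 1).
Local Notation L := (smooth_sign_limit R).

(** The first term is 4 / (2 L), from [smooth_sign_comparison]; the factor 8 adds the 4 / s of the
    two bump integrals. *)
Definition smoothing_constant : R := 2 / L + 8 * (2 + 12 / L).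

Lemma smoothing_constant_ge0 : 0 <= smoothing_constant.
Proof.
have L0 := smooth_sign_limit_gt0 R.
have h : 0 <= 12 / L by rewrite divr_ge0 // ltW.
have h2 : 0 <= 2 / L by rewrite divr_ge0 // ltW.
rewrite /smoothing_constant; lra.
Qed.

Lemma gaussian_smoothing (s x : R) : 0 < s ->
  `|weighted_cdf leb phi id x - (2^-1 -
      (\int[leb]_(t in `]0, 1]) (wendland t / t * (cos (t * s * x) * 0 -
         sin (t * s * x) * expR (- (t * s) ^+ 2 / 2)))) / (2 * L))|
  <= (2 + 12 / L) * \int[leb]_(t in `]0, 1]) ((1 - t) ^+ 2 *
    (cos (t * s * x) * expR (- (t * s) ^+ 2 / 2) + sin (t * s * x) * 0)).
Proof.
move=> s0.
have mphi : measurable_fun setT phi by exact: measurable_normal_pdf.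
have mid : measurable_fun setT (@id R) by exact: measurable_id.
have phi0 := @normal_pdf_ge0 R 0 1.
have iphi := @integrable_normal_pdf R 0 1.
have iphi1 : \int[leb]_x phi x = 1 by rewrite /Rintegral integral_normal_pdf.
have iX := @integrable_norm_mul_std_normal_pdf R.
have := weighted_cdf_smoothing (m := leb) mphi mid phi0 iphi iphi1 iX x s0.
rewrite (weighted_smooth_sign (m := leb) mphi mid phi0 iphi iX x s0).
rewrite (weighted_bump (m := leb) mphi mid phi0 iphi iX s x).
have -> : weighted_sin leb phi id = fun=> 0.
  by apply/funext => t; exact: gaussian_sin.
have -> : weighted_cos leb phi id = fun t => expR (- t ^+ 2 / 2).
  by apply/funext => t; exact: gaussian_cos.
by [].
Qed.

(** An Esseen-type inequality: each distribution function is within a bump integral of its smoothed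
    version, and the two smoothed versions differ by [smooth_sign_comparison]. *)
Theorem kolmogorov_smoothing d (T : measurableType d)
    (m : {sigma_finite_measure set T -> \bar R}) (rho X : T -> R) (eps s x : R) :
  measurable_fun setT rho -> measurable_fun setT X -> (forall w, 0 <= rho w) ->
  m.-integrable setT (EFin \o rho) -> \int[m]_w rho w = 1 ->
  m.-integrable setT (EFin \o (fun w => `|X w| * rho w)) ->
  0 < s -> 0 <= eps ->
  (forall r, 0 < r <= s -> `|weighted_cos m rho X r - expR (- r ^+ 2 / 2)| <=
     eps * r / (1 + r ^+ 2)) ->
  (forall r, 0 < r <= s -> `|weighted_sin m rho X r| <= eps * r / (1 + r ^+ 2)) ->
  `|weighted_cdf m rho X x - weighted_cdf leb phi id x| <=
    smoothing_constant * (eps + s^-1).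
Proof.
move=> mrho mX rho0 irho irho1 iX s0 eps0 Cn Sn.
have L0 := smooth_sign_limit_gt0 R.
have cC := continuous_weighted_cos mrho mX rho0 irho iX.
have cS := continuous_weighted_sin mrho mX rho0 irho iX.
have := smooth_sign_comparison x s0 eps0 cC cS Cn Sn.
have [b1 b2] := bump_comparison x s0 eps0 cC cS Cn Sn.
have := gaussian_smoothing x s0.
have := weighted_cdf_smoothing mrho mX rho0 irho irho1 iX x s0.
rewrite (weighted_smooth_sign mrho mX rho0 irho iX x s0).
rewrite (weighted_bump mrho mX rho0 irho iX s x).
move: b1 b2; set B1 := Rintegral _ _ _; set B2 := Rintegral _ _ _ => b1 b2.
set A1 := Rintegral _ _ _; set A2 := Rintegral _ _ _.
set F1 := weighted_cdf _ _ _ _; set F2 := weighted_cdf _ _ _ _ => h1 h2 hA.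
set K := 2 + 12 / L in h1 h2 *.
have K0 : 0 <= K by rewrite addr_ge0 // divr_ge0 // ltW.
have hA2 : `|A1 / (2 * L) - A2 / (2 * L)| <= 2 / L * eps.
  rewrite -mulrBl normrM (_ : 2 / L * eps = 4 * eps * (2 * L)^-1); last first.
    by field; rewrite gt_eqF.
  have L2 : 0 <= (2 * L)^-1 by rewrite invr_ge0 mulr_ge0 // ltW.
  by rewrite (ger0_norm L2) ler_wpM2r.
have -> : F1 - F2 = (F1 - (2^-1 - A1 / (2 * L))) - (F2 - (2^-1 - A2 / (2 * L)))
   - (A1 / (2 * L) - A2 / (2 * L)) by ring.
have h3 : K * B1 <= K * (4 / s + eps) by rewrite ler_wpM2l.
have h4 : K * B2 <= K * (4 / s) by rewrite ler_wpM2l.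
apply: (le_trans (ler_normB _ _)).
have h5 := ler_normB (F1 - (2^-1 - A1 / (2 * L))) (F2 - (2^-1 - A2 / (2 * L))).
have h6 : 0 <= 2 / L * s^-1 by rewrite mulr_ge0 ?invr_ge0 ?divr_ge0 // ltW.
have h7 : 0 <= K * eps by rewrite mulr_ge0.
rewrite /smoothing_constant -/K; lra.
Qed.

End KolmogorovSmoothing.

(** * Characteristic functions from zero-free regions *)

Section ComplexExponential.
Import Normc.
Local Open Scope complex_scope.
Variable R : realType.
Implicit Types (x y t : R) (z w : R[i]).

Definition cis t : R[i] := cos t +i* sin t.
Definition cexp z : R[i] := (expR (complex.Re z))%:C * cis (complex.Im z).

Lemma complex_ext z w : complex.Re z = complex.Re w -> complex.Im z = complex.Im w -> z = w.
Proof. by case: z => a b; case: w => c d /= -> ->. Qed.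

Lemma cisD x y : cis (x + y) = cis x * cis y.
Proof.
by rewrite /cis cosD sinD; apply: complex_ext => /=; ring.
Qed.

Lemma cis0 : cis 0 = 1.
Proof. by rewrite /cis cos0 sin0. Qed.

Lemma cisX t n : cis t ^+ n = cis (n%:R * t).
Proof.
elim: n => [|n IH]; first by rewrite expr0 mul0r cis0.
by rewrite exprS IH -cisD -[n.+1%:R]natr1 mulrDl mul1r addrC.
Qed.

Lemma normc_real x : normc x%:C = `|x|.
Proof. by rewrite /normc /= expr0n addr0 sqrtr_sqr. Qed.

Lemma normc_cis t : normc (cis t) = 1.
Proof. by rewrite /normc /= cos2Dsin2 sqrtr1. Qed.

Lemma normc_ge0 z : 0 <= normc z.
Proof. by case: z => a b; exact: sqrtr_ge0. Qed.

Lemma normc_Re z : `|complex.Re z| <= normc z.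
Proof.
by case: z => a b /=; rewrite -sqrtr_sqr ler_wsqrtr // lerDl sqr_ge0.
Qed.

Lemma normc_Im z : `|complex.Im z| <= normc z.
Proof.
by case: z => a b /=; rewrite -sqrtr_sqr ler_wsqrtr // lerDr sqr_ge0.
Qed.

Lemma normc_le_ReIm (a b : R) : normc (a +i* b) <= `|a| + `|b|.
Proof.
have -> : a +i* b = a%:C + (0 +i* b) by apply: complex_ext; rewrite /= ?addr0 ?add0r.
apply: (le_trans (le_normcD _ _)); rewrite normc_real lerD2l.
by rewrite /normc /= expr0n add0r sqrtr_sqr.
Qed.

Lemma cexpD z w : cexp (z + w) = cexp z * cexp w.
Proof.
case: z => a b; case: w => c d.
by rewrite /cexp /= expRD cisD rmorphM /= mulrACA.
Qed.

Lemma cexp0 : cexp 0 = 1.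
Proof. by rewrite /cexp /= expR0 cis0 mulr1. Qed.

Lemma cexpN z : cexp z * cexp (- z) = 1.
Proof. by rewrite -cexpD subrr cexp0. Qed.

Lemma cexp_sum (I : Type) (r : seq I) (F : I -> R[i]) :
  cexp (\sum_(i <- r) F i) = \prod_(i <- r) cexp (F i).
Proof. exact: (big_morph cexp cexpD cexp0). Qed.

Lemma normc_cexp z : normc (cexp z) = expR (complex.Re z).
Proof. by rewrite /cexp normcM normc_cis mulr1 normc_real ger0_norm ?expR_ge0. Qed.

Lemma expR_half_le2 x : x <= 2^-1 -> expR x <= 2.
Proof.
move=> x2; have := expR_ge1Dx (- x); rewrite expRN => h.
rewrite -[leLHS]invrK -[leRHS]invrK lef_pV2 ?posrE ?invr_gt0 ?expR_gt0 //; lra.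
Qed.

Let le_from0 (f df : R -> R) x : 0 <= x -> f 0 = 0 ->
  (forall z : R, 0 <= z <= x -> is_derive z 1 f (df z)) ->
  (forall z : R, 0 <= z <= x -> 0 <= df z) -> 0 <= f x.
Proof. by move=> x0 f0 fdf df0; rewrite -[leLHS]f0; exact: is_derive_le fdf df0. Qed.

Lemma expR_taylor2 x : `|x| <= 2^-1 -> `|expR x - (1 + x + x ^+ 2 / 2)| <= `|x| ^+ 3 / 2.
Proof.
have [x0|x0] := leP 0 x; rewrite ?(ger0_norm x0) => x2.
  (* This is the derivative of x^3/2 - (exp x - 1 - x - x^2/2); its own second derivative 3 - exp is
     positive because exp <= 2 on [0, 1/2]. *)
  have h1 (z : R) : 0 <= z <= x -> 0 <= 1 + z + 3 / 2 * z ^+ 2 - expR z.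
    move=> /andP[z0 zx].
    apply: (@le_from0 (fun z : R => 1 + z + 3 / 2 * z ^+ 2 - expR z)
      (fun z : R => 1 + 3 * z - expR z)) => // [|y _|y /andP[y0 yz]].
    - by rewrite expR0; field.
    - by apply: is_derive_eq; rewrite /GRing.scale /=; field.
    apply: (@le_from0 (fun z : R => 1 + 3 * z - expR z)
      (fun z : R => 3 - expR z)) => // [|u _|u /andP[u0 uy]].
    - by rewrite expR0; ring.
    - by apply: is_derive_eq; rewrite /GRing.scale /=; ring.
    - by have := @expR_half_le2 u; lra.
  have h2 : 0 <= expR x - (1 + x + x ^+ 2 / 2).
    apply: (@le_from0 (fun x : R => expR x - (1 + x + x ^+ 2 / 2))
      (fun x : R => expR x - (1 + x))) => // [|z _|z _].
    - by rewrite expR0; field.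
    - by apply: is_derive_eq; rewrite /GRing.scale /=; field.
    - by rewrite subr_ge0 expR_ge1Dx.
  rewrite ger0_norm // -subr_ge0.
  apply: (@le_from0 (fun x : R => x ^+ 3 / 2 - (expR x - (1 + x + x ^+ 2 / 2)))
     (fun z : R => 1 + z + 3 / 2 * z ^+ 2 - expR z)) => // [|z _].
  - by rewrite expR0; field.
  - by apply: is_derive_eq; rewrite /GRing.scale /=; field.
have nx : 0 <= - x by rewrite oppr_ge0 ltW.
rewrite -(normrN x) (ger0_norm nx); set y := - x in nx *.
have -> : x = - y by rewrite /y opprK.
have a1 (z : R) : 0 <= z <= y -> 0 <= expR (- z) - (1 - z).
  by move=> _; rewrite subr_ge0 expR_ge1Dx.
have dN (z : R) : is_derive z 1 (fun z : R => expR (- z)) (- expR (- z)).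
  by apply: is_derive_eq; rewrite /GRing.scale /=; ring.
have a2 (z : R) : 0 <= z <= y -> 0 <= 1 - z + z ^+ 2 / 2 - expR (- z).
  move=> /andP[z0 zy].
  apply: (@le_from0 (fun z : R => 1 - z + z ^+ 2 / 2 - expR (- z))
    (fun z : R => expR (- z) - (1 - z))) => // [|u _|u /andP[u0 uz]].
  - by rewrite oppr0 expR0; field.
  - by apply: is_derive_eq; rewrite /GRing.scale /=; field.
  - by apply: a1; rewrite u0 (le_trans uz).
have a3 : 0 <= expR (- y) - (1 - y + y ^+ 2 / 2) + y ^+ 3 / 6.
  apply: (@le_from0 (fun z : R => expR (- z) - (1 - z + z ^+ 2 / 2) + z ^+ 3 / 6)
    (fun z : R => 1 - z + z ^+ 2 / 2 - expR (- z))) => // [|u _].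
  - by rewrite oppr0 expR0; field.
  - by apply: is_derive_eq; rewrite /GRing.scale /=; field.
have := a2 y; rewrite lexx nx => /(_ isT) a2y.
have y3 : 0 <= y ^+ 3 by rewrite exprn_ge0.
by rewrite sqrrN ler_norml; apply/andP; split; lra.
Qed.

Lemma normc_cis_taylor t : `|t| <= 1 ->
  normc (cis t - ((1 - t ^+ 2 / 2) +i* t)) <= `|t| ^+ 3 / 4.
Proof.
move=> t1; have := norm_cos_sub_le t; have := norm_sin_sub_le t.
have -> : cis t - ((1 - t ^+ 2 / 2) +i* t) = (cos t - (1 - t ^+ 2 / 2)) +i* (sin t - t) by [].
have := normc_le_ReIm (cos t - (1 - t ^+ 2 / 2)) (sin t - t).
have : `|t| ^+ 4 <= `|t| ^+ 3.
  by rewrite exprS ler_piMl // exprn_ge0.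
have : 0 <= `|t| ^+ 3 by rewrite exprn_ge0.
lra.
Qed.

(** Real and imaginary directions are expanded separately as [e1] and [e2]; [e3] collects the terms
    of degree at least 3 in the product of the two Taylor polynomials. *)
Lemma cexp_taylor2 z : normc z <= 2^-1 ->
  normc (cexp z - (1 + z + z ^+ 2 / 2)) <= 3 * normc z ^+ 3.
Proof.
move=> z2; set r := normc z in z2 *; have r0 : 0 <= r := normc_ge0 z.
have xr : `|complex.Re z| <= r := normc_Re z; have yr : `|complex.Im z| <= r := normc_Im z.
rewrite /cexp; move: xr yr; have zE : z = (complex.Re z) +i* (complex.Im z) by case: (z).
rewrite [in X in _ - X]zE; set x := complex.Re z; set y := complex.Im z => xr yr.
pose e1 := expR x - (1 + x + x ^+ 2 / 2).
pose e2 := cis y - ((1 - y ^+ 2 / 2) +i* y).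
have x3 : `|x| ^+ 3 <= r ^+ 3 by rewrite ler_pXn2r // nnegrE.
have y3 : `|y| ^+ 3 <= r ^+ 3 by rewrite ler_pXn2r // nnegrE.
have h1 : `|e1| <= r ^+ 3 / 2.
  by have := expR_taylor2 (le_trans xr z2); rewrite -/e1; lra.
have h2 : normc e2 <= r ^+ 3 / 4.
  have y1 : `|y| <= 1 by lra.
  by have := normc_cis_taylor y1; rewrite -/e2; lra.
pose e3 := (- (x * y ^+ 2) / 2 - x ^+ 2 * y ^+ 2 / 4) +i* (x ^+ 2 * y / 2).
have -> : (expR x)%:C * cis y - (1 + (x +i* y) + (x +i* y) ^+ 2 / 2) =
    e1%:C * cis y + (1 + x + x ^+ 2 / 2)%:C * e2 + e3.
  have -> : (x +i* y) ^+ 2 / 2 = ((x ^+ 2 - y ^+ 2) / 2) +i* (x * y).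
    have -> : (2 : R[i])^-1 = (2^-1)%:C by rewrite fmorphV rmorph_nat.
    by rewrite expr2; apply: complex_ext => /=; field.
  by rewrite /e1 /e2 /e3 /cis; apply: complex_ext => /=; field.
have h3 : normc e3 <= 9 / 8 * r ^+ 3.
  apply: (le_trans (normc_le_ReIm _ _)).
  have p1 : `|x * y ^+ 2| <= r ^+ 3.
    rewrite normrM normrX [leRHS]exprS ler_pM ?exprn_ge0 //.
    by rewrite ler_pXn2r // nnegrE.
  have p2 : `|x ^+ 2 * y| <= r ^+ 3.
    rewrite normrM normrX [leRHS]exprSr ler_pM ?exprn_ge0 //.
    by rewrite ler_pXn2r // nnegrE.
  have p3 : `|x ^+ 2 * y ^+ 2| <= r ^+ 3 / 2.
    have -> : x ^+ 2 * y ^+ 2 = x * (x * y ^+ 2) by ring.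
    by rewrite normrM mulrC ler_pM // (le_trans xr).
  have := ler_normB (- (x * y ^+ 2) / 2) (x ^+ 2 * y ^+ 2 / 4).
  rewrite !(normrM _ (_^-1)) normrN !normfV !(@ger0_norm _ _%:R) //; lra.
apply: (le_trans (le_normcD _ _)).
have := le_normcD (e1%:C * cis y) ((1 + x + x ^+ 2 / 2)%:C * e2).
rewrite !normcM normc_cis !normc_real mulr1.
have E2 : `|1 + x + x ^+ 2 / 2| <= 2.
  move: xr; rewrite !ler_norml => /andP[xl xu].
  by apply/andP; split; nra.
have : `|1 + x + x ^+ 2 / 2| * normc e2 <= 2 * (r ^+ 3 / 4) by rewrite ler_pM // normc_ge0.
have : 0 <= r ^+ 3 by rewrite exprn_ge0.
lra.
Qed.

End ComplexExponential.

Section CharacteristicFactorization.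
Import Normc.
Local Open Scope complex_scope.
Variable R : realType.
Implicit Types (A theta eta : R) (a w : R[i]).

(** The second-order expansion in theta of log(1 + a (exp(i theta) - 1)): the first two cumulants a
    and a - a^2 of a Bernoulli variable, for complex a. *)
Definition factor_exponent theta a : R[i] :=
  'i * theta%:C * a + ('i * theta%:C) ^+ 2 * (a - a ^+ 2) / 2.

Lemma normc_i : normc ('i : R[i]) = 1.
Proof. by rewrite /normc /= expr0n expr1n add0r sqrtr1. Qed.

Lemma normcX a n : normc (a ^+ n) = normc a ^+ n.
Proof. by elim: n => [|n IH]; rewrite ?expr0 ?normc1 // !exprS normcM IH. Qed.

Lemma normc_half : normc (2^-1 : R[i]) = 2^-1.
Proof.
have -> : (2 : R[i])^-1 = (2^-1)%:C by rewrite fmorphV rmorph_nat.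
by rewrite normc_real ger0_norm.
Qed.

Lemma normcB a w : normc (a - w) <= normc a + normc w.
Proof. by rewrite -(normcN w) le_normcD. Qed.

(** Dividing by an exponential instead of taking a complex logarithm avoids branches. The condition
    on theta gives |w| <= 2 theta A^2 <= 1/2, so exp(- w) has modulus at most 2, and 52 is twice the
    26 obtained for the difference. *)
Lemma factor_estimate A theta a : 1 <= A -> normc a <= A ->
  0 <= theta -> 4 * A ^+ 2 * theta <= 1 ->
  normc ((1 + a * (cis theta - 1)) * cexp (- factor_exponent theta a) - 1) <=
  52 * A ^+ 6 * theta ^+ 3.
Proof.
move=> A1 aA t0 At; set w := factor_exponent theta a.
have A2 : 1 <= A ^+ 2 by rewrite exprn_ege1.
have t1 : theta <= 1 by nra.
have A0 : 0 <= A by lra.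
have na0 := normc_ge0 a.
pose tau : R[i] := 'i * theta%:C.
have ntau : normc tau = theta by rewrite normcM normc_i mul1r normc_real ger0_norm.
pose rho := cis theta - ((1 - theta ^+ 2 / 2) +i* theta).
have nrho : normc rho <= theta ^+ 3 / 4.
  by have := @normc_cis_taylor R theta; rewrite ger0_norm //; apply.
have cisE : cis theta - 1 = tau + tau ^+ 2 / 2 + rho.
  have -> : tau ^+ 2 / 2 = (- (theta ^+ 2) / 2)%:C.
    have -> : (2 : R[i])^-1 = (2^-1)%:C by rewrite fmorphV rmorph_nat.
    by rewrite /tau expr2; apply: complex_ext => /=; field.
  by rewrite /rho /cis /tau; apply: complex_ext => /=; field.
have wE : w = tau * a + tau ^+ 2 * (a - a ^+ 2) / 2 by [].
have na2 : normc (a - a ^+ 2) <= 2 * A ^+ 2.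
  apply: (le_trans (normcB _ _)); rewrite normcX.
  have : normc a ^+ 2 <= A ^+ 2 by rewrite ler_pXn2r // nnegrE.
  have : A <= A ^+ 2 by rewrite expr2 ler_peMl.
  lra.
have d1 : normc (tau ^+ 2 * (a - a ^+ 2) / 2) <= theta ^+ 2 * A ^+ 2.
  rewrite normcM normc_half (normcM (tau ^+ 2)) normcX ntau.
  have : theta ^+ 2 * normc (a - a ^+ 2) <= theta ^+ 2 * (2 * A ^+ 2).
    by rewrite ler_wpM2l // sqr_ge0.
  lra.
have ta : normc (tau * a) <= theta * A by rewrite normcM ntau ler_wpM2l.
have tA : theta * A <= theta * A ^+ 2 by rewrite ler_wpM2l // expr2 ler_peMl.
have ttA : theta ^+ 2 * A ^+ 2 <= theta * A ^+ 2.
  by rewrite ler_wpM2r ?sqr_ge0 // expr2 ler_piMl.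
have nw : normc w <= 2 * (theta * A ^+ 2).
  by rewrite wE; apply: (le_trans (le_normcD _ _)); lra.
have w2 : normc w <= 2^-1 by lra.
have d2 : normc (tau * a + w) <= 3 * (theta * A ^+ 2).
  by apply: (le_trans (le_normcD _ _)); lra.
have c1 := cexp_taylor2 w2.
have c2 : normc w ^+ 3 <= 8 * (theta ^+ 3 * A ^+ 6).
  have -> : 8 * (theta ^+ 3 * A ^+ 6) = (2 * (theta * A ^+ 2)) ^+ 3 by ring.
  rewrite ler_pXn2r ?nnegrE ?normc_ge0 //.
  by rewrite mulr_ge0 // mulr_ge0 // sqr_ge0.
pose T := theta ^+ 3 * A ^+ 6.
have h1 : normc (a * rho) <= T / 4.
  rewrite normcM; apply: (@le_trans _ _ (A * (theta ^+ 3 / 4))).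
    by rewrite ler_pM // normc_ge0.
  have A6 : A <= A ^+ 6 by rewrite -[leLHS]expr1 ler_weXn2l.
  rewrite /T; have : theta ^+ 3 * A <= theta ^+ 3 * A ^+ 6.
    by rewrite ler_wpM2l // exprn_ge0.
  lra.
have h2 : normc (tau ^+ 2 * (a - a ^+ 2) / 2 * (tau * a + w) / 2) <= 3 / 2 * T.
  rewrite normcM (normcM _ (tau * a + w)) normc_half.
  have : normc (tau ^+ 2 * (a - a ^+ 2) / 2) * normc (tau * a + w) <=
      theta ^+ 2 * A ^+ 2 * (3 * (theta * A ^+ 2)).
    by rewrite ler_pM // normc_ge0.
  have -> : theta ^+ 2 * A ^+ 2 * (3 * (theta * A ^+ 2)) = 3 * (theta ^+ 3 * A ^+ 4) by ring.
  have : theta ^+ 3 * A ^+ 4 <= T by rewrite /T ler_wpM2l ?exprn_ge0 // ler_weXn2l.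
  lra.
(* Orders one and two cancel: the remaining quadratic part is (tau^2 a^2 - w^2) / 2, factored as a
   difference of squares. *)
have e : 1 + a * (cis theta - 1) - cexp w = a * rho -
   tau ^+ 2 * (a - a ^+ 2) / 2 * (tau * a + w) / 2 - (cexp w - (1 + w + w ^+ 2 / 2)).
  by rewrite cisE wE; field.
have d : normc (1 + a * (cis theta - 1) - cexp w) <= 26 * T.
  rewrite e; apply: (le_trans (normcB _ _)).
  have := normcB (a * rho) (tau ^+ 2 * (a - a ^+ 2) / 2 * (tau * a + w) / 2).
  rewrite -/T in c2; have T0 : 0 <= T by rewrite mulr_ge0 ?exprn_ge0.
  lra.
have -> : (1 + a * (cis theta - 1)) * cexp (- w) - 1 =
    (1 + a * (cis theta - 1) - cexp w) * cexp (- w).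
  by rewrite mulrBl cexpN.
have q2 : normc (cexp (- w)) <= 2.
  rewrite normc_cexp; apply: expR_half_le2.
  by have := normc_Re (- w); rewrite normcN ler_norml => /andP[_]; lra.
rewrite normcM; have := ler_pM (normc_ge0 _) (normc_ge0 _) d q2.
rewrite /T; lra.
Qed.

Lemma normc_prod_sub1 (I : Type) (r : seq I) (f : I -> R[i]) eta : 0 <= eta ->
  (forall i, normc (f i - 1) <= eta) ->
  normc (\prod_(i <- r) f i - 1) <= expR ((size r)%:R * eta) - 1.
Proof.
move=> eta0 fe; elim: r => [|i r IH].
  by rewrite big_nil subrr mul0r expR0 subrr normc0.
rewrite big_cons /= -[(size r).+1%:R]natr1 mulrDl mul1r expRD.
set P := \prod_(j <- r) f j in IH *; set E := expR _ in IH *.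
have -> : f i * P - 1 = (f i - 1) * (P - 1) + (f i - 1) + (P - 1) by ring.
apply: (le_trans (le_normcD _ _)).
have := le_normcD ((f i - 1) * (P - 1)) (f i - 1); rewrite normcM.
have := fe i; have := ler_pM (normc_ge0 _) (normc_ge0 _) (fe i) IH.
have := expR_ge1Dx eta; move: (expR eta) => F FE.
have E0 : 0 <= E by exact: expR_ge0.
have : (1 + eta) * E <= F * E by rewrite ler_wpM2r.
lra.
Qed.

Lemma characteristic_factorization (r : seq R[i]) A theta (mean var : R) :
  1 <= A -> (forall a, a \in r -> normc a <= A) ->
  0 <= theta -> 4 * A ^+ 2 * theta <= 1 ->
  \sum_(a <- r) a = mean%:C -> \sum_(a <- r) (a - a ^+ 2) = var%:C ->
  normc (cis (- (theta * mean)) * \prod_(a <- r) (1 + a * (cis theta - 1))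
    - (expR (- (theta ^+ 2 * var / 2)))%:C) <=
  expR (- (theta ^+ 2 * var / 2)) *
    (expR ((size r)%:R * (52 * A ^+ 6 * theta ^+ 3)) - 1).
Proof.
move=> A1 rA t0 At sm sv.
(* The value 1 off [r] makes the estimate hold for all arguments, as [normc_prod_sub1] demands. *)
pose f a := if a \in r then (1 + a * (cis theta - 1)) * cexp (- factor_exponent theta a) else 1.
have eta0 : 0 <= 52 * A ^+ 6 * theta ^+ 3.
  by rewrite mulr_ge0 ?exprn_ge0 // mulr_ge0 ?exprn_ge0 //; lra.
have fe a : normc (f a - 1) <= 52 * A ^+ 6 * theta ^+ 3.
  rewrite /f; case: ifP => [ar|_]; last by rewrite subrr normc0.
  exact: factor_estimate (rA _ ar) _ _.
have -> : \prod_(a <- r) (1 + a * (cis theta - 1)) =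
    cexp (\sum_(a <- r) factor_exponent theta a) * \prod_(a <- r) f a.
  rewrite cexp_sum -big_split /= [LHS]big_seq [RHS]big_seq; apply: eq_bigr => a ar.
  by rewrite /f ar mulrCA cexpN mulr1.
have -> : \sum_(a <- r) factor_exponent theta a =
    (- (theta ^+ 2 * var / 2)) +i* (theta * mean).
  rewrite big_split /= -mulr_sumr sm.
  have -> : \sum_(a <- r) (('i * theta%:C) ^+ 2 * (a - a ^+ 2) / 2) =
      ('i * theta%:C) ^+ 2 / 2 * var%:C.
    by rewrite -sv mulr_sumr; apply: eq_bigr => a _; rewrite mulrAC.
  have -> : (2 : R[i])^-1 = (2^-1)%:C by rewrite fmorphV rmorph_nat.
  by rewrite expr2; apply: complex_ext => /=; field.
rewrite /cexp [complex.Re _]/= [complex.Im _]/=.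
set E := (expR _)%:C; set Q := \prod_(a <- r) f a.
have -> : cis (- (theta * mean)) * (E * cis (theta * mean) * Q) =
    (cis (- (theta * mean)) * cis (theta * mean)) * (E * Q) by ring.
rewrite -cisD addNr cis0 mul1r {}/E {}/Q.
rewrite -[X in _ - X]mulr1 -mulrBr normcM normc_real ger0_norm ?expR_ge0 //.
by rewrite ler_wpM2l ?expR_ge0 // normc_prod_sub1.
Qed.

End CharacteristicFactorization.

(** * Factorization of probability generating functions *)

Section GeneratingPolynomial.
Import Normc.
Local Open Scope complex_scope.
Variable R : realType.

Section LinearFactors.
Implicit Types (r : seq R[i]) (a w : R[i]).

(** A root u corresponds to a = 1 / (1 - u): the value 1 at the point 1 is built in, and roots at
    distance at least [rad] from 1 mean |a| <= 1 / rad. *)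
Definition linear_factors r : {poly R[i]} :=
  \prod_(a <- r) (1 + a%:P * ('X - 1)).

Lemma linear_factors_horner r w :
  (linear_factors r).[w] = \prod_(a <- r) (1 + a * (w - 1)).
Proof.
rewrite horner_prod; apply: eq_bigr => a _.
by rewrite !hornerE.
Qed.

Lemma linear_factors_1 r : (linear_factors r).[1] = 1.
Proof.
by rewrite linear_factors_horner big1 // => a _; rewrite subrr mulr0 addr0.
Qed.

Lemma linear_factors_cons a r :
  linear_factors (a :: r) = (1 + a%:P * ('X - 1)) * linear_factors r.
Proof. by rewrite /linear_factors big_cons. Qed.

Let deriv_factor a : (1 + a%:P * ('X - 1))^`() = a%:P.
Proof. by rewrite derivD derivC add0r derivM derivC mul0r add0r derivB derivX derivC subr0 mulr1. Qed.

Lemma linear_factors_deriv r : (linear_factors r)^`().[1] = \sum_(a <- r) a.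
Proof.
elim: r => [|a r IH]; first by rewrite /linear_factors !big_nil derivC horner0.
rewrite linear_factors_cons derivM deriv_factor hornerD !hornerM IH linear_factors_1.
by rewrite hornerD hornerM !hornerE subrr mulr0 addr0 mul1r big_cons.
Qed.

(** Twice the second elementary symmetric function of the a_j. Matched with the factorial moment
    E[S (S - 1)], it turns the sum of the a_j - a_j^2 into the variance. *)
Lemma linear_factors_deriv2 r : (linear_factors r)^`()^`().[1] =
  (\sum_(a <- r) a) ^+ 2 - \sum_(a <- r) a ^+ 2.
Proof.
elim: r => [|a r IH].
  by rewrite /linear_factors !big_nil !derivC horner0 expr0n subr0.
rewrite linear_factors_cons derivM deriv_factor derivD !derivM derivC deriv_factor.
rewrite mul0r add0r !hornerD !hornerM IH linear_factors_deriv.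
rewrite hornerD hornerM !hornerE subrr mulr0 addr0 !big_cons.
rewrite /=; ring.
Qed.

Lemma poly_linear_factors (P : {poly R[i]}) (rad : R) : 0 < rad -> P.[1] = 1 ->
  (forall w, normc (w - 1) < rad -> P.[w] != 0) ->
  exists r, [/\ P = linear_factors r, (size r).+1 = size P &
    forall a, a \in r -> normc a <= rad^-1].
Proof.
move=> rad0 P1 Pnz; have [z Pz] := closed_field_poly_normal P.
have P0 : P != 0 by apply: contraTneq (oner_neq0 R[i]) => P0; rewrite -P1 P0 horner0 eqxx.
have zroot u : u \in z -> rad <= normc (u - 1).
  move=> uz; rewrite leNgt; apply/negP => /Pnz/negP; apply.
  by rewrite -/(root P u) Pz rootZ ?lead_coef_eq0 // root_prod_XsubC.
have z1 u : u \in z -> 1 - u != 0.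
  move=> /zroot h; apply/eqP => e; move: h; rewrite -opprB e oppr0 normc0.
  by rewrite leNgt rad0.
have lc : lead_coef P * \prod_(u <- z) (1 - u) = 1.
  have := P1; rewrite {1}Pz hornerZ horner_prod => lP; rewrite -[RHS]lP; congr (_ * _).
  by apply: eq_bigr => u _; rewrite !hornerE.
exists [seq (1 - u)^-1 | u <- z]; split.
- rewrite {1}Pz /linear_factors big_map.
  have -> : \prod_(u <- z) ('X - u%:P) =
     (\prod_(u <- z) (1 - u))%:P * \prod_(j <- z) (1 + (1 - j)^-1%:P * ('X - 1)).
    rewrite rmorph_prod -big_split /= [LHS]big_seq [RHS]big_seq; apply: eq_bigr => u /z1 u1.
    rewrite mulrDr mulr1 mulrA -polyCM divff // mul1r polyCB.
    by rewrite polyC1; ring.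
  by rewrite -mul_polyC mulrA -polyCM lc mul1r.
- by rewrite size_map [in RHS]Pz size_scale ?lead_coef_eq0 // size_prod_XsubC.
- move=> _ /mapP[u uz ->]; rewrite normcV lef_pV2 ?posrE //.
    by rewrite -opprB normcN zroot.
  by rewrite -opprB normcN (lt_le_trans rad0) // zroot.
Qed.

End LinearFactors.

Variables (I : finType) (p : I -> R) (S : I -> nat).

Definition generating_poly : {poly R[i]} := \sum_i (p i)%:C *: 'X^(S i).

Lemma generating_poly_horner w : generating_poly.[w] = \sum_i (p i)%:C * w ^+ S i.
Proof. by rewrite horner_sum; apply: eq_bigr => i _; rewrite hornerZ hornerXn. Qed.

Lemma size_generating_poly n : (forall i, S i <= n)%N -> (size generating_poly <= n.+1)%N.
Proof.
move=> Sn; apply: (leq_trans (size_sum _ _ _)); apply/bigmax_leqP => i _.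
by apply: (leq_trans (size_scale_leq _ _)); rewrite size_polyXn ltnS.
Qed.

Lemma generating_poly_deriv : generating_poly^`().[1] = (\sum_i p i * (S i)%:R)%:C.
Proof.
rewrite raddf_sum horner_sum rmorph_sum; apply: eq_bigr => i _ /=.
by rewrite derivZ derivXn hornerZ hornerMn hornerXn expr1n rmorphM rmorph_nat.
Qed.

Lemma generating_poly_deriv2 : generating_poly^`()^`().[1] =
  (\sum_i p i * ((S i)%:R ^+ 2 - (S i)%:R))%:C.
Proof.
rewrite raddf_sum /= raddf_sum horner_sum rmorph_sum; apply: eq_bigr => i _ /=.
rewrite !derivZ derivXn derivMn derivXn hornerZ !hornerMn hornerXn expr1n rmorphM; congr (_ * _).
rewrite -mulrnA rmorphB rmorphXn /= rmorph_nat.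
case: (S i) => [|k]; first by rewrite muln0 expr0n subrr.
by rewrite /= natrM -[k.+1%:R]natr1; ring.
Qed.

Definition mean : R := \sum_i p i * (S i)%:R.
Definition variance : R := \sum_i p i * ((S i)%:R - mean) ^+ 2.

Hypothesis p1 : \sum_i p i = 1.

Lemma variance_def : variance = \sum_i p i * ((S i)%:R ^+ 2 - (S i)%:R) + mean - mean ^+ 2.
Proof.
have -> : variance = \sum_i (p i * ((S i)%:R ^+ 2 - (S i)%:R) + p i * (S i)%:R
    - 2 * mean * (p i * (S i)%:R) + mean ^+ 2 * p i).
  by apply: eq_bigr => i _; ring.
rewrite !big_split /= sumrN -!mulr_sumr p1 -/mean; ring.
Qed.

Lemma characteristic_bound n (rad A theta : R) : (forall i, S i <= n)%N ->
  0 < rad -> 1 <= A -> rad^-1 <= A ->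
  (forall w, normc (w - 1) < rad -> generating_poly.[w] != 0) ->
  0 <= theta -> 4 * A ^+ 2 * theta <= 1 ->
  let bound := expR (- (theta ^+ 2 * variance / 2)) *
    (expR (n%:R * (52 * A ^+ 6 * theta ^+ 3)) - 1) in
  `|\sum_i p i * cos (theta * ((S i)%:R - mean)) - expR (- (theta ^+ 2 * variance / 2))| <= bound
  /\ `|\sum_i p i * sin (theta * ((S i)%:R - mean))| <= bound.
Proof.
move=> Sn rad0 A1 radA Pnz t0 At bound.
have P1 : generating_poly.[1] = 1.
  rewrite generating_poly_horner; under eq_bigr do rewrite expr1n mulr1.
  by rewrite -rmorph_sum p1.
have [r [Pr sr ra]] := poly_linear_factors rad0 P1 Pnz.
have sm : \sum_(a <- r) a = mean%:C.
  by rewrite -linear_factors_deriv -Pr generating_poly_deriv.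
have sv : \sum_(a <- r) (a - a ^+ 2) = variance%:C.
  have := linear_factors_deriv2 r; rewrite -Pr generating_poly_deriv2 sm => e.
  by rewrite big_split /= sumrN sm variance_def !rmorphB rmorphD /= e rmorphXn /=; ring.
have ra' a : a \in r -> normc a <= A by move=> /ra h; exact: le_trans radA.
have := characteristic_factorization A1 ra' t0 At sm sv.
rewrite -linear_factors_horner -Pr generating_poly_horner.
have -> : cis (- (theta * mean)) * \sum_i (p i)%:C * cis theta ^+ S i =
    (\sum_i p i * cos (theta * ((S i)%:R - mean))) +i*
    (\sum_i p i * sin (theta * ((S i)%:R - mean))).
  rewrite mulr_sumr; apply/esym.
  transitivity (\sum_i ((p i * cos (theta * ((S i)%:R - mean))) +i*
     (p i * sin (theta * ((S i)%:R - mean))))).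
    by apply: (big_rec3 (fun x y z => x +i* y = z)) => // i x y z _ <-.
  apply: eq_bigr => i _; rewrite cisX mulrCA -cisD.
  have -> : - (theta * mean) + (S i)%:R * theta = theta * ((S i)%:R - mean) by ring.
  by apply: complex_ext => /=; rewrite ?mul0r ?subr0 ?addr0.
set z := _ - _; move=> nz.
have nb : normc z <= bound.
  apply: le_trans nz _; rewrite /bound ler_wpM2l ?expR_ge0 // lerD2r ler_expR.
  apply: ler_wpM2r; last by rewrite ler_nat -ltnS sr size_generating_poly.
  by rewrite mulr_ge0 ?exprn_ge0 // mulr_ge0 ?exprn_ge0 //; lra.
split; [have := normc_Re z|have := normc_Im z]; move=> /le_trans/(_ nb).
  by rewrite /z.
by rewrite /z /= oppr0 addr0.
Qed.

End GeneratingPolynomial.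

(** * A Berry-Esseen bound from a zero-free disc and a variance bound *)

Section BerryEsseen.
Import Normc.
Local Open Scope complex_scope.
Variable R : realType.
Implicit Types (A rad c r t : R).

Definition zero_free_bound rad : R := Num.max 1 rad^-1.
Local Notation bnd := zero_free_bound.

(** The first term, with 208 = 4 * 52, keeps the accumulated cubic error below r^2 / 4; the second
    is the range of [factor_estimate]. *)
Definition frequency_cutoff rad c : R :=
  Num.min (c / (208 * bnd rad ^+ 6)) (4 * bnd rad ^+ 2)^-1.

Definition berry_esseen_constant rad c : R :=
  smoothing_constant R * (36 * (52 * bnd rad ^+ 6) / (c * Num.sqrt c)
    + (frequency_cutoff rad c * Num.sqrt c)^-1).

Lemma expR_sub1_le t : expR t - 1 <= t * expR t.
Proof.
have := expR_ge1Dx (- t); rewrite expRN => h.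
have e0 := expR_gt0 t.
have : (1 - t) * expR t <= 1 by rewrite -ler_pdivlMr // div1r.
lra.
Qed.

(** With v = r^2 / 4, r^2 (1 + r^2) = 4 v + 16 v^2, while v and v^2 / 2 are both at most exp v:
    hence 36 = 4 + 32. *)
Lemma cubic_gaussian_le r : 0 <= r ->
  r ^+ 3 * expR (- (r ^+ 2 / 4)) <= 36 * r / (1 + r ^+ 2).
Proof.
move=> r0; have r1 : 0 < 1 + r ^+ 2 by rewrite ltr_pwDl // sqr_ge0.
have v0 : 0 <= r ^+ 2 / 4 by rewrite divr_ge0 ?sqr_ge0.
have e1 := expR_ge1Dx (r ^+ 2 / 4); have := expR_ge1Dxn 1 v0.
have -> : 2`!%:R = 2 :> R by [].
have := expR_gt0 (r ^+ 2 / 4); rewrite expRN.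
move: (expR _) e1 => E e1 E0 e2; rewrite ler_pdivrMr //.
have -> : 36 * r / (1 + r ^+ 2) * E = r * (36 * E) / (1 + r ^+ 2) by rewrite mulrAC; ring.
rewrite ler_pdivlMr //.
have -> : r ^+ 3 * (1 + r ^+ 2) = r * (r ^+ 2 * (1 + r ^+ 2)) by ring.
rewrite ler_wpM2l //; lra.
Qed.

Lemma zero_free_bound_ge1 rad : 1 <= bnd rad.
Proof. by rewrite le_max lexx. Qed.

Lemma frequency_cutoff_gt0 rad c : 0 < c -> 0 < frequency_cutoff rad c.
Proof.
move=> c0; have A1 := zero_free_bound_ge1 rad.
have A0 : 0 < bnd rad by lra.
by rewrite lt_min !(divr_gt0, invr_gt0, mulr_gt0) ?exprn_gt0.
Qed.

Section RandomVariable.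
Context d (T : measurableType d) (P : probability T R) (X : T -> R).
Variables (I : finType) (p : I -> R) (S : I -> nat) (n : nat) (rad c : R).
Local Notation m := (mean p S).
Local Notation v := (variance p S).
Local Notation sigma := (Num.sqrt v).
Hypothesis n_gt0 : (0 < n)%N.
Hypothesis rad_gt0 : 0 < rad.
Hypothesis c_gt0 : 0 < c.
Hypothesis mX : measurable_fun setT X.
Hypothesis iX : P.-integrable setT (EFin \o X).
Hypothesis p1 : \sum_i p i = 1.
Hypothesis Sn : forall i, (S i <= n)%N.
Hypothesis zero_free : forall w, normc (w - 1) < rad -> (generating_poly p S).[w] != 0.
Hypothesis var_ge : c * n%:R <= v.
Hypothesis law : forall f : R -> R, measurable_fun setT f ->
  \int[P]_w f (X w) = \sum_i p i * f (((S i)%:R - m) / sigma).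

Let A := bnd rad.
Let delta := frequency_cutoff rad c.
Let A1 : 1 <= A := zero_free_bound_ge1 rad.
Let n0 : 0 < n%:R :> R. Proof. by rewrite ltr0n. Qed.
Let cn0 : 0 < c * n%:R. Proof. by rewrite mulr_gt0. Qed.
Let v0 : 0 < v. Proof. exact: lt_le_trans var_ge. Qed.
Let s0 : 0 < sigma. Proof. by rewrite sqrtr_gt0. Qed.
Let s2 : sigma ^+ 2 = v. Proof. by rewrite sqr_sqrtr // ltW. Qed.
Let delta0 : 0 < delta := frequency_cutoff_gt0 rad c_gt0.

Definition char_error : R := 36 * (52 * A ^+ 6) * n%:R / sigma ^+ 3.

Lemma char_error_ge0 : 0 <= char_error.
Proof.
have A0 : 0 <= A by apply: le_trans A1.
have sg0 : 0 <= sigma by exact: ltW.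
apply: divr_ge0; last exact: exprn_ge0.
by do 3! apply: mulr_ge0 => //; exact: exprn_ge0.
Qed.

(** Here exp(eta) - 1 <= eta exp(eta) with eta <= r^2 / 4, so half of the Gaussian decay survives
    and turns the cubic error into the profile r / (1 + r^2). *)
Lemma standardized_char_bound r : 0 < r <= delta * sigma ->
  `|\sum_i p i * cos (r * (((S i)%:R - m) / sigma)) - expR (- r ^+ 2 / 2)|
     <= char_error * r / (1 + r ^+ 2) /\
  `|\sum_i p i * sin (r * (((S i)%:R - m) / sigma))| <= char_error * r / (1 + r ^+ 2).
Proof.
move=> /andP[r0 rd]; pose theta := r / sigma.
have t0 : 0 <= theta by rewrite divr_ge0 ?ltW.
have td : theta <= delta by rewrite ler_pdivrMr.
have rE : r = theta * sigma by rewrite divfK // gt_eqF.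
have arg i : theta * ((S i)%:R - m) = r * (((S i)%:R - m) / sigma).
  by rewrite /theta mulrAC mulrA.
clearbody theta.
have A0 : 0 < A := lt_le_trans ltr01 A1.
have A60 : 0 < A ^+ 6 by rewrite exprn_gt0.
have t4 : 4 * A ^+ 2 * theta <= 1.
  have A20 : 0 < 4 * A ^+ 2 by rewrite mulr_gt0 // exprn_gt0.
  rewrite -(ler_pdivlMl _ _ A20) mulr1; apply: (le_trans td).
  by rewrite ge_min lexx orbT.
have radA : rad^-1 <= A by rewrite le_max lexx orbT.
have [] := characteristic_bound p1 Sn rad_gt0 A1 radA zero_free t0 t4.
under eq_bigr do rewrite arg.
under [X in _ -> `|X| <= _ -> _]eq_bigr do rewrite arg.
have -> : - (theta ^+ 2 * v / 2) = - r ^+ 2 / 2.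
  by rewrite rE exprMn s2; ring.
suff h : expR (- r ^+ 2 / 2) * (expR (n%:R * (52 * A ^+ 6 * theta ^+ 3)) - 1)
    <= char_error * r / (1 + r ^+ 2).
  by move=> h1 h2; split; [exact: le_trans h1 h|exact: le_trans h2 h].
set eta := n%:R * _.
have eta0 : 0 <= eta.
  by rewrite mulr_ge0 // mulr_ge0 ?exprn_ge0 // mulr_ge0 // ltW.
have etar : eta <= r ^+ 2 / 4.
  have d1 : 208 * A ^+ 6 * theta <= c.
    have A20 : 0 < 208 * A ^+ 6 by rewrite mulr_gt0.
    rewrite -(ler_pdivlMl _ _ A20); apply: (le_trans td).
    by rewrite mulrC ge_min lexx.
  have -> : eta = (208 * A ^+ 6 * theta) * n%:R * (theta ^+ 2 / 4) by rewrite /eta; field.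
  have -> : r ^+ 2 / 4 = v * (theta ^+ 2 / 4) by rewrite rE exprMn s2; field.
  apply: ler_wpM2r; first by rewrite divr_ge0 ?sqr_ge0.
  by apply: le_trans var_ge; rewrite ler_wpM2r // ltW.
have etaE : eta = char_error / 36 * r ^+ 3.
  by rewrite /eta /char_error rE; field; rewrite gt_eqF.
have ce0 := char_error_ge0.
apply: (@le_trans _ _ (expR (- r ^+ 2 / 2) * (eta * expR (r ^+ 2 / 4)))).
  rewrite ler_wpM2l ?expR_ge0 //; apply: (le_trans (expR_sub1_le _)).
  by rewrite ler_wpM2l // ler_expR.
have -> : expR (- r ^+ 2 / 2) * (eta * expR (r ^+ 2 / 4)) = eta * expR (- (r ^+ 2 / 4)).
  by rewrite mulrCA -expRD; congr (_ * expR _); field.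
rewrite etaE -mulrA; apply: (@le_trans _ _ (char_error / 36 * (36 * r / (1 + r ^+ 2)))).
  apply: ler_wpM2l; first by rewrite divr_ge0.
  by apply: cubic_gaussian_le; exact: ltW.
rewrite le_eqVlt; apply/orP; left; apply/eqP; field.
by rewrite gt_eqF // ltr_pwDl // sqr_ge0.
Qed.

Theorem berry_esseen_zero_free x :
  `|\int[P]_w (X w <= x)%R%:R - weighted_cdf lebesgue_measure (@normal_pdf R 0 1) id x|
  <= berry_esseen_constant rad c / Num.sqrt n%:R.
Proof.
have A0 : 0 < A := lt_le_trans ltr01 A1.
have A60 : 0 < A ^+ 6 by rewrite exprn_gt0.
have ce0 := char_error_ge0.
have ds0 : 0 < delta * sigma by rewrite mulr_gt0.
have i1 : P.-integrable setT (EFin \o (fun=> 1 : R)).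
  by apply: finite_measure_integrable_cst.
have int1 : \int[P]_w (1 : R) = 1.
  by rewrite Rintegral_cst //= mul1r probability_setT.
have iX1 : P.-integrable setT (EFin \o (fun w => `|X w| * 1)).
  by have := integrable_norm iX; apply: eq_integrable => // w _; rewrite /= mulr1.
have cosE r : weighted_cos P (fun=> 1) X r = \sum_i p i * cos (r * (((S i)%:R - m) / sigma)).
  rewrite /weighted_cos; under eq_Rintegral do rewrite mulr1.
  apply: (law (f := fun y => cos (r * y))); apply: continuous_measurable_fun => y.
  apply: (@continuous_comp _ _ _ ( *%R r) cos); last exact: continuous_cos.
  by apply: cvgM; [exact: cvg_cst|exact: cvg_id].
have sinE r : weighted_sin P (fun=> 1) X r = \sum_i p i * sin (r * (((S i)%:R - m) / sigma)).
  rewrite /weighted_sin; under eq_Rintegral do rewrite mulr1.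
  apply: (law (f := fun y => sin (r * y))); apply: continuous_measurable_fun => y.
  apply: (@continuous_comp _ _ _ ( *%R r) sin); last exact: continuous_sin.
  by apply: cvgM; [exact: cvg_cst|exact: cvg_id].
have hcos r : 0 < r <= delta * sigma ->
    `|weighted_cos P (fun=> 1) X r - expR (- r ^+ 2 / 2)| <= char_error * r / (1 + r ^+ 2).
  by move=> rd; rewrite cosE; case: (standardized_char_bound rd).
have hsin r : 0 < r <= delta * sigma ->
    `|weighted_sin P (fun=> 1) X r| <= char_error * r / (1 + r ^+ 2).
  by move=> rd; rewrite sinE; case: (standardized_char_bound rd).
have := @kolmogorov_smoothing R d T P (fun=> 1) X char_error (delta * sigma) x
  (measurable_cst _) mX (fun=> ler01) i1 int1 iX1 ds0 ce0 hcos hsin.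
have -> : weighted_cdf P (fun=> 1) X x = \int[P]_w (X w <= x)%R%:R.
  by apply: eq_Rintegral => w _; rewrite mulr1.
move=> /le_trans; apply; rewrite /berry_esseen_constant -/A -/delta -mulrA.
apply: ler_wpM2l; first exact: smoothing_constant_ge0.
have scn : Num.sqrt c * Num.sqrt n%:R <= sigma.
  by rewrite -sqrtrM ?ler_wsqrtr // ltW.
have sc0 : 0 < Num.sqrt c by rewrite sqrtr_gt0.
have sn0 : 0 < Num.sqrt n%:R :> R by rewrite sqrtr_gt0.
have scn0 : 0 < Num.sqrt c * Num.sqrt n%:R by rewrite mulr_gt0.
have sc2 : Num.sqrt c ^+ 2 = c by rewrite sqr_sqrtr // ltW.
have sn2 : Num.sqrt n%:R ^+ 2 = n%:R :> R by rewrite sqr_sqrtr.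
rewrite mulrDl; apply: lerD.
  have -> : 36 * (52 * A ^+ 6) / (c * Num.sqrt c) / Num.sqrt n%:R =
      36 * (52 * A ^+ 6) * n%:R / (Num.sqrt c * Num.sqrt n%:R) ^+ 3.
    have -> : c * Num.sqrt c = Num.sqrt c ^+ 2 * Num.sqrt c by rewrite sc2.
    have -> : 36 * (52 * A ^+ 6) * n%:R = 36 * (52 * A ^+ 6) * Num.sqrt n%:R ^+ 2 by rewrite sn2.
    by field; rewrite !gt_eqF.
  have A6 : 0 <= A ^+ 6 by exact: ltW.
  have ss : (Num.sqrt c * Num.sqrt n%:R) ^+ 3 <= sigma ^+ 3.
    have h1 := ltW scn0; have h2 := ltW s0.
    by rewrite ler_pXn2r.
  apply: ler_wpM2l; first by do 3! apply: mulr_ge0 => //.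
  by rewrite lef_pV2 ?posrE ?exprn_gt0.
rewrite -invfM lef_pV2 ?posrE ?mulr_gt0 // -mulrA.
by apply: ler_wpM2l => //; exact: ltW.
Qed.

End RandomVariable.
End BerryEsseen.

(** * Passage to the limit along a filter *)

Section Limits.
Import Normc.
Local Open Scope complex_scope.
Variables (R : realType) (T : Type) (F : set_system T).
Context {FF : ProperFilter F}.
Variables (I : finType) (q : T -> I -> R) (p : I -> R) (S : I -> nat).
Hypothesis qp : forall i, q t i @[t --> F] --> p i.

Lemma cvg_to_ge (f : T -> R) (l x : R) : f t @[t --> F] --> l ->
  (\forall t \near F, x <= f t) -> x <= l.
Proof.
move=> fl xf; have := @cvg_lim _ (@norm_hausdorff _ R) _ _ FF _ _ fl => <-.
by apply: limr_ge => //; apply/cvg_ex; exists l.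
Qed.

Lemma linear_factors_lower (r : seq R[i]) (rad : R) w : 0 < rad ->
  (forall a, a \in r -> normc a <= rad^-1) -> normc (w - 1) < rad ->
  (1 - normc (w - 1) / rad) ^+ size r <= normc (linear_factors r).[w].
Proof.
move=> rad0 ra w1; rewrite linear_factors_horner.
have u0 : 0 <= 1 - normc (w - 1) / rad by rewrite subr_ge0 ler_pdivrMr ?mul1r // ltW.
elim: r ra => [|a r IH] ra; first by rewrite big_nil normc1 expr0.
rewrite big_cons normcM exprS /=; apply: ler_pM => //; first exact: exprn_ge0.
- have := le_normcD (1 + a * (w - 1)) (- (a * (w - 1))).
  rewrite addrK normc1 normcN normcM.
  have h : normc a * normc (w - 1) <= normc (w - 1) / rad.
    by rewrite mulrC ler_wpM2l ?normc_ge0 // ra // mem_head.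
  by move: h; lra.
- by apply: IH => b br; apply: ra; rewrite inE br orbT.
Qed.

Lemma le_normc_sum (J : finType) (f : J -> R[i]) :
  normc (\sum_j f j) <= \sum_j normc (f j).
Proof.
apply: (big_ind2 (fun (x : R[i]) (y : R) => normc x <= y)) => //; first by rewrite normc0.
by move=> x1 y1 x2 y2 h1 h2; apply: (le_trans (le_normcD _ _)); exact: lerD.
Qed.

Lemma cvg_weighted_sum (f : T -> I -> R) (g : I -> R) : (forall i, f t i @[t --> F] --> g i) ->
  (\sum_i q t i * f t i) @[t --> F] --> \sum_i p i * g i.
Proof.
move=> fg; apply: cvg_big => [|i _]; last by apply: cvgM.
exact: add_continuous.
Qed.

Lemma cvg_mean : mean (q t) S @[t --> F] --> mean p S.
Proof. by apply: cvg_weighted_sum => i; exact: cvg_cst. Qed.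

Lemma cvg_variance : variance (q t) S @[t --> F] --> variance p S.
Proof.
apply: cvg_weighted_sum => i; apply: cvgM; (apply: cvgB; first exact: cvg_cst).
  exact: cvg_mean.
exact: cvg_mean.
Qed.

Hypothesis q1 : \forall t \near F, \sum_i q t i = 1.

Lemma limit_total : \sum_i p i = 1.
Proof.
have : (\sum_i q t i * 1) @[t --> F] --> \sum_i p i * 1.
  by apply: cvg_weighted_sum => i; exact: cvg_cst.
under [X in _ --> X]eq_bigr do rewrite mulr1.
move=> h; apply/eqP; rewrite eq_le -lerN2; apply/andP; split.
  apply: (cvg_to_ge (cvgN h)); apply: filterS q1 => t qt.
  by under eq_bigr do rewrite mulr1; rewrite qt.
apply: (cvg_to_ge h); apply: filterS q1 => t qt.
by under eq_bigr do rewrite mulr1; rewrite qt.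
Qed.

(** A quantitative Hurwitz argument: at a zero w of the limit, the approximating polynomials are at
    most the sum of |q_i - p_i| |w|^(S_i), which tends to 0, against a lower bound u^n fixed along
    the filter. *)
Lemma limit_zero_free n (rad : R) : 0 < rad -> (forall i, S i <= n)%N ->
  (\forall t \near F, forall w, normc (w - 1) < rad -> (generating_poly (q t) S).[w] != 0) ->
  forall w, normc (w - 1) < rad -> (generating_poly p S).[w] != 0.
Proof.
move=> rad0 Sn zf w w1; apply/eqP => pw.
pose u := 1 - normc (w - 1) / rad.
have u0 : 0 < u by rewrite subr_gt0 ltr_pdivrMr ?mul1r.
have u1 : u <= 1 by rewrite gerBl divr_ge0 ?normc_ge0 // ltW.
have h : (\sum_i `|q t i - p i| * normc w ^+ S i) @[t --> F] --> \sum_(i : I) (0 : R).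
  apply: cvg_big => [|i _]; first exact: add_continuous.
  rewrite -[X in _ --> X](mul0r (normc w ^+ S i)); apply: cvgM; last exact: cvg_cst.
  rewrite -(@normr0 _ R); apply: cvg_norm; rewrite -(subrr (p i)).
  by apply: cvgB; [exact: qp|exact: cvg_cst].
have : u ^+ n <= \sum_(i : I) (0 : R).
  apply: (cvg_to_ge h); near=> t.
  have t1 : \sum_i q t i = 1 by near: t.
  have tz w' : normc (w' - 1) < rad -> (generating_poly (q t) S).[w'] != 0.
    by move: w'; near: t.
  have P1 : (generating_poly (q t) S).[1] = 1.
    rewrite generating_poly_horner; under eq_bigr do rewrite expr1n mulr1.
    by rewrite -rmorph_sum t1.
  have [r [Pr sr ra]] := poly_linear_factors rad0 P1 tz.
  have := linear_factors_lower rad0 ra w1; rewrite -Pr -/u => h1.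
  apply: (@le_trans _ _ (normc (generating_poly (q t) S).[w])).
    apply: le_trans h1; apply: ler_wiXn2l => //; first exact: ltW.
    by rewrite -ltnS sr size_generating_poly.
  rewrite -[X in normc X]subr0 -pw !generating_poly_horner -sumrB.
  apply: (le_trans (le_normc_sum _)); apply: ler_sum => i _.
  by rewrite -mulrBl normcM normcX -rmorphB normc_real.
by rewrite big1 // leNgt exprn_gt0.
Unshelve. all: by end_near.
Qed.

End Limits.

(** * The Ising model on the lattice *)

Section LatticeGraph.
Variable d : nat.
Implicit Types (i j : lattice d) (L : {fset lattice d}).

Lemma nearest_neighbour_sym i j : nearest_neighbour i j = nearest_neighbour j i.
Proof. by rewrite /nearest_neighbour; congr (_ == _); apply: eq_bigr => k _; rewrite distrC. Qed.

Lemma nearest_neighbour_irr i : nearest_neighbour i i = false.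
Proof. by rewrite /nearest_neighbour big1 // => k _; rewrite subrr normr0. Qed.

Lemma nearest_neighbour_coord i j k : nearest_neighbour i j ->
  `|j ord0 k - i ord0 k| <= 1.
Proof.
rewrite /nearest_neighbour (bigD1 k) //= distrC => /eqP <-.
by rewrite lerDl; apply: sumr_ge0.
Qed.

Definition graph_rel L : rel L := fun i j : L => nearest_neighbour (val i) (val j).

Lemma graph_rel_sym L : symmetric (@graph_rel L).
Proof. by move=> i j; exact: nearest_neighbour_sym. Qed.

Lemma graph_rel_irr L : irreflexive (@graph_rel L).
Proof. by move=> i; exact: nearest_neighbour_irr. Qed.

(** A neighbour is determined by its coordinate differences, which lie in {-1, 0, 1}; the shift by 1
    makes them elements of ['I_3]. *)
Lemma graph_rel_degree L (i : L) : (#|[set j | graph_rel i j]%SET| <= 3 ^ d)%N.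
Proof.
pose g (j : L) : {ffun 'I_d -> 'I_3} :=
  [ffun k => inord (absz (val j ord0 k - val i ord0 k + 1))].
have -> : (3 ^ d)%N = #|{ffun 'I_d -> 'I_3}| by rewrite card_ffun !card_ord.
apply: (@leq_trans #|g @: [set j | graph_rel i j]%SET|); last exact: max_card.
rewrite card_in_imset // => j j'; rewrite !inE => ij ij' gjj'.
apply/val_inj/rowP => k.
have := congr1 (fun f : {ffun 'I_d -> 'I_3} => val (f k)) gjj'; rewrite !ffunE.
have h (u : L) : graph_rel i u -> (0 <= val u ord0 k - val i ord0 k + 1 <= 2)%R.
  move=> /(nearest_neighbour_coord k); rewrite ler_norml => /andP[h1 h2].
  by rewrite -lerBlDr sub0r h1 /= -lerBrDr.
have h3 (u : int) : (0 <= u <= 2)%R -> ((inord (absz u) : 'I_3) : nat) = absz u :> nat.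
  move=> /andP[u0 u2]; rewrite inordK //.
  by move: u0 u2; case: u => // m _; rewrite lez_nat.
move=> /=; rewrite !h3 ?h //.
have /andP[p1 _] := h _ ij; have /andP[p2 _] := h _ ij'.
move=> /(congr1 Posz); rewrite !gez0_abs // => /addIr/addIr.
by rewrite !ord1.
Qed.

End LatticeGraph.

Section FiniteVolume.
Variables (R : realType) (d : nat) (beta h : R) (L : {fset lattice d}).
Hypothesis beta_ge0 : 0 <= beta.
Implicit Types (s : {ffun L -> bool}) (X : {set L}).

Local Notation E := (@graph_rel d L).
Local Notation b := (expR (- beta)).
Local Notation lam := (expR (2 * h)).
Local Notation gibbs := (gibbs_weight E b lam).

Definition plus_set s : {set L} := [set i | s i]%SET.

Lemma interaction_b_itv : 0 < b <= 1.
Proof. by rewrite expR_gt0 -expR0 ler_expR oppr_le0. Qed.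

Let f s (i j : L) : R := spin R (s i) * spin R (s j).

Lemma edge_sum s :
  2 * \sum_(e : {set L} | is_edge e) \prod_(i in e) spin R (s i) =
  \sum_i \sum_(j | E i j) f s i j.
Proof.
rewrite pair_big_dep /=.
rewrite (partition_big (fun p : L * L => [set p.1; p.2]%SET) (@is_edge d L)) /=; last first.
  move=> p ep; apply/existsP; exists p.1; apply/existsP; exists p.2.
  by apply/andP; split; [exact: ep|exact: eqxx].
rewrite mulr_sumr; apply: eq_bigr => e /existsP[x /existsP[y /andP[xy /eqP ->]]].
have xny : x != y by apply: contraTneq xy => ->; rewrite nearest_neighbour_irr.
rewrite big_setU1 ?inE //= big_set1.
rewrite (bigD1 (x, y)) /=; last by rewrite eqxx andbT.
rewrite (bigD1 (y, x)) /=; last first.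
  rewrite /graph_rel nearest_neighbour_sym xy finset.setUC eqxx /=.
  by apply: contraNneq xny => -[->].
rewrite big1 ?addr0 => [|p]; first by rewrite /f /=; ring.
rewrite -!andbA => /and4P[ep /eqP pxy p1 p2]; exfalso.
have h1 : p.1 \in [set x; y]%SET by rewrite -pxy !inE eqxx.
have h2 : p.2 \in [set x; y]%SET by rewrite -pxy !inE eqxx orbT.
have pn : p.1 != p.2 by apply: contraTneq ep => ->; rewrite graph_rel_irr.
move: h1 h2 p1 p2 pn; case: (p) => u v /=; rewrite !inE !xpair_eqE.
by move=> /orP[]/eqP -> /orP[]/eqP ->; rewrite ?eqxx.
Qed.

(** Each edge is spread over its two ordered pairs with exponent beta / 2, and exp(- beta/2) =
    exp(beta/2) exp(- beta) for a disagreeing pair. The prefactor does not depend on the spins, so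
    it cancels upon normalization. *)
Lemma expR_hamiltonian s :
  expR (- hamiltonian beta h s) =
  expR (- h * #|{: L}|%:R) * (\prod_(i : L) \prod_(j | E i j) expR (beta / 2)) *
  gibbs (plus_set s).
Proof.
rewrite /hamiltonian opprB mulNr opprK.
have -> : beta * (\sum_(e : {set L} | is_edge e) \prod_(i in e) spin R (s i)) =
    \sum_i \sum_(j | E i j) beta / 2 * f s i j.
  under [RHS]eq_bigr do rewrite -mulr_sumr.
  by rewrite -mulr_sumr -edge_sum; field.
have -> : \sum_(i : L) spin R (s i) = 2 * #|plus_set s|%:R - #|{: L}|%:R.
  have -> : #|plus_set s|%:R = \sum_(i : L) (s i)%:R :> R.
    rewrite -sum1_card natr_sum big_mkcond; apply: eq_bigr => i _ /=.
    by rewrite inE; case: (s i).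
  have -> : #|{: L}|%:R = \sum_(i : L) 1 :> R by rewrite sumr_const.
  rewrite mulr_sumr -sumrB; apply: eq_bigr => i _.
  by rewrite /spin; case: (s i) => /=; ring.
rewrite expRD.
have -> : expR (\sum_i \sum_(j | E i j) beta / 2 * f s i j) =
    (\prod_(i : L) \prod_(j | E i j) expR (beta / 2)) * ising_weight E b (plus_set s).
  rewrite expR_sum /ising_weight /pair_weight [X in _ = _ * X](eq_bigl predT) => [|i]; last by rewrite inE.
  rewrite -big_split /=; apply: eq_bigr => i _; rewrite expR_sum.
  rewrite [X in _ = _ * X](eq_bigl predT) => [|j]; last by rewrite inE.
  rewrite -big_mkcond /= -big_split /=; apply: eq_bigr => j ij.
  rewrite /f /edge_weight !inE /spin.
  by case: (s i); case: (s j) => /=; rewrite ?mulr1 -?expRD; congr expR; field.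
have -> : expR (h * (2 * #|plus_set s|%:R - #|{: L}|%:R)) =
    expR (- h * #|{: L}|%:R) * lam ^+ #|plus_set s|.
  by rewrite -expRM_natr -expRD; congr expR; ring.
exact: mulrACA.
Qed.

End FiniteVolume.

Section LocalConfigurations.
Import Normc.
Variables (d : nat) (D : {fset lattice d}).

Definition extend (eta : {ffun D -> bool}) : lattice d -> bool :=
  fun i => if insub i is Some k then eta k else false.

Definition restriction (w : lattice d -> bool) : {ffun D -> bool} :=
  [ffun k => w (val k)].

Definition plus_count (eta : {ffun D -> bool}) : nat := #|[set k | eta k]%SET|.

Lemma extendE eta (k : D) : extend eta (val k) = eta k.
Proof. by rewrite /extend valK. Qed.

Lemma plus_count_le eta : (plus_count eta <= #|` D|)%N.
Proof. by rewrite cardfE; exact: max_card. Qed.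

Lemma cylinder_extend eta w : cylinder D (extend eta) w <-> restriction w = eta.
Proof.
split => [h|<- i iD].
  by apply/ffunP => k; rewrite ffunE h ?extendE //; exact: fsvalP.
have -> : i = val [` iD]%fset by [].
by rewrite extendE ffunE.
Qed.

End LocalConfigurations.

Section FiniteVolumeExpectation.
Import Normc.
Variables (R : realType) (d : nat) (beta h : R) (L D : {fset lattice d}).
Hypothesis beta_ge0 : 0 <= beta.
Hypothesis DL : (D `<=` L)%fset.
Local Notation E := (@graph_rel d L).
Local Notation b := (expR (- beta)).
Local Notation lam := (expR (2 * h)).
Local Notation gibbs := (gibbs_weight E b lam).
Local Notation pi := (fun eta : {ffun D -> bool} => ising_cylinder beta h D (extend eta) L).
Local Notation S := (@plus_count d D).

Let lam0 : 0 < lam. Proof. exact: expR_gt0. Qed.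

Definition gibbs_total : R := \sum_X gibbs X.

Lemma gibbs_total_gt0 : 0 < gibbs_total.
Proof.
rewrite /gibbs_total (bigD1 finset.set0) //=; apply: ltr_pwDl.
  exact: (gibbs_weight_gt0 _ (interaction_b_itv beta_ge0) lam0).
apply: sumr_ge0 => X _; apply: ltW.
exact: (gibbs_weight_gt0 _ (interaction_b_itv beta_ge0) lam0).
Qed.

Lemma sum_plus_set (K : nmodType) (F : {set L} -> K) :
  \sum_(s : {ffun L -> bool}) F (plus_set s) = \sum_X F X.
Proof.
pose g (X : {set L}) : {ffun L -> bool} := [ffun i => i \in X].
rewrite (reindex_onto g (@plus_set d L)) /=; last first.
  by move=> s _; apply/ffunP => i; rewrite ffunE inE.
have gK X : plus_set (g X) = X by apply/setP => i; rewrite inE ffunE.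
by apply: eq_big => [X|X _]; rewrite gK ?eqxx.
Qed.

Lemma ising_pmfE s : ising_pmf beta h s = gibbs (plus_set s) / gibbs_total.
Proof.
rewrite /ising_pmf /partition_function.
under [X in _ / X]eq_bigr do rewrite expR_hamiltonian //.
rewrite -mulr_sumr (sum_plus_set (fun X => gibbs X)) expR_hamiltonian //.
rewrite -mulf_div divff ?mul1r // mulf_neq0 ?gt_eqF ?expR_gt0 //.
by apply: prodr_gt0 => i _; apply: prodr_gt0 => j _; exact: expR_gt0.
Qed.

Lemma plus_count_restriction (s : {ffun L -> bool}) :
  S (restriction D (extend s)) = #|(plus_set s :&: fsub L D)%SET|.
Proof.
rewrite /plus_count -(card_imset _ (@fincl_inj _ _ _ DL)); congr #|pred_of_set _|.
apply/setP => i; rewrite !inE; apply/imsetP/andP => [[k]|[si iD]].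
  rewrite inE ffunE => sk ->; split; last exact: fsvalP.
  have -> : s (fincl DL k) = extend s (val (fincl DL k)) by rewrite extendE.
  exact: sk.
exists [` iD]%fset; last exact/val_inj.
by rewrite inE ffunE /= extendE.
Qed.

(** The ring morphism lets one identity serve the real moments and the complex generating
    function. *)
Lemma local_expectation (K : comNzRingType) (phi : {rmorphism R -> K}) (G : nat -> K) :
  \sum_eta phi (pi eta) * G (S eta) =
  phi gibbs_total^-1 * \sum_X phi (gibbs X) * G #|(X :&: fsub L D)%SET|.
Proof.
transitivity (\sum_(s : {ffun L -> bool}) phi (ising_pmf beta h s) *
    G #|(plus_set s :&: fsub L D)%SET|); last first.
  rewrite -(sum_plus_set (fun X => phi (gibbs X) * G #|(X :&: fsub L D)%SET|)) mulr_sumr.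
  by apply: eq_bigr => s _; rewrite ising_pmfE rmorphM [RHS]mulrA [phi _^-1 * _]mulrC.
rewrite (partition_big (fun s : {ffun L -> bool} => restriction D (extend s)) predT) //=.
apply: eq_bigr => eta _; rewrite /ising_cylinder rmorph_sum mulr_suml.
apply: eq_big => [s|s /forallP hs].
  apply/forallP/eqP => [hs|<- i].
    apply/ffunP => k; rewrite ffunE; have kL : val k \in L by apply: (fsubsetP DL); exact: fsvalP.
    have := hs [` kL]%fset; rewrite /= fsvalP /= => /eqP; rewrite extendE => <-.
    by rewrite -[RHS](extendE s [` kL]%fset).
  apply/implyP => iD; apply/eqP.
  have -> : val i = val [` iD]%fset by [].
  by rewrite extendE ffunE /= extendE.
congr (_ * G _); rewrite -plus_count_restriction; congr S.
apply/ffunP => k; rewrite ffunE; have kL : val k \in L by apply: (fsubsetP DL); exact: fsvalP.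
have := hs [` kL]%fset; rewrite /= fsvalP /= => /eqP; rewrite extendE => <-.
by rewrite -[LHS](extendE s [` kL]%fset).
Qed.

Lemma local_total : \sum_eta pi eta = 1.
Proof.
have := local_expectation (@idfun R) (fun=> 1); rewrite /=.
under eq_bigr do rewrite mulr1.
move=> ->; under eq_bigr do rewrite mulr1.
by rewrite -/gibbs_total mulVf // gt_eqF // gibbs_total_gt0.
Qed.

Lemma local_generating_poly (w : R[i]) :
  (generating_poly pi S).[w] =
  (gibbs_total^-1)%:C%C * ising_poly E b (site_field lam (fsub L D) w).
Proof.
rewrite generating_poly_horner.
rewrite (local_expectation (real_complex R) (fun n => w ^+ n)); congr (_ * _).
apply: eq_bigr => X _; rewrite /gibbs_weight rmorphM /= mulrAC mulrC; congr (_ * _).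
rewrite /site_field big_split /= prodr_const rmorphXn /=; congr (_ * _).
rewrite -big_mkcondr /= prodr_const; congr (_ ^+ _); apply: eq_card => i.
by rewrite finset.in_setI.
Qed.

Lemma local_variance_ge (deg : nat) : (3 ^ d <= deg)%N ->
  (flip_rate b lam deg / (1 + flip_rate b lam deg) / 2) ^+ 2 / (deg.+1)%:R * #|` D|%:R <=
  variance pi S.
Proof.
move=> hdeg; set m := mean pi S.
have hd i : (#|[set j | E i j]%SET| <= deg)%N := leq_trans (graph_rel_degree i) hdeg.
have e0 : \sum_X gibbs X * (#|(X :&: fsub L D)%SET|%:R - m) = 0.
  have := local_expectation (@idfun R) (fun n => n%:R - m); rewrite /=.
  have -> : \sum_eta pi eta * ((S eta)%:R - m) = 0.
    under eq_bigr do rewrite mulrBr.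
    by rewrite sumrB -mulr_suml local_total mul1r subrr.
  by move/esym/eqP; rewrite mulf_eq0 invr_eq0 gt_eqF ?gibbs_total_gt0 //= => /eqP.
have := gibbs_variance_lower_bound (@graph_rel_sym d L) (@graph_rel_irr d L)
  (interaction_b_itv beta_ge0) lam0 hd e0.
rewrite -/gibbs_total card_fsub // -ler_pdivlMr ?gibbs_total_gt0 // => /le_trans; apply.
rewrite /variance (local_expectation (@idfun R) (fun n => (n%:R - m) ^+ 2)) /=.
by rewrite mulrC.
Qed.

End FiniteVolumeExpectation.

Section Exhaustion.
Variable d : nat.

Lemma exhaustion_proper_filter : ProperFilter (@exhaustion d).
Proof.
apply: filter_from_proper; last by move=> L0 _; exists L0; exact: fsubset_refl.
apply: filter_fromT_filter; first by exists fset0.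
move=> L1 L2; exists (L1 `|` L2)%fset => L /=.
by rewrite fsubUset => /andP[].
Qed.

Lemma near_exhaustion (D : {fset lattice d}) : \forall L \near @exhaustion d, (D `<=` L)%fset.
Proof. by exists D. Qed.

End Exhaustion.

Section Law.
Variables (R : realType) (d : nat) (mu : probability (configuration d) R) (D : {fset lattice d}).
Local Notation S := (@plus_count d D).

Definition local_law (eta : {ffun D -> bool}) : R := fine (mu (cylinder D (extend eta))).
Local Notation pi := local_law.

Lemma measurable_cylinder (eta : lattice d -> bool) :
  measurable (cylinder D eta : set (configuration d)).
Proof. by apply: sub_sigma_algebra; exists D, eta. Qed.

Lemma restriction_sum (G : {ffun D -> bool} -> R) (w : configuration d) :
  G (restriction D w) = \sum_eta G eta * \1_(cylinder D (extend eta)) w.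
Proof.
rewrite (bigD1 (restriction D w)) //= indicE mem_set; last exact/cylinder_extend.
rewrite mulr1 big1 ?addr0 // => eta ne.
rewrite indicE memNset ?mulr0 // => /cylinder_extend e.
by rewrite e eqxx in ne.
Qed.

Lemma measurable_restriction (G : {ffun D -> bool} -> R) :
  measurable_fun setT (fun w : configuration d => G (restriction D w)).
Proof.
rewrite (_ : (fun w => _) = (fun w : configuration d => \sum_eta G eta * \1_(cylinder D (extend eta)) w)).
  apply: measurable_sum => eta; apply: measurable_funM => //.
  by apply: measurable_indic; exact: measurable_cylinder.
by apply/funext => w; rewrite restriction_sum.
Qed.

Lemma integrable_restriction (G : {ffun D -> bool} -> R) :
  mu.-integrable setT (EFin \o (fun w : configuration d => G (restriction D w))).
Proof.
apply: measurable_bounded_integrable => //.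
- by rewrite -ge0_fin_numE // fin_num_measure.
- exact: measurable_restriction.
- exists (\sum_eta `|G eta|); split; first exact: num_real.
  move=> M ltM w _ /=; apply: le_trans (ltW ltM).
  by rewrite (bigD1 (restriction D w)) //= lerDl sumr_ge0.
Qed.

Lemma integral_restriction (G : {ffun D -> bool} -> R) :
  (\int[mu]_w (G (restriction D w))%:E = (\sum_eta pi eta * G eta)%:E)%E.
Proof.
have mc eta := measurable_cylinder (extend eta).
under eq_integral do rewrite restriction_sum -sumEFin.
rewrite integral_sum //; last first.
  move=> eta; have -> : (fun w : configuration d => (G eta * \1_(cylinder D (extend eta)) w)%:E) =
     (fun w => (G eta)%:E * (\1_(cylinder D (extend eta)) w)%:E)%E.
    by apply/funext => w; rewrite EFinM.
  by apply: integrableZl => //; exact: integrable_indic.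
rewrite -sumEFin; apply: eq_bigr => eta _.
under eq_integral do rewrite EFinM.
rewrite integralZl //; last exact: integrable_indic.
rewrite integral_indic // setIT muleC EFinM fineK //.
exact: fin_num_measure.
Qed.

Hypothesis pi1 : \sum_eta pi eta = 1.

Lemma magnetizationE (w : configuration d) :
  magnetization R D w = 2 * (S (restriction D w))%:R - #|` D|%:R.
Proof.
have -> : #|` D|%:R = \sum_(k : D) 1 :> R by rewrite sumr_const cardfE.
rewrite /magnetization big_seq_fsetE /= /plus_count -sum1_card natr_sum.
rewrite [X in 2 * X]big_mkcond /= mulr_sumr -sumrB; apply: eq_bigr => k _.
by rewrite inE ffunE /spin; case: (w _) => /=; ring.
Qed.

Lemma expectation_magnetization :
  ('E_mu[magnetization R D])%E = (2 * mean pi S - #|` D|%:R)%:E.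
Proof.
rewrite unlock; under eq_integral do rewrite magnetizationE.
rewrite (integral_restriction (fun eta => 2 * (S eta)%:R - #|` D|%:R)); congr EFin.
under eq_bigr do rewrite mulrBr mulrCA.
by rewrite sumrB -mulr_sumr -mulr_suml pi1 mul1r.
Qed.

Lemma variance_magnetization :
  ('V_mu[magnetization R D])%E = (4 * variance pi S)%:E.
Proof.
rewrite /random_variable.variance unlock expectation_magnetization /= unlock.
set G := fun eta => 2 * (S eta)%:R - #|` D|%:R - (2 * mean pi S - #|` D|%:R).
transitivity (\int[mu]_w ((fun eta => G eta * G eta) (restriction D w))%:E)%E.
  by apply: eq_integral => w _; rewrite /G -magnetizationE.
rewrite (integral_restriction (fun eta => G eta * G eta)) /G; congr EFin.
rewrite /variance mulr_sumr; apply: eq_bigr => eta _; ring.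
Qed.

(** The magnetization is 2 S - |D|, an increasing affine function of the number of plus spins, and
    standardization does not see such a change. *)
Lemma standardizeE (w : configuration d) :
  standardize (P := mu) (magnetization R D) w =
  ((S (restriction D w))%:R - mean pi S) / Num.sqrt (variance pi S).
Proof.
rewrite /standardize expectation_magnetization variance_magnetization /= magnetizationE.
have -> : Num.sqrt (4 * variance pi S) = 2 * Num.sqrt (variance pi S).
  by rewrite sqrtrM // -[4]/((2 * 2)%N%:R) natrM -expr2 sqrtr_sqr ger0_norm.
have -> : 2 * (S (restriction D w))%:R - #|` D|%:R - (2 * mean pi S - #|` D|%:R) =
  2 * ((S (restriction D w))%:R - mean pi S) by ring.
by rewrite -mulf_div divff // mul1r.
Qed.

Lemma cdf_standardize (a : R) :
  cdf (standardize (P := mu) (magnetization R D) : {RV mu >-> R}) a =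
  (\int[mu]_w (standardize (P := mu) (magnetization R D) w <= a)%R%:R)%:E.
Proof.
rewrite /cdf /distribution /pushforward /Rintegral.
set A := _ @^-1` _.
have mA : measurable A.
  rewrite -[A]setTI; apply: (measurable_standardize _ _ (measurable_itv _)); exact: measurableT.
under eq_integral => w _.
  have -> : ((standardize (P := mu) (magnetization R D) w <= a)%R%:R : R) =
     \1_A w.
    rewrite indicE; congr (_%:R); congr nat_of_bool; apply/idP/idP => [h|].
      by apply: mem_set; rewrite /A /= in_itv.
    by move=> /set_mem; rewrite /A /= in_itv.
  over.
rewrite integral_indic // setIT fineK //; exact: fin_num_measure.
Qed.

End Law.

Lemma cdf_std_gaussian (R : realType) (a : R) :
  cdf (std_gaussian R) a =
  (weighted_cdf lebesgue_measure (@normal_pdf R 0 1) id a)%:E.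
Proof.
rewrite /cdf /distribution /pushforward /weighted_cdf /Rintegral.
set A := _ @^-1` _.
suff -> : (\int[lebesgue_measure]_x ((x <= a)%R%:R * normal_pdf 0 1 x)%:E)%E = normal_prob 0 1 A.
  rewrite fineK //; apply: fin_num_measure.
  by rewrite -[A]setTI; apply: (@measurable_id _ _ setT measurableT _ (measurable_itv _)).
rewrite /normal_prob [RHS]integral_mkcond; apply: eq_integral => x _.
rewrite patchE.
have -> : (x \in A) = (x <= a).
  apply/idP/idP => [/set_mem|h]; first by rewrite /A /= in_itv.
  by apply: mem_set; rewrite /A /= in_itv.
by case: (x <= a); rewrite ?mul1r ?mul0r.
Qed.

Import Normc.

Definition variance_rate (R : realType) (d : nat) (beta h : R) : R :=
  let q := flip_rate (expR (- beta)) (expR (2 * h)) (3 ^ d) in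
  (q / (1 + q) / 2) ^+ 2 / (3 ^ d).+1%:R.

Lemma variance_rate_gt0 (R : realType) (d : nat) (beta h : R) :
  0 <= beta -> 0 < variance_rate d beta h.
Proof.
move=> b0; rewrite /variance_rate; set q := flip_rate _ _ _.
have q0 : 0 < q by apply: flip_rate_gt0; [exact: interaction_b_itv|exact: expR_gt0].
by rewrite divr_gt0 ?exprn_gt0 ?divr_gt0 // addr_gt0.
Qed.

(** The disc and the variance bound pass to the limit first, and the Berry-Esseen bound is applied
    once, under [mu]; the constant therefore depends on neither [mu] nor [D]. *)
Lemma kolmogorov_dist_magnetization (R : realType) (d : nat) (beta h rad : R)
    (mu : probability (configuration d) R) (D : {fset lattice d}) :
  0 <= beta -> 0 < rad -> infinite_volume_ising beta h mu -> D != fset0 ->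
  (forall L w, normc (w - 1) < rad ->
     ising_poly (@graph_rel d L) (expR (- beta)) (site_field (expR (2 * h)) (fsub L D) w) != 0) ->
  (kolmogorov_dist (P := mu) (standardize (P := mu) (magnetization R D)) (std_gaussian R)
    <= (berry_esseen_constant rad (variance_rate d beta h) / Num.sqrt (#|` D|)%:R)%:E)%E.
Proof.
move=> beta0 rad0 lim D0 zf; have FF := exhaustion_proper_filter d.
pose q (L : {fset lattice d}) (eta : {ffun D -> bool}) : R :=
  ising_cylinder beta h D (extend eta) L.
pose pi := @local_law R d mu D; pose S := @plus_count d D.
have qpi eta : q L eta @[L --> @exhaustion d] --> pi eta by exact: lim.
have DL := near_exhaustion D.
have q1 : \forall L \near @exhaustion d, \sum_eta q L eta = 1.
  by apply: filterS DL => L; exact: (local_total h beta0).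
have pi1 : \sum_eta pi eta = 1 := limit_total (FF := FF) qpi q1.
have zfq : \forall L \near @exhaustion d, forall w, normc (w - 1) < rad ->
    (generating_poly (q L) S).[w] != 0.
  apply: filterS DL => L DL w w1; rewrite (local_generating_poly beta h DL).
  rewrite mulf_neq0 ?zf // fmorph_eq0 invr_eq0 gt_eqF // gibbs_total_gt0 //.
have zfpi w : normc (w - 1) < rad -> (generating_poly pi S).[w] != 0.
  exact: (limit_zero_free (FF := FF) qpi q1 rad0 (@plus_count_le d D) zfq).
have vpi : variance_rate d beta h * #|` D|%:R <= variance pi S.
  apply: (cvg_to_ge (FF := FF) (cvg_variance (FF := FF) (S := S) qpi)).
  apply: filterS DL => L DL.
  exact: (local_variance_ge h beta0 DL (leqnn _)).
have cardD : (0 < #|` D|)%N by rewrite cardfs_gt0.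
have mX := measurable_standardize (P := mu) (magnetization R D).
have XE : standardize (P := mu) (magnetization R D) =
    fun w => ((S (restriction D w))%:R - mean pi S) / Num.sqrt (variance pi S).
  by apply/funext => w; exact: standardizeE.
have iX : mu.-integrable setT (EFin \o standardize (P := mu) (magnetization R D)).
  rewrite XE.
  exact: (integrable_restriction mu (fun eta => ((S eta)%:R - mean pi S) / Num.sqrt (variance pi S))).
have law f : measurable_fun setT f ->
    \int[mu]_w f (standardize (P := mu) (magnetization R D) w) =
    \sum_eta pi eta * f (((S eta)%:R - mean pi S) / Num.sqrt (variance pi S)).
  by move=> _; rewrite XE /Rintegral (integral_restriction mu
    (fun eta => f (((S eta)%:R - mean pi S) / Num.sqrt (variance pi S)))).
apply: ge_ereal_sup => _ [a _ <-].
rewrite (cdf_standardize mu) cdf_std_gaussian -EFinB lee_fin.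
exact: (berry_esseen_zero_free cardD rad0 (variance_rate_gt0 _ _ beta0) mX iX pi1
  (@plus_count_le d D) zfpi vpi law).
Qed.

Theorem proposition49 (R : realType) (d : nat) (hd : (1 <= d)%N) :
  (forall beta h : R, h != 0 -> 0 < beta ->
     exists K : R, forall mu : probability (configuration d) R,
       infinite_volume_ising beta h mu ->
       forall D : {fset lattice d}, D != fset0 ->
         (kolmogorov_dist (P := mu)
            (standardize (P := mu) (magnetization R D)) (std_gaussian R)
          <= (K / Num.sqrt (#|` D|)%:R)%:E)%E)
  /\
  (exists beta1 : R, 0 < beta1 /\
     forall beta : R, 0 < beta -> beta < beta1 ->
     exists K : R, forall mu : probability (configuration d) R,
       infinite_volume_ising beta 0 mu ->
       forall D : {fset lattice d}, D != fset0 ->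
         (kolmogorov_dist (P := mu)
            (standardize (P := mu) (magnetization R D)) (std_gaussian R)
          <= (K / Num.sqrt (#|` D|)%:R)%:E)%E).
Proof.
split=> [beta h h0 beta0|].
  have bge0 := ltW beta0; have bI := interaction_b_itv bge0.
  (* The sign of h decides on which side of the unit circle the fugacity exp(2h) lies. *)
  have [hlt|hgt|] := ltgtP h 0; last by move/eqP; rewrite (negbTE h0).
    have lam1 : expR (2 * h) < 1 by rewrite -expR0 ltr_expR pmulr_rlt0.
    have rad0 : 0 < 1 - expR (2 * h) by rewrite subr_gt0.
    exists (berry_esseen_constant (1 - expR (2 * h)) (variance_rate d beta h)) => mu lim D D0.
    apply: kolmogorov_dist_magnetization lim D0 _ => // L w.
    apply: (ising_zero_free_small (@graph_rel_irr d L) bI).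
    by rewrite expR_gt0.
  have lam1 : 1 < expR (2 * h) by rewrite -expR0 ltr_expR mulr_gt0.
  have rad0 : 0 < 1 - (expR (2 * h))^-1 by rewrite subr_gt0 invf_lt1 ?expR_gt0.
  exists (berry_esseen_constant (1 - (expR (2 * h))^-1) (variance_rate d beta h)) => mu lim D D0.
  apply: kolmogorov_dist_magnetization lim D0 _ => // L w.
  exact: (ising_zero_free_large (@graph_rel_irr d L) bI).
(* The largest slope allowed by the high-temperature induction for degree 3^d. *)
pose eps : R := (2 * (3 ^ d).+1%:R)^-1.
have eps0 : 0 < eps by rewrite invr_gt0 mulr_gt0.
(* For beta < 1/4, exp(2 beta) <= 2, so exp(2 beta) - exp(-2 beta) <= 4 beta + 2 beta = 6 beta,
   which must stay below eps. *)
exists (Num.min 4^-1 (eps / 6)); split; first by rewrite lt_min invr_gt0 divr_gt0 // ltr0n.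
move=> beta beta0; rewrite lt_min => /andP[beta4 beta6].
have bge0 := ltW beta0; have bI := interaction_b_itv bge0.
exists (berry_esseen_constant (eps / 2) (variance_rate d beta 0)) => mu lim D D0.
apply: kolmogorov_dist_magnetization lim D0 _ => //; first by rewrite divr_gt0.
move=> L w; rewrite mulr0 expR0.
apply: (ising_zero_free_high_temperature (@graph_rel_sym d L) (@graph_rel_irr d L) bI
  _ (@graph_rel_degree d L) eps0).
- rewrite -expRM_natr -expRN.
  have -> : - (- beta * 2) = 2 * beta by ring.
  have e1 := expR_sub1_le (2 * beta).
  have e2 : expR (2 * beta) <= 2 by apply: expR_half_le2; lra.
  have := expR_ge1Dx (- beta * 2).
  have : 2 * beta * expR (2 * beta) <= 2 * beta * 2 by rewrite ler_pM2l //; lra.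
  lra.
- by rewrite mulfV // gt_eqF // mulr_gt0.
Qed.
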